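(* Assume Conditions $\mathcal M$. Then, as $\varepsilon\to0$, the pseudo-MLE $\hat\vartheta_\varepsilon$ converges in probability to $\hat\vartheta$, $$\frac{\hat\vartheta_\varepsilon-\hat\vartheta}{\varepsilon^{2/3}}\Longrightarrow\hat u,$$ and for every $p>0$, $$\lim_{\varepsilon\to0}\mathbf E_{\vartheta_0}\Big|\frac{\hat\vartheta_\varepsilon-\hat\vartheta}{\varepsilon^{2/3}}\Big|^p=\mathbf E|\hat u|^p.$$
   Context: Fix $T>0$, $0<\alpha<\beta<T$, $\Theta=(\alpha,\beta)$, and a true value $\vartheta_0\in\Theta$. The observed process is $X_t=\int_0^tS(\vartheta_0,s)\,ds+\varepsilon W_t$, $0\le t\le T$, where $W$ is a standard Wiener process, $\varepsilon\in(0,1]$ and $S(\vartheta_0,\cdot)\in L^2(0,T)$. The statistician uses the misspecified model ${\rm d}X_t=M(\vartheta,t){\rm d}t+\varepsilon{\rm d}W_t$ with $M(\vartheta,t)=h(t)\mathbf 1_{\{t<\vartheta\}}+g(t)\mathbf 1_{\{t\ge\vartheta\}}$, where $h,g$ are bounded measurable functions on $[0,T]$. The pseudo-likelihood is $V(\vartheta,X^T)=\exp\{\varepsilon^{-2}\int_0^TM(\vartheta,t){\rm d}X_t-\frac1{2\varepsilon^2}\int_0^TM(\vartheta,t)^2{\rm d}t\}$, and the pseudo-MLE $\hat\vartheta_\varepsilon$ is a (measurable) point of maximum of $V(\cdot,X^T)$ over $[\alpha,\beta]$. Put $\delta(t)=h(t)-g(t)$, $\Phi(\vartheta)=\int_0^T[M(\vartheta,t)-S(\vartheta_0,t)]^2{\rm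 d}t$, and $$\ddot\Phi(\vartheta)=2[h(\vartheta)-S(\vartheta_0,\vartheta)][h'(\vartheta)-\partial_tS(\vartheta_0,\vartheta)]-2[g(\vartheta)-S(\vartheta_0,\vartheta)][g'(\vartheta)-\partial_tS(\vartheta_0,\vartheta)]$$ (primes and $\partial_t$ denote derivatives in $t$). Conditions $\mathcal M$: (1) $\inf_{t\in\Theta}\delta(t)>0$; (2) $\Phi$ has a unique point of minimum $\hat\vartheta=\hat\vartheta(\vartheta_0)$ over $\vartheta\in\Theta$ (and $\inf_\Theta\Phi=\Phi(\hat\vartheta)$); (3) $h,g$ and $t\mapsto S(\vartheta_0,t)$ are continuously differentiable in $t$ on $\Theta$; (4) $\inf_{\vartheta\in\Theta}\ddot\Phi(\vartheta)>0$. Set $\gamma(\hat\vartheta)=\ddot\Phi(\hat\vartheta)/2$ and $\hat u=\arg\sup_{u\in\mathbb R}[\delta(\hat\vartheta)W(u)-\frac{\gamma(\hat\vartheta)}2u^2]$, where $W(\cdot)$ is a two-sided standard Wiener process on $\mathbb R$ (i.e. $W(u)=W_+(u)$ for $u\ge0$, $W(u)=W_-(-u)$ for $u<0$, with $W_\pm$ independent standard Wiener processes). *)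

(* Defs.v *)
From HB Require Import structures.
From mathcomp Require Import all_boot all_order all_algebra.
From mathcomp Require Import all_classical all_reals all_analysis.
Set Implicit Arguments.
Unset Strict Implicit.
Unset Printing Implicit Defensive.
Import Order.TTheory GRing.Theory Num.Def Num.Theory.
Import numFieldNormedType.Exports.
Local Open Scope classical_set_scope.
Local Open Scope ring_scope.

Definition indep_rvs {R : realType} {d : measure_display} {Omega : measurableType d}
  (P : probability Omega R) (n : nat) (X : nat -> Omega -> R) : Prop :=
  forall B : nat -> set R, (forall i, measurable (B i)) ->
    P (\bigcap_(i in `I_n) (X i @^-1` B i)) = (\prod_(i < n) P (X i @^-1` B i))%E.

(* W is a standard Wiener process indexed by the time set D (D contains 0):
   W 0 = 0 and continuous paths (a.s.), and for every increasing finite family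
   of times in D the increments are independent, centered Gaussian with
   variance the length of the time interval.  With D = [0,T] this is the
   standard Wiener process on [0,T]; with D = R it is the two-sided one. *)
Definition is_wiener {R : realType} {d : measure_display} {Omega : measurableType d}
  (P : probability Omega R) (D : set R) (W : R -> Omega -> R) : Prop :=
  D 0 /\
  (forall t, D t -> measurable_fun setT (W t)) /\
  {ae P, forall w, W 0 w = 0 /\ {within D, continuous (fun t => W t w)}} /\
  (forall (n : nat) (ts : nat -> R),
     (forall i, (i <= n)%N -> D (ts i)) ->
     (forall i, (i < n)%N -> ts i < ts i.+1) ->
     indep_rvs P n (fun i w => W (ts i.+1) w - W (ts i) w) /\
     (forall i, (i < n)%N -> forall B : set R, measurable B ->
        P ((fun w => W (ts i.+1) w - W (ts i) w) @^-1` B)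
        = normal_prob 0 (Num.sqrt (ts i.+1 - ts i)) B)).

(* Step functions on [0,T]: a list of triples (a,b,c) stands for
   sum c * 1_[a,b), with 0 <= a <= b <= T. *)
Definition step_ok {R : realType} (T : R) (s : seq (R * R * R)) : bool :=
  all (fun x => (0 <= x.1.1) && (x.1.1 <= x.1.2) && (x.1.2 <= T)) s.

Definition stepf {R : realType} (s : seq (R * R * R)) (t : R) : R :=
  \sum_(x <- s) (if (x.1.1 <= t) && (t < x.1.2) then x.2 else 0).

Definition stepW {R : realType} {Omega : Type} (W : R -> Omega -> R)
  (s : seq (R * R * R)) (w : Omega) : R :=
  \sum_(x <- s) x.2 * (W x.1.2 w - W x.1.1 w).

Definition is_wiener_integral {R : realType} {d : measure_display}
  {Omega : measurableType d} (P : probability Omega R) (W : R -> Omega -> R)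
  (T : R) (f : R -> R) (I : Omega -> R) : Prop :=
  measurable_fun setT I /\
  exists sn : nat -> seq (R * R * R),
    (forall n, step_ok T (sn n)) /\
    ((fun n => (\int[@lebesgue_measure R]_(t in `[0%R, T]) ((stepf (sn n) t - f t) ^+ 2)%:E)%E)
        @ \oo --> 0%E) /\
    ((fun n => (\int[P]_w ((stepW W (sn n) w - I w) ^+ 2)%:E)%E) @ \oo --> 0%E).

Definition Mtrend {R : realType} (h g : R -> R) (th t : R) : R :=
  if t < th then h t else g t.

Definition Phi {R : realType} (T : R) (h g S0 : R -> R) (th : R) : R :=
  Rintegral (@lebesgue_measure R) `[0, T] (fun t => (Mtrend h g th t - S0 t) ^+ 2).

Definition Phidd {R : realType} (h g S0 : R -> R) (th : R) : R :=
  2 * (h th - S0 th) * (derive1 h th - derive1 S0 th)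
  - 2 * (g th - S0 th) * (derive1 g th - derive1 S0 th).

(* Pseudo-likelihood V(theta, X^T) for noise level eps.  Since
   dX_t = S(theta0,t) dt + eps dW_t, the stochastic integral is
   \int_0^T M dX = \int_0^T M(theta,t) S0(t) dt + eps * J theta, where
   J theta is the Wiener integral \int_0^T M(theta,t) dW_t. *)
Definition pseudo_lik {R : realType} {Omega : Type} (T : R) (h g S0 : R -> R)
  (J : R -> Omega -> R) (eps th : R) (w : Omega) : R :=
  expR (eps ^- 2 * (Rintegral (@lebesgue_measure R) `[0, T]
                       (fun t => Mtrend h g th t * S0 t) + eps * J th w)
        - (2 * eps ^+ 2)^-1 *
            Rintegral (@lebesgue_measure R) `[0, T] (fun t => Mtrend h g th t ^+ 2)).

Definition C1_on {R : realType} (a b : R) (f : R -> R) : Prop :=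
  forall x, a < x < b -> derivable f x 1 /\ {for x, continuous (derive1 f)}.

(* Main.v *)
(* Up to an additive constant, eps^2 times the log-pseudo-likelihood is
   eps J(th) - Phi(th)/2.  The process J has independent centred Gaussian
   increments whose variance is the integral of (h - g)^2, and Phi dominates a
   quadratic around its minimiser.  Chaining with moments of arbitrary order and
   peeling over dyadic distances give
     P(|thhat_eps - vhat| >= eps^(2/3) r) <= C_m r^(-3m)
   for all eps in (0,1], hence consistency and uniform integrability.  Rescaled
   by eps^(2/3), the criterion has the law of delta(vhat) W(A(u)) - Q(u) for
   deterministic A(u) -> u and Q(u) -> gamma(vhat)/2 u^2, so argmax events can be
   compared on the space carrying W.  No uniqueness of the limiting argmax is
   needed: a small linear tilt makes maxima strict, and completing the square
   turns the tilted process into a translate of the original one.  For the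
   rescaled errors u_n this gives
     limsup P(x <= u_n) <= P'(x <= uhat), and likewise for -u_n and -uhat;
   weak convergence follows by testing on step functions whose jumps include
   their endpoint according to sign, and moments by truncation. *)
Require Import Defs.
From HB Require Import structures.
From mathcomp Require Import all_boot all_order all_algebra.
From mathcomp Require Import all_classical all_reals all_analysis.
From mathcomp Require Import measurable_realfun.
From mathcomp Require Import lra ring zify.
Set Implicit Arguments.
Unset Strict Implicit.
Unset Printing Implicit Defensive.
Import Order.TTheory GRing.Theory Num.Def Num.Theory.
Import numFieldNormedType.Exports.
Local Open Scope classical_set_scope.
Local Open Scope ring_scope.

(** * Laws of sequences of random variables *)

(** The scale comes from a balance: over a distance a the noise eps J moves by about eps a^(1/2),
    whereas Phi grows like a^2, so the maximiser is found at a of order eps^(2/3). Writing eps =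
    rho^3 turns all rescalings into integer powers. The obstacle is that the rescaled criteria for
    different eps are comparable only in law, and the argmax is not a continuous functional of the
    path. Every argmax event is therefore enclosed in an event built by countable operations from
    the values at a fixed dense sequence of times; such an event has the same probability for any
    two processes with the same Gaussian increments. Once all these events live on the space
    carrying W, a reverse Fatou argument applies. Between the half-line above x - s and the one
    below x - 2s, a tilt of slope gamma s gains at least gamma s^2, a fixed margin that absorbs all
    approximation errors. The tilt moves the argmax by s, whence the threshold x - 3s; at the end s
    tends to 0. *)

Lemma le_of_eq (d : Order.disp_t) (T : porderType d) (x y : T) : x = y -> (x <= y)%O.
Proof. by move->. Qed.

Section half_line_events.
Context {R : realType} {d : measure_display} {Omega : measurableType d}.
Implicit Types (X : Omega -> R) (x : R).

Lemma measurable_ge X x : measurable_fun setT X -> measurable [set w | x <= X w].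
Proof.
move=> mX; rewrite (_ : mkset _ = X @^-1` `[x, +oo[).
  by rewrite -[Y in measurable Y]setTI; exact: mX.
by apply/seteqP; split => w /=; rewrite in_itv/= andbT.
Qed.

Lemma measurable_gt X x : measurable_fun setT X -> measurable [set w | x < X w].
Proof.
move=> mX; rewrite (_ : mkset _ = X @^-1` `]x, +oo[).
  by rewrite -[Y in measurable Y]setTI; exact: mX.
by apply/seteqP; split => w /=; rewrite in_itv/= andbT.
Qed.

Lemma measurable_norm_ge X x : measurable_fun setT X -> measurable [set w | x <= `|X w|].
Proof. by move=> mX; apply: measurable_ge; exact: measurableT_comp. Qed.

End half_line_events.

(** Strict upper bounds on the first n coordinates are closed under intersection, and for Gaussian
    increments their probabilities are products of [Ncdf]; they serve as the pi-system that
    determines a law. *)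
Definition cylinders (R : realType) : set (set (nat -> R)) :=
  [set E | exists (n : nat) (x : nat -> R),
     E = \bigcap_(i in `I_n) [set f | f i < x i]].

Definition path_space (R : realType) := g_sigma_algebraType (@cylinders R).

Definition eqlaw (R : realType) d d'
  (Omega : measurableType d) (Omega' : measurableType d')
  (P : probability Omega R) (P' : probability Omega' R)
  (X : nat -> Omega -> R) (Y : nat -> Omega' -> R) : Prop :=
  forall E : set (path_space R), measurable E ->
    P [set w | E (X ^~ w)] = P' [set w | E (Y ^~ w)].

Lemma measurable_coord (R : realType) (i : nat) :
  measurable_fun [set: path_space R] (fun f : path_space R => f i).
Proof.
apply: (measurability _ (RGenInftyO.measurableE R)) => //.
move=> _ [_ [x ->] <-]; rewrite setTI.
(* A cylinder constrains all coordinates up to [i], so the earlier ones get the bound k and the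
   union over k releases them. *)
have -> : ((fun f : path_space R => f i) @^-1` `]-oo, x[%classic) =
    \bigcup_k \bigcap_(j in `I_i.+1) [set f : path_space R | f j < (if j == i then x else k%:R)].
  apply/seteqP; split => f /=; rewrite in_itv/=.
    move=> fx.
    have [k kP] : exists k : nat, forall j : nat, (j < i.+1)%N -> f j < k%:R.
      elim: i.+1 => [|n [k IH]]; first by exists 0%N.
      exists (maxn k (Num.truncn `|f n|).+1) => j; rewrite ltnS leq_eqVlt => /orP[/eqP->|/IH/lt_le_trans]; last first.
        by apply; rewrite ler_nat leq_maxl.
      apply: (@lt_le_trans _ _ (Num.truncn `|f n|).+1%:R); last by rewrite ler_nat leq_maxr.
      by apply: (le_lt_trans (ler_norm _)); rewrite truncnS_gt.
    by exists k => // j /= ji; case: eqP => [->//|_]; exact: kP.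
  by move=> [k _ /(_ i)/=]; rewrite eqxx; apply.
apply: bigcupT_measurable => k; apply: sub_sigma_algebra.
by exists i.+1, (fun j => if j == i then x else k%:R).
Qed.

Lemma measurable_path d (T : measurableType d) (R : realType)
  (F : T -> path_space R) : (forall i, measurable_fun setT (fun t => F t i)) ->
  measurable_fun setT F.
Proof.
move=> mF; apply: (@measurability _ _ T (path_space R) setT F (@cylinders R)) => //.
move=> _ [_ [n [x ->]] <-]; rewrite setTI preimage_bigcap.
apply: fin_bigcap_measurable => // i _.
rewrite -[X in measurable X]setTI.
have -> : F @^-1` [set f | f i < x i] = (fun t => F t i) @^-1` `]-oo, x i[%classic.
  by apply/seteqP; split => t /=; rewrite in_itv.
exact: mF.
Qed.

Lemma cylindersI (R : realType) : setI_closed (@cylinders R).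
Proof.
move=> _ _ [n [x ->]] [m [y ->]].
exists (maxn n m), (fun i => if (i < n)%N then (if (i < m)%N then Num.min (x i) (y i) else x i) else y i).
apply/seteqP; split => f /=.
  move=> [fx fy] i /= inm.
  have := fx i; have := fy i => /=.
  by move: inm; rewrite leq_max; case: (ltnP i n); case: (ltnP i m) => //= _ _ _ a b; rewrite ?lt_min ?a ?b.
move=> fxy; split => i /= ii; have := fxy i => /=; rewrite leq_max ii ?orbT => /(_ isT).
  by case: ifP => //; rewrite lt_min => _ /andP[].
by case: ifP => //; rewrite lt_min => _ /andP[].
Qed.

(** Uniqueness of measures on a pi-system, applied to the two image measures on [path_space]; the
    cylinder with n = 0 is the whole space and supplies the exhausting sequence. *)
Lemma eqlaw_fdd (R : realType) d d'
  (Omega : measurableType d) (Omega' : measurableType d')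
  (P : probability Omega R) (P' : probability Omega' R)
  (X : nat -> Omega -> R) (Y : nat -> Omega' -> R) :
  (forall i, measurable_fun setT (X i)) -> (forall i, measurable_fun setT (Y i)) ->
  (forall (n : nat) (x : nat -> R),
     P [set w | forall i, (i < n)%N -> X i w < x i] =
     P' [set w | forall i, (i < n)%N -> Y i w < x i]) ->
  eqlaw P P' X Y.
Proof.
move=> mX mY H E mE.
have mX' : measurable_fun setT (fun w => X ^~ w : path_space R) by apply: measurable_path.
have mY' : measurable_fun setT (fun w => Y ^~ w : path_space R) by apply: measurable_path.
pose X' : {mfun Omega >-> path_space R} := MeasurableFun.Pack (MeasurableFun.Class (isMeasurableFun.Build _ _ Omega (path_space R) _ mX')).
pose Y' : {mfun Omega' >-> path_space R} := MeasurableFun.Pack (MeasurableFun.Class (isMeasurableFun.Build _ _ Omega' (path_space R) _ mY')).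
apply: (@measure_unique _ R (path_space R) (@cylinders R) (fun=> setT) _ _ _ _ (distribution P X') (distribution P' Y')) => //.
- exact: cylindersI.
- by move=> _; exists 0%N, (fun=> 0); apply/seteqP; split => // f _ i; rewrite /= ltn0.
- exact: bigcup_const.
- by move=> _ [n [x ->]]; exact: H.
- by move=> _; exact: (le_lt_trans (@probability_le1 _ _ _ (distribution P X') _ measurableT) (ltry 1)).
Qed.

Lemma eqlaw_comp (R : realType) d d'
  (Omega : measurableType d) (Omega' : measurableType d')
  (P : probability Omega R) (P' : probability Omega' R)
  (X : nat -> Omega -> R) (Y : nat -> Omega' -> R)
  (F : nat -> path_space R -> R) :
  (forall i, measurable_fun setT (F i)) -> eqlaw P P' X Y ->
  eqlaw P P' (fun i w => F i (X ^~ w)) (fun i w => F i (Y ^~ w)).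
Proof.
move=> mF XY E mE.
have mF' : measurable_fun setT (fun f : path_space R => (fun i => F i f) : path_space R).
  exact: measurable_path.
by have := XY _ (mF' measurableT _ mE); rewrite setTI.
Qed.

(** * Normal laws *)

Definition Ncdf (R : realType) (y : R) : R := fine (normal_prob 0 1 `]-oo, y[%classic).

Lemma normal_prob_scale (R : realType) (s x : R) : 0 < s ->
  normal_prob 0 s `]-oo, x[%classic = (Ncdf (x / s))%:E.
Proof.
move=> s0; rewrite /Ncdf fineK; last exact: fin_num_measure.
rewrite /normal_prob.
rewrite (@integral_itv_bndo_bndc _ -oo%O x (fun z => (normal_pdf 0 s z)%:E)); last first.
  by apply/measurable_EFinP/measurable_funTS; exact: measurable_normal_pdf.
rewrite (@integral_itv_bndo_bndc _ -oo%O (x / s) (fun z => (normal_pdf 0 1 z)%:E)); last first.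
  by apply/measurable_EFinP/measurable_funTS; exact: measurable_normal_pdf.
have dF : (fun y : R => s * y)^`()%classic = cst s.
  by apply/funext => y; rewrite derive1E deriveZ//= derive_id /GRing.scale/= mulr1.
rewrite {1}(_ : x = s * (x / s)); last by rewrite mulrC divfK// gt_eqF.
rewrite increasing_ge0_integration_by_substitutionNy//.
- apply: eq_integral => y _; rewrite dF !fctE; congr (_%:E).
  rewrite !normal_pdfE ?oner_eq0 ?gt_eqF// /normal_peak /normal_fun !subr0 expr1n mul1r.
  rewrite mulrAC; congr (_ * _).
    rewrite -mulrnAr sqrtrM ?sqr_ge0// sqrtr_sqr gtr0_norm// invfM mulrC mulrA divff ?gt_eqF//.
    by rewrite mul1r.
  congr expR; rewrite exprMn -(mulr_natr (s ^+ 2)) -[1 *+ 2]/(2%:R); field.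
  by rewrite gt_eqF.
- by move=> a b _ _; rewrite ltr_pM2l.
- by rewrite dF => y _; exact: cst_continuous.
- by rewrite dF; exact: is_cvg_cst.
- by rewrite dF; exact: cvg_cst.
- split => [y _|]; first exact: derivableZ.
  by apply: cvg_at_left_filter; apply: cvgMr; exact: cvg_id.
- by apply: gt0_cvgMrNy.
- by apply: continuous_subspaceT; apply: continuous_normal_pdf; rewrite gt_eqF.
- by move=> y _; exact: normal_pdf_ge0.
Qed.

(** The normal density is bounded by its peak. *)
Lemma Ncdf_lipschitz (R : realType) (x y : R) : x <= y ->
  0 <= Ncdf y - Ncdf x <= normal_peak 1 * (y - x).
Proof.
move=> xy; have n10 : (1 : R) != 0 by rewrite oner_eq0.
have -> : Ncdf y - Ncdf x = fine (normal_prob 0 1 `[x, y[%classic).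
  apply/eqP; rewrite subr_eq; apply/eqP; rewrite /Ncdf -fineD; [|exact: fin_num_measure..].
  congr fine; rewrite -measureU//=; last first.
    apply/seteqP; split => z //=; rewrite !in_itv/= => -[/andP[+ _]].
    by rewrite leNgt => /negP.
  congr (normal_prob 0 1 _); apply/seteqP; split => z /=; rewrite !in_itv/=.
    by move=> zy; case: (ltP z x) => zx; [right|left].
  by case=> [/andP[]//|zx]; exact: lt_le_trans zx xy.
rewrite fine_ge0//= -lee_fin fineK; last exact: fin_num_measure.
apply: (@le_trans _ _ (\int[lebesgue_measure]_(z in `[x, y[) (normal_peak 1)%:E)%E).
  rewrite /normal_prob; apply: ge0_le_integral => //=.
  - by move=> z _; rewrite lee_fin normal_pdf_ge0.
  - by apply/measurable_EFinP/measurable_funTS; exact: measurable_normal_pdf.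
  - by move=> z _; rewrite lee_fin normal_pdf_ub.
rewrite integral_cst//= lebesgue_measure_itv/= lte_fin.
by case: ltP => [_|yx]; rewrite ?EFinB// ?mule0 lee_fin mulr_ge0 ?normal_peak_ge0 ?subr_ge0.
Qed.

Lemma Ncdf_continuous (R : realType) : continuous (@Ncdf R).
Proof.
move=> x; apply/cvgrPdist_le => e e0.
have p0 : 0 < normal_peak (1 : R) by rewrite normal_peak_gt0 ?oner_eq0.
near=> y.
have yx : normal_peak 1 * `|x - y| <= e.
  have : `|x - y| <= e / normal_peak 1.
    by near: y; apply: cvgr_dist_le => //; rewrite divr_gt0.
  by rewrite ler_pdivlMr// mulrC.
apply: le_trans yx.
case: (leP x y) => [xy|/ltW xy]; have /andP[a b] := Ncdf_lipschitz xy.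
  by rewrite distrC (distrC x) (ger0_norm a) (@ger0_norm _ (y - x)) ?subr_ge0.
by rewrite (ger0_norm a) (@ger0_norm _ (x - y)) ?subr_ge0.
Unshelve. all: by end_near. Qed.

(** The density of standard deviation s is sqrt 2 exp(- x^2 / (4 s^2)) times the density of standard
    deviation sqrt 2 s. On |x| >= y the exponential is at most its value at y, and the remaining
    mass is at most 1. *)
Lemma normal_tail_expR (R : realType) (s y : R) : 0 < s -> 0 <= y ->
  (normal_prob 0 s [set x : R | (y <= `|x|)%R] <= (Num.sqrt 2 * expR (- (y / s) ^+ 2 / 4))%R%:E)%E.
Proof.
move=> s0 y0.
have r20 : 0 < Num.sqrt (2 : R) by rewrite sqrtr_gt0.
have s'0 : 0 < Num.sqrt 2 * s by rewrite mulr_gt0.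
have mA : measurable [set x : R | y <= `|x|] by exact: measurable_ge.
rewrite /normal_prob.
apply: (@le_trans _ _ (\int[lebesgue_measure]_(x in [set x : R | (y <= `|x|)%R])
   ((Num.sqrt 2 * expR (- (y / s) ^+ 2 / 4))%R%:E * (normal_pdf 0 (Num.sqrt 2 * s)%R x)%:E))%E).
  apply: ge0_le_integral => //=.
  - by move=> x _; rewrite lee_fin normal_pdf_ge0.
  - by apply/measurable_EFinP/measurable_funTS; exact: measurable_normal_pdf.
  - apply/measurable_EFinP; apply: measurable_funM => //.
    by apply/measurable_funTS; exact: measurable_normal_pdf.
  - move=> x /= yx; rewrite -EFinM lee_fin !normal_pdfE ?gt_eqF//.
    rewrite /normal_peak /normal_fun !subr0.
    have -> : (Num.sqrt 2 * s) ^+ 2 = 2 * s ^+ 2 by rewrite exprMn sqr_sqrtr.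
    have -> : (2 * s ^+ 2 * pi *+ 2) = 2 * (s ^+ 2 * pi *+ 2) by rewrite -mulrA mulrnAr.
    rewrite [X in _ * (X^-1 * _)]sqrtrM// invfM.
    set k := (Num.sqrt (s ^+ 2 * pi *+ 2))^-1.
    have -> : Num.sqrt 2 * expR (- (y / s) ^+ 2 / 4) *
        ((Num.sqrt 2)^-1 * k * expR (- x ^+ 2 / (2 * s ^+ 2 *+ 2))) =
        k * (expR (- (y / s) ^+ 2 / 4) * expR (- x ^+ 2 / (2 * s ^+ 2 *+ 2))).
      by field; rewrite gt_eqF.
    rewrite ler_wpM2l ?invr_ge0// -expRD ler_expR.
    have xs : (y / s) ^+ 2 <= x ^+ 2 / s ^+ 2.
      rewrite expr_div_n ler_pM2r ?invr_gt0 ?exprn_gt0//.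
      by rewrite -(real_normK (num_real x)) ler_sqr ?nnegrE.
    rewrite -(mulr_natr (s ^+ 2)) -(mulr_natr (2 * s ^+ 2)).
    have -> : - x ^+ 2 / (s ^+ 2 * 2) = - (x ^+ 2 / s ^+ 2) / 2 by field; rewrite gt_eqF.
    have -> : - x ^+ 2 / (2 * s ^+ 2 * 2) = - (x ^+ 2 / s ^+ 2) / 4 by field; rewrite gt_eqF.
    lra.
rewrite ge0_integralZl//; first last.
- by move=> x _; rewrite lee_fin normal_pdf_ge0.
- by apply/measurable_EFinP/measurable_funTS; exact: measurable_normal_pdf.
rewrite -[leRHS]mule1; apply: lee_pmul => //.
  by apply: integral_ge0 => x _; rewrite lee_fin normal_pdf_ge0.
rewrite -(integral_normal_pdf 0 (Num.sqrt 2 * s)).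
apply: ge0_subset_integral => //.
- by apply/measurable_EFinP; exact: measurable_normal_pdf.
- by move=> x _; rewrite lee_fin normal_pdf_ge0.
Qed.

(** Comes from exp(- z) <= (m / z)^m at z = y^2 / (4 v), with the factor sqrt 2 of
    [normal_tail_expR]. *)
Definition tailC (R : realType) (m : nat) : R := Num.sqrt 2 * (4 * m%:R) ^+ m.

Lemma normal_tail (R : realType) (m : nat) (v y : R) : 0 < v -> 0 < y -> (0 < m)%N ->
  (normal_prob 0 (Num.sqrt v) [set x : R | (y <= `|x|)%R] <= (tailC R m * (v / y ^+ 2) ^+ m)%:E)%E.
Proof.
move=> v0 y0 m0; apply: (le_trans (normal_tail_expR _ (ltW y0))).
  by rewrite sqrtr_gt0.
have m0' : 0 < m%:R :> R by rewrite ltr0n.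
rewrite lee_fin /tailC -mulrA ler_wpM2l// -exprMn.
have z0 : 0 < y ^+ 2 / v by rewrite divr_gt0 ?exprn_gt0.
have -> : - (y / Num.sqrt v) ^+ 2 / 4 = - (y ^+ 2 / v / 4).
  by rewrite expr_div_n sqr_sqrtr ?ltW// mulNr.
have -> : 4 * m%:R * (v / y ^+ 2) = (y ^+ 2 / v / 4 / m%:R)^-1.
  by field; rewrite !gt_eqF// exprn_gt0.
set z := y ^+ 2 / v / 4; have {}z0 : 0 < z by rewrite /z divr_gt0.
rewrite expRN exprVn lef_pV2 ?posrE ?expR_gt0 ?exprn_gt0 ?divr_gt0//.
have -> : expR z = expR (z / m%:R) ^+ m.
  by rewrite -expRM_natl mulrC divfK// gt_eqF.
rewrite lerXn2r ?nnegrE ?expR_ge0 ?(ltW (divr_gt0 z0 m0'))//.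
by apply: le_trans (expR_ge1Dx _); rewrite lerDr.
by rewrite exprn_gt0.
Qed.

Lemma normal_law (R : realType) d (Omega : measurableType d)
  (P : probability Omega R) (X : Omega -> R) (s : R) : 0 < s ->
  measurable_fun setT X ->
  (forall x, P [set w | X w < x] = (Ncdf (x / s))%:E) ->
  forall B, measurable B -> P (X @^-1` B) = normal_prob 0 s B.
Proof.
move=> s0 mX H B mB.
pose X' : {mfun Omega >-> measurableTypeR R} := MeasurableFun.Pack (MeasurableFun.Class (isMeasurableFun.Build _ _ Omega (measurableTypeR R) _ mX)).
have : distribution P X' B = normal_prob 0 s B; last by [].
apply: (@measure_unique _ R (measurableTypeR R) (@RGenInftyO.G R) (fun n => `]-oo, n%:R[%classic) _ _ _ _ (distribution P X') (normal_prob 0 s) _ _ B mB).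
- exact: RGenInftyO.measurableE.
- move=> _ _ [x ->] [y ->]; exists (Num.min x y).
  by apply/seteqP; split => z /=; rewrite !in_itv/= lt_min; [move=> [-> ->]|move/andP].
- by move=> n; exists n%:R.
- apply/seteqP; split => // x _; exists (Num.truncn `|x|).+1 => //=.
  by rewrite in_itv/= (le_lt_trans (ler_norm _))// truncnS_gt.
- move=> _ [x ->]; transitivity (Ncdf (x / s))%:E; last exact/esym/normal_prob_scale.
  by rewrite -H; congr (P _); apply/seteqP; split => z /=; rewrite in_itv.
- by move=> n; apply: le_lt_trans (ltry 1); exact: probability_le1.
Qed.

Lemma normal_tail_law (R : realType) d (Omega : measurableType d)
  (P : probability Omega R) (X : Omega -> R) (v y : R) (m : nat) : 0 < v -> 0 < y -> (0 < m)%N ->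
  measurable_fun setT X ->
  (forall x, P [set w | X w < x] = (Ncdf (x / Num.sqrt v))%:E) ->
  (P [set w | (y <= `|X w|)%R] <= (tailC R m * (v / y ^+ 2) ^+ m)%:E)%E.
Proof.
move=> v0 y0 m0 mX H; apply: le_trans (normal_tail v0 y0 m0).
rewrite -(normal_law _ mX H) ?sqrtr_gt0//.
exact: measurable_ge.
Qed.

Definition normal_m2 (R : realType) : \bar R := (\int[normal_prob 0 1]_x (x ^+ 2)%:E)%E.

(** Layer-cake formula: the tail of X^2 at r is at most sqrt 2 exp(- r / 4), a multiple of the
    exponential density of rate 1/4. *)
Lemma normal_m2_fin (R : realType) : (normal_m2 R < +oo)%E.
Proof.
have mX : measurable_fun setT (fun x : R => x ^+ 2) by apply: measurable_funX.
pose X : {RV (normal_prob 0 (1:R)) >-> R} :=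
  MeasurableFun.Pack (MeasurableFun.Class (isMeasurableFun.Build _ _ (measurableTypeR R) R _ mX)).
have -> : normal_m2 R = ('E_(normal_prob 0 (1:R))[X])%E by rewrite expectation_def.
rewrite ge0_expectation_ccdf; last by move=> x; exact: sqr_ge0.
apply: (@le_lt_trans _ _ (\int[lebesgue_measure]_(r in `[0%R, +oo[) ((4 * Num.sqrt 2)%:E * (exponential_pdf 4^-1 r)%:E))%E).
  apply: ge0_le_integral => //=.
  - by apply/measurable_funTS; exact: ccdf_measurable.
  - apply/measurable_EFinP; apply: measurable_funM => //.
    by apply/measurable_funTS; exact: measurable_exponential_pdf.
  - move=> r; rewrite in_itv/= andbT => r0.
    rewrite /ccdf /distribution /pushforward/=.
    apply: (@le_trans _ _ (normal_prob 0 (1 : R) [set x : R | (Num.sqrt r <= `|x|)%R])).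
      apply: le_measure => //=.
      + by rewrite inE -[Y in measurable Y]setTI; apply: (mX measurableT).
      + rewrite inE; have -> : [set x : R | Num.sqrt r <= `|x|] = `[Num.sqrt r, +oo[ `|` `]-oo, - Num.sqrt r].
          apply/seteqP; split => x /=; rewrite !in_itv/= andbT ler_normr lerNr; last by move/orP.
          by move/orP.
        exact: measurableU.
      + move=> x /=; rewrite in_itv/= andbT => rx.
        by rewrite -sqrtr_sqr ler_wsqrtr// ltW.
    apply: le_trans (normal_tail_expR _ (sqrtr_ge0 _)) _ => //.
    rewrite -EFinM lee_fin exponential_pdfE// divr1 sqr_sqrtr//.
    rewrite mulrAC !mulrA divff ?mul1r// mulrC; apply: ler_pM => //.
    by rewrite ler_expR; lra.
rewrite ge0_integralZl//=; first last.
- by move=> x _; rewrite lee_fin exponential_pdf_ge0.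
- by apply/measurable_EFinP/measurable_funTS; exact: measurable_exponential_pdf.
apply: (@le_lt_trans _ _ ((4 * Num.sqrt 2)%:E * 1)%E); last by rewrite mule1 ltry.
apply: lee_pmul => //.
  by apply: integral_ge0 => x _; rewrite lee_fin exponential_pdf_ge0.
rewrite -(@integral_exponential_pdf _ 4^-1)//.
apply: ge0_subset_integral => //.
- by apply/measurable_EFinP; exact: measurable_exponential_pdf.
- by move=> x _; rewrite lee_fin exponential_pdf_ge0.
Qed.

Lemma second_moment_law (R : realType) d (Omega : measurableType d)
  (P : probability Omega R) (X : Omega -> R) (v : R) : 0 < v ->
  measurable_fun setT X ->
  (forall B, measurable B -> P (X @^-1` B) = normal_prob 0 (Num.sqrt v) B) ->
  (\int[P]_w (X w ^+ 2)%:E = v%:E * normal_m2 R)%E.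
Proof.
move=> v0 mX H; have sv0 : 0 < Num.sqrt v by rewrite sqrtr_gt0.
have mZ : measurable_fun setT (fun w => X w / Num.sqrt v) by apply: measurable_funM.
pose Z : {mfun Omega >-> measurableTypeR R} :=
  MeasurableFun.Pack (MeasurableFun.Class (isMeasurableFun.Build _ _ Omega (measurableTypeR R) _ mZ)).
transitivity (v%:E * \int[P]_w (Z w ^+ 2)%:E)%E.
  rewrite -ge0_integralZl//=.
  - apply: eq_integral => w _; rewrite -EFinM; congr (_%:E).
    by rewrite expr_div_n sqr_sqrtr ?ltW// mulrCA divff ?gt_eqF// mulr1.
  - by apply/measurable_EFinP; apply: measurable_funX.
  - by move=> w _; rewrite lee_fin sqr_ge0.
  - by rewrite lee_fin ltW.
congr (_ * _)%E.
rewrite -[LHS](@ge0_integral_distribution _ _ _ _ _ P Z (fun x : R => (x ^+ 2)%:E)); first last.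
- by move=> x; rewrite lee_fin sqr_ge0.
- by apply/measurable_EFinP; apply: measurable_funX.
apply: eq_measure_integral => A mA _.
apply: (@normal_law _ _ _ P _ 1 _ mZ) => // x; rewrite divr1.
rewrite (_ : [set w | Z w < x] = X @^-1` `]-oo, x * Num.sqrt v[%classic); last first.
  by apply/seteqP; split => w /=; rewrite in_itv/= ltr_pdivrMr.
by rewrite H// normal_prob_scale// mulfK// gt_eqF.
Qed.

(** * Gaussian increments *)

(** Independence and normality are stated together, as a product formula for the joint distribution
    function of successive increments. [A] is the variance clock and enters through differences
    only. This form is stable under time change, scaling and L2 limits. *)
Definition gauss_incr (R : realType) d (Omega : measurableType d)
  (P : probability Omega R) (D : set R) (A : R -> R) (X : R -> Omega -> R) : Prop :=
  (forall t, D t -> measurable_fun setT (X t)) /\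
  forall (n : nat) (ts : nat -> R), (forall i, (i <= n)%N -> D (ts i)) ->
    (forall i, (i < n)%N -> ts i < ts i.+1) ->
    forall x : nat -> R,
      P [set w | forall i, (i < n)%N -> X (ts i.+1) w - X (ts i) w < x i] =
      (\prod_(i < n) Ncdf (x i / Num.sqrt (A (ts i.+1) - A (ts i))))%:E.

Section gauss_incr.
Context {R : realType} {d : measure_display} {Omega : measurableType d}.
Variable P : probability Omega R.
Implicit Types (D : set R) (A : R -> R) (X : R -> Omega -> R).

Lemma gauss_incr_wiener D X : is_wiener P D X -> gauss_incr P D id X.
Proof.
move=> [_ [mX [_ H]]]; split=> // n ts tsD tsS x.
have [H1 H2] := H n ts tsD tsS.
have := H1 (fun i => `]-oo, x i[%classic) (fun i => measurable_itv _).
have -> : \bigcap_(i in `I_n) (fun w => X (ts i.+1) w - X (ts i) w) @^-1` `]-oo, x i[ =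
   [set w | forall i, (i < n)%N -> X (ts i.+1) w - X (ts i) w < x i].
  by apply/seteqP; split => w /= h i /h; rewrite /= in_itv.
move=> ->; rewrite -prodEFin; apply: eq_bigr => i _.
by rewrite H2// normal_prob_scale// sqrtr_gt0 subr_gt0 tsS.
Qed.

Lemma gauss_incr_timechange D D' A (a : R -> R) X : gauss_incr P D A X ->
  (forall t, D' t -> D (a t)) ->
  (forall s t, D' s -> D' t -> s < t -> a s < a t) ->
  gauss_incr P D' (A \o a) (fun t => X (a t)).
Proof.
move=> [mX H] aD ai; split => [t /aD/mX//|n ts tsD tsS x].
apply: (H n (a \o ts)) => [i /tsD/aD//|i iltn]; apply: ai; [| |exact: tsS].
- by apply: tsD; exact: ltnW.
- exact: tsD.
Qed.

Lemma gauss_incr_scale D A X (k : R) : 0 < k -> gauss_incr P D A X ->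
  gauss_incr P D (fun t => k ^+ 2 * A t) (fun t w => k * X t w).
Proof.
move=> k0 [mX H]; split => [t /mX mXt|n ts tsD tsS x].
  exact: measurable_funM.
have := H n ts tsD tsS (fun i => x i / k).
have -> : [set w | forall i, (i < n)%N -> X (ts i.+1) w - X (ts i) w < x i / k] =
   [set w | forall i, (i < n)%N -> k * X (ts i.+1) w - k * X (ts i) w < x i].
  by apply/seteqP; split => w /= h i /h; rewrite -mulrBr ltr_pdivlMr// mulrC.
move=> ->; congr (_%:E); apply: eq_bigr => i _.
by rewrite -mulrBr sqrtrM ?sqr_ge0// sqrtr_sqr gtr0_norm// invfM mulrA.
Qed.

Lemma gauss_incr_eq D A A' X : (forall s t, D s -> D t -> A t - A s = A' t - A' s) ->
  gauss_incr P D A X -> gauss_incr P D A' X.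
Proof.
move=> AA' [mX H]; split => // n ts tsD tsS x; rewrite (H n ts tsD tsS).
by congr (_%:E); apply: eq_bigr => i _; rewrite AA'//; apply: tsD => //; exact: ltnW.
Qed.

Lemma gauss_incr_law D A X s t : gauss_incr P D A X -> D s -> D t -> s < t ->
  forall x, P [set w | X t w - X s w < x] = (Ncdf (x / Num.sqrt (A t - A s)))%:E.
Proof.
move=> [mX H] Ds Dt st x.
have := H 1%N (fun i => if i == 0%N then s else t) _ _ (fun=> x).
rewrite big_ord1/= => <-; last 2 first.
- by move=> [|[|]].
- by move=> [|].
by congr (P _); apply/seteqP; split => w /= h; [move=> [|]//|apply: (h 0%N)].
Qed.

Lemma gauss_incr_tail D A X s t (m : nat) (y : R) : gauss_incr P D A X ->
  D s -> D t -> s < t -> A s < A t -> 0 < y -> (0 < m)%N ->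
  (P [set w | (y <= `|X t w - X s w|)%R] <= (tailC R m * ((A t - A s) / y ^+ 2) ^+ m)%:E)%E.
Proof.
move=> G Ds Dt st As y0 m0; apply: normal_tail_law => //; first by rewrite subr_gt0.
  by case: G => mX _; apply: measurable_funB; exact: mX.
exact: gauss_incr_law G Ds Dt st.
Qed.

End gauss_incr.

Section eqlaw_incr.
Context {R : realType} {d d' : measure_display}
  {Omega : measurableType d} {Omega' : measurableType d'}.
Variables (P : probability Omega R) (P' : probability Omega' R).

(** Laws are compared on sequences, so a finite family is padded with zeros. Beyond the first [m]
    coordinates a cylinder either imposes nothing (positive bounds) or is empty (some bound is at
    most 0). *)
Lemma eqlaw_finite (m : nat) (X : nat -> Omega -> R) (Y : nat -> Omega' -> R) :
  (forall i, (i < m)%N -> measurable_fun setT (X i)) ->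
  (forall i, (i < m)%N -> measurable_fun setT (Y i)) ->
  (forall n x, (n <= m)%N -> P [set w | forall i, (i < n)%N -> X i w < x i] =
     P' [set w | forall i, (i < n)%N -> Y i w < x i]) ->
  eqlaw P P' (fun i w => if (i < m)%N then X i w else 0)
             (fun i w => if (i < m)%N then Y i w else 0).
Proof.
move=> mX mY H; apply: eqlaw_fdd.
- by move=> i; case: ltnP => // /mX.
- by move=> i; case: ltnP => // /mY.
move=> n x; pose cut (T : Type) (Z : nat -> T -> R) :=
  [set w | forall i, (i < n)%N -> (if (i < m)%N then Z i w else 0) < x i].
rewrite -/(cut _ X) -/(cut _ Y).
have [nm|mn] := leqP n m.
  have cutE (T : Type) (Z : nat -> T -> R) : cut T Z = [set w | forall i, (i < n)%N -> Z i w < x i].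
    by apply/seteqP; split => w h i iltn; have := h i iltn; rewrite (leq_trans iltn nm).
  by rewrite !cutE; exact: H.
have [x0|/existsNP[i /not_implyP[/andP[im iltn] /negP]]] :=
    pselect (forall i, (m <= i < n)%N -> 0 < x i).
  have cutE (T : Type) (Z : nat -> T -> R) : cut T Z = [set w | forall i, (i < m)%N -> Z i w < x i].
    apply/seteqP; split => w h i iltm.
      by have := h i (ltn_trans iltm mn); rewrite iltm.
    by case: ltnP => im; [exact: h|rewrite x0// im].
  by rewrite !cutE; exact: H.
rewrite -leNgt => xi0.
have cut0 (T : Type) (Z : nat -> T -> R) : cut T Z = set0.
  by apply/seteqP; split => // w /(_ i iltn); rewrite ltnNge im/= ltNge xi0.
by rewrite !cut0 !measure0.
Qed.

(** The times [t i] may be unordered and may repeat. The distinct values among finitely many of them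
    and [b] are sorted; the consecutive increments along the sorted list have equal laws, and each
    difference from the value at [b] is a fixed linear combination of them. *)
Lemma gauss_incr_eqlaw D A (X : R -> Omega -> R) (Y : R -> Omega' -> R) (b : R) (t : nat -> R) :
  gauss_incr P D A X -> gauss_incr P' D A Y -> D b -> (forall i, D (t i)) ->
  eqlaw P P' (fun i w => X (t i) w - X b w) (fun i w => Y (t i) w - Y b w).
Proof.
move=> [mX HX] [mY HY] Db Dt; apply: eqlaw_fdd => [i|i|n x].
- by apply: measurable_funB; exact: mX.
- by apply: measurable_funB; exact: mY.
pose s := sort <=%R (undup (b :: [seq t i | i <- iota 0 n])).
have us : uniq s by rewrite sort_uniq undup_uniq.
have ss : sorted <%R s by rewrite lt_sorted_uniq_le us sort_le_sorted.
have bs : b \in s by rewrite mem_sort mem_undup mem_head.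
have ts i : (i < n)%N -> t i \in s.
  by move=> iltn; rewrite mem_sort mem_undup inE map_f ?orbT// mem_iota.
have Ds z : z \in s -> D z.
  by rewrite mem_sort mem_undup inE => /predU1P[->//|/mapP[i _ ->]].
pose u i := nth b s i; pose m := (size s).-1.
have ms : size s = m.+1 by rewrite prednK//; case: (s) bs.
have Du i : (i <= m)%N -> D (u i) by move=> im; apply/Ds/mem_nth; rewrite ms ltnS.
have uS i : (i < m)%N -> u i < u i.+1.
  move=> im; apply: (sorted_ltn_nth lt_trans b ss); rewrite ?inE ?ms ?ltnS//.
  exact: ltnW.
have idx z : z \in s -> (index z s <= m)%N by rewrite -index_mem ms ltnS.
have eqI : eqlaw P P' (fun i w => if (i < m)%N then X (u i.+1) w - X (u i) w else 0)
                      (fun i w => if (i < m)%N then Y (u i.+1) w - Y (u i) w else 0).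
  apply: eqlaw_finite => [i im|i im|k y km].
  - by apply: measurable_funB; apply: mX; apply: Du => //; exact: ltnW.
  - by apply: measurable_funB; apply: mY; apply: Du => //; exact: ltnW.
  rewrite HX ?HY// => i ik; first by apply: Du; exact: leq_trans ik km.
  - by apply: uS; exact: leq_trans ik km.
  - by apply: Du; exact: leq_trans ik km.
  - by apply: uS; exact: leq_trans ik km.
(* Both values are telescoped from the smallest time, which treats [t i] before [b] and after [b]
   alike. *)
pose F i (f : path_space R) : R := \sum_(l < index (t i) s) f l - \sum_(l < index b s) f l.
have mF i : measurable_fun setT (F i).
  by apply: measurable_funB; apply: measurable_sum => l; exact: measurable_coord.
have tele (Z : R -> R) z : z \in s ->
    \sum_(l < index z s) (if (l < m)%N then Z (u l.+1) - Z (u l) else 0) = Z z - Z (u 0%N).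
  move=> zs; transitivity (\sum_(l < index z s) (Z (u l.+1) - Z (u l))).
    by apply: eq_bigr => l _; rewrite (leq_trans (ltn_ord l) (idx _ zs)).
  by rewrite -(big_mkord xpredT (fun l => Z (u l.+1) - Z (u l))) telescope_sumr// /u nth_index.
have FZ (Z : R -> R) i : (i < n)%N ->
    F i (fun j => if (j < m)%N then Z (u j.+1) - Z (u j) else 0) = Z (t i) - Z b.
  by move=> iltn; rewrite /F (tele Z) ?ts// (tele Z)// opprB addrA subrK.
have := eqlaw_comp mF eqI (E := [set f | forall i, (i < n)%N -> f i < x i]).
set E0 := [set w | _]; set E1 := [set w | _]; set E2 := [set w | _].
set E3 := [set w | _]; set E4 := [set w | _].
have -> : E1 = E3.
  by apply/seteqP; split => w h i iltn; have := h i iltn; rewrite /= (FZ (X ^~ w)).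
have -> : E2 = E4.
  by apply/seteqP; split => w h i iltn; have := h i iltn; rewrite /= (FZ (Y ^~ w)).
by apply; apply: sub_sigma_algebra; exists n, x.
Qed.

End eqlaw_incr.

(** * The Wiener integral of the change-point trend *)

Section square_of_increments.
Context {d : measure_display} {T : measurableType d} {R : realType}.
Variables (mu : {measure set T -> \bar R}) (D : set T) (mD : measurable D).

(** Integrability and value travel together, so that linearity applies without side conditions on
    extended reals. *)
Definition has_int (f : T -> R) (r : R) : Prop :=
  mu.-integrable D (EFin \o f) /\ (\int[mu]_(x in D) (f x)%:E = r%:E)%E.

Lemma has_intD f g a b : has_int f a -> has_int g b ->
  has_int (fun x => f x + g x) (a + b).
Proof.
move=> [fi fa] [gi gb]; split; first exact: (integrableD mD fi gi).
by rewrite EFinD -fa -gb -(integralD mD fi gi).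
Qed.

Lemma has_intZ (k : R) f a : has_int f a -> has_int (fun x => k * f x) (k * a).
Proof.
move=> [fi fa]; split; first exact: (integrableZl mD k fi).
by rewrite EFinM -fa -(integralZl mD fi).
Qed.

Lemma has_int_sum (I : Type) (s : seq I) (f : I -> T -> R) (a : I -> R) :
  (forall i, has_int (f i) (a i)) ->
  has_int (fun x => \sum_(i <- s) f i x) (\sum_(i <- s) a i).
Proof.
move=> fa; elim: s => [|i s IH].
  split; last by rewrite big_nil; under eq_integral do rewrite big_nil; rewrite integral0.
  by apply: (eq_integrable mD (cst 0%E)); [move=> x _; rewrite /= big_nil|exact: integrable0].
have [h1 h2] := has_intD (fa i) IH; split.
  by apply: eq_integrable h1 => // x _; rewrite /= big_cons.
by rewrite big_cons -h2; apply: eq_integral => x _; rewrite big_cons.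
Qed.

Variables (V : R -> T -> R) (C : R) (dst : R -> R -> R).
Hypothesis mV : forall p, measurable_fun D (V p).
Hypothesis HV : forall p q, (\int[mu]_(x in D) ((V p x - V q x) ^+ 2)%:E = (C * dst p q)%:E)%E.

Definition polar (a b a' b' : R) : R :=
  2^-1 * (dst b a' + dst a b' + - 1 * dst b b' + - 1 * dst a a').

(* Polarisation: the quadratic form of the increments is determined by the
   squared distances between the members of the family. *)
Lemma square_sum_incr (s : seq (R * R * R)) :
  has_int (fun t => (\sum_(x <- s) x.2 * (V x.1.2 t - V x.1.1 t)) ^+ 2)
    (C * \sum_(x <- s) \sum_(y <- s) x.2 * (y.2 * polar x.1.1 x.1.2 y.1.1 y.1.2)).
Proof.
have hV p q : has_int (fun t => (V p t - V q t) ^+ 2) (C * dst p q).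
  split => //; apply/integrableP; split.
    by apply/measurable_EFinP; apply: measurable_funX; exact: measurable_funB.
  rewrite (eq_integral (fun t => ((V p t - V q t) ^+ 2)%:E)) ?HV ?ltry// => t _.
  by rewrite /= ger0_norm// sqr_ge0.
have hP a b a' b' : has_int (fun t => (V b t - V a t) * (V b' t - V a' t)) (C * polar a b a' b').
  have := has_intZ 2^-1 (has_intD (has_intD (has_intD (hV b a') (hV a b')) (has_intZ (- 1) (hV b b'))) (has_intZ (- 1) (hV a a'))).
  rewrite (_ : 2^-1 * _ = C * polar a b a' b'); last by rewrite /polar; ring.
  move=> [h1 h2]; split; first by apply: eq_integrable h1 => // t _ /=; congr (_%:E); field.
  by rewrite -h2; apply: eq_integral => t _ /=; congr (_%:E); field.
have := has_int_sum s (fun x => has_int_sum s (fun y => has_intZ x.2 (has_intZ y.2 (hP x.1.1 x.1.2 y.1.1 y.1.2)))).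
have -> : \sum_(x <- s) \sum_(y <- s) x.2 * (y.2 * (C * polar x.1.1 x.1.2 y.1.1 y.1.2)) =
    C * \sum_(x <- s) \sum_(y <- s) x.2 * (y.2 * polar x.1.1 x.1.2 y.1.1 y.1.2).
  rewrite mulr_sumr; apply: eq_bigr => x _; rewrite mulr_sumr; apply: eq_bigr => y _; ring.
have E t : (\sum_(x <- s) x.2 * (V x.1.2 t - V x.1.1 t)) ^+ 2 =
    \sum_(x <- s) \sum_(y <- s) x.2 * (y.2 * ((V x.1.2 t - V x.1.1 t) * (V y.1.2 t - V y.1.1 t))).
  rewrite expr2 mulr_suml; apply: eq_bigr => x _; rewrite mulr_sumr; apply: eq_bigr => y _; ring.
move=> [h1 h2]; split; first by apply: eq_integrable h1 => // t _ /=; rewrite E.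
by rewrite -h2; apply: eq_integral => t _ /=; rewrite E.
Qed.

End square_of_increments.

(** Extends the index set of a family on [0, T] to all reals, so that the squared distances required
    by [square_sum_incr] are available for every pair of indices. *)
Definition clamp (R : realType) (T p : R) : R := Num.max 0 (Num.min p T).

Lemma clamp_id (R : realType) (T p : R) : 0 <= p -> p <= T -> clamp T p = p.
Proof. by move=> p0 pT; rewrite /clamp min_l// max_r. Qed.

Lemma clamp_itv (R : realType) (T p : R) : 0 <= T -> 0 <= clamp T p <= T.
Proof. by move=> T0; rewrite /clamp le_max lexx/= ge_max T0 ge_min lexx orbT. Qed.

Section ito.
Context {R : realType} {d : measure_display} {Omega : measurableType d}.
Variables (P : probability Omega R) (T : R) (W : R -> Omega -> R).
Hypotheses (T0 : 0 <= T) (HW : is_wiener P `[0, T] W).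

Lemma wiener_sq s t : 0 <= s <= T -> 0 <= t <= T ->
  (\int[P]_w ((W s w - W t w) ^+ 2)%:E = (fine (normal_m2 R) * `|s - t|)%:E)%E.
Proof.
wlog st : s t / t <= s => [hw|].
  case: (leP t s) => [ts|/ltW st] ? ?; first exact: hw.
  rewrite distrC -(hw t s)//; apply: eq_integral => w _.
  by rewrite -[in RHS]sqrrN opprB.
move=> /andP[s0 sT] /andP[t0 tT].
have [_ [mW [_ H]]] := HW.
have mWs : measurable_fun setT (W s) by apply: mW; rewrite /= in_itv/= s0.
have mWt : measurable_fun setT (W t) by apply: mW; rewrite /= in_itv/= t0.
rewrite ger0_norm ?subr_ge0//.
have [->|nst] := eqVneq s t.
  under eq_integral do rewrite subrr expr0n.
  by rewrite integral0 subrr mulr0.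
have lst : 0 < s - t by rewrite subr_gt0 lt_neqAle eq_sym nst.
rewrite (@second_moment_law _ _ _ P (fun w => W s w - W t w) _ lst).
- rewrite muleC -[in LHS](@fineK _ (normal_m2 R)) ?EFinM//.
  rewrite ge0_fin_numE ?normal_m2_fin//.
  by apply: integral_ge0 => x _; rewrite lee_fin sqr_ge0.
- exact: measurable_funB.
move=> B mB.
have [||_ H2] := H 1%N (fun i => if i == 0%N then t else s).
- by move=> [|[|]]//= _; rewrite in_itv/= ?t0 ?s0.
- by move=> [|]//= _; rewrite -subr_gt0.
exact: (H2 0%N).
Qed.

(** Up to a constant, the indicators of the half-lines below p have the same squared distances as
    the values of W in [wiener_sq]. By [square_sum_incr] these distances determine the quadratic
    form, which is all that the isometry uses. *)
Lemma indic_sq p q :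
  (\int[lebesgue_measure]_(x in `[0%R, T]) (((x < clamp T p)%R%:R - (x < clamp T q)%R%:R) ^+ 2 : R)%:E
   = (1 * `|clamp T p - clamp T q|)%:E)%E.
Proof.
wlog st : p q / clamp T q <= clamp T p => [hw|].
  case: (leP (clamp T q) (clamp T p)) => [ts|/ltW st]; first exact: hw.
  rewrite distrC -(hw q p)//; apply: eq_integral => w _.
  by rewrite -[in RHS]sqrrN opprB.
have /andP[p0 pT] := clamp_itv p T0; have /andP[q0 qT] := clamp_itv q T0.
rewrite mul1r ger0_norm ?subr_ge0//.
transitivity (\int[lebesgue_measure]_(x in `[0%R, T]) (\1_(`[clamp T q, clamp T p[%classic : set R) x)%:E)%E.
  apply: eq_integral => x _; congr (_%:E); rewrite indicE.
  have [xq|xq] := ltP x (clamp T q).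
    rewrite (lt_le_trans xq st) subrr expr0n memNset//= in_itv/= leNgt xq//.
  rewrite subr0; have [xp|xp] := ltP x (clamp T p).
    by rewrite expr1n mem_set//= in_itv/= xq xp.
  by rewrite expr0n memNset//= in_itv/= ltNge xp andbF.
rewrite integral_indic//= setIidl.
  rewrite lebesgue_measure_itv/= lte_fin.
  case: ltP => // le; have -> : clamp T p = clamp T q by apply/le_anti; rewrite st le.
  by rewrite subrr.
move=> x /=; rewrite !in_itv/= => /andP[h1 h2].
by rewrite (le_trans q0 h1)/= (le_trans (ltW h2)).
Qed.

Let cin p : 0 <= clamp T p <= T. Proof. exact: clamp_itv. Qed.

Let mW p : measurable_fun setT (W (clamp T p)).
Proof. by case: HW => _ [+ _]; apply; rewrite /= in_itv/= cin. Qed.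

Lemma stepW_clamp s : step_ok T s ->
  stepW W s = fun w => \sum_(x <- s) x.2 * (W (clamp T x.1.2) w - W (clamp T x.1.1) w).
Proof.
move=> /allP sok; apply/funext => w; apply: eq_big_seq => x /sok /andP[/andP[a b] c].
by rewrite !clamp_id// (le_trans a b, le_trans b c).
Qed.

Lemma measurable_stepW s : step_ok T s -> measurable_fun setT (stepW W s).
Proof.
move=> /stepW_clamp ->; apply: measurable_sum => x; apply: measurable_funM => //.
exact: measurable_funB.
Qed.

(* The value of the constant (it is 1) is never needed, only its finiteness. *)
Lemma ito_isometry (s : seq (R * R * R)) : step_ok T s ->
  (\int[P]_w ((stepW W s w) ^+ 2)%:E =
   (fine (normal_m2 R))%:E * \int[lebesgue_measure]_(t in `[0%R, T]) ((stepf s t) ^+ 2)%:E)%E.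
Proof.
move=> sok'; have /allP sok := sok'.
pose dst p q : R := `|clamp T p - clamp T q|.
have [_ h1] := @square_sum_incr _ _ _ P setT measurableT (fun p => W (clamp T p)) (fine (normal_m2 R)) dst mW
  (fun p q => wiener_sq (cin p) (cin q)) s.
have mI p : measurable_fun `[0, T] (fun x : R => (x < clamp T p)%R%:R : R).
  apply: measurable_funTS.
  rewrite (_ : (fun x => _) = \1_(`]-oo, clamp T p[)); first exact: measurable_indic.
  by apply/funext => x; rewrite indicE; congr (nat_of_bool _)%:R; apply/idP/idP; rewrite inE/= in_itv.
have [_ h2] := @square_sum_incr _ _ _ (@lebesgue_measure R) `[0, T] (measurable_itv _)
  (fun p (x : R) => (x < clamp T p)%R%:R) 1 dst mI indic_sq s.
rewrite mul1r in h2.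
rewrite (stepW_clamp sok').
have -> : (\int[lebesgue_measure]_(t in `[0%R, T]) ((stepf s t) ^+ 2)%:E =
  \int[lebesgue_measure]_(t in `[0%R, T]) ((\sum_(x <- s) x.2 * ((t < clamp T x.1.2)%R%:R - (t < clamp T x.1.1)%R%:R)) ^+ 2)%:E)%E.
  apply: eq_integral => t _; congr (_ ^+ 2)%:E; apply: eq_big_seq => x /sok /andP[/andP[a b] c].
  rewrite !clamp_id// ?(le_trans a b) ?(le_trans b c)//.
  have [xq|xq] := ltP t x.1.1; first by rewrite (lt_le_trans xq b) subrr mulr0.
  by case: ltP => _ /=; rewrite ?subr0 ?mulr1 ?mulr0.
by rewrite h1 h2 -EFinM.
Qed.

End ito.

(** * Law of weighted sums of increments over consecutive blocks *)

Section weighted_blocks.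
Context {R : realType} {d : measure_display} {Omega : measurableType d}.
Variables (P : probability Omega R) (T : R) (W : R -> Omega -> R).
Hypotheses (T0 : 0 < T) (GW : gauss_incr P `[0, T] id W).

(* Running the Wiener process itself at the accumulated variance gives a
   family with the same law as the weighted increments; block sums of that
   family are single increments, so no convolution of normal laws is needed. *)
Lemma weighted_blocks (n N : nat) (t a : nat -> R) : (0 < N)%N ->
  (forall l, (l <= n * N)%N -> 0 <= t l <= T) ->
  (forall l, (l < n * N)%N -> t l < t l.+1) ->
  (forall l, (l < n * N)%N -> 0 < a l) ->
  forall x : nat -> R,
  P [set w | forall i, (i < n)%N ->
      \sum_(j < N) a (i * N + j)%N * (W (t (i * N + j).+1) w - W (t (i * N + j)%N) w) < x i] =
  (\prod_(i < n) Ncdf (x i /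
     Num.sqrt (\sum_(j < N) a (i * N + j)%N ^+ 2 * (t (i * N + j).+1 - t (i * N + j)%N))))%:E.
Proof.
move=> N0 tT tS a0 x; set L := (n * N)%N.
have Ln i j : (i < n)%N -> (j < N)%N -> (i * N + j < L)%N.
  move=> iltn jN; apply: (@leq_trans (i * N + N)); first by rewrite ltn_add2l.
  by rewrite -mulSnr leq_mul2r iltn orbT.
pose v l := a l ^+ 2 * (t l.+1 - t l).
have v0 l : (l < L)%N -> 0 < v l.
  by move=> lL; rewrite mulr_gt0// ?exprn_gt0 ?a0// subr_gt0 tS.
pose S k := \sum_(l < k) v l.
have SS k : S k.+1 = S k + v k by rewrite /S big_ord_recr.
have SD i k : S (i + k)%N = S i + \sum_(j < k) v (i + j)%N.
  by elim: k => [|k IH]; rewrite ?addn0 ?big_ord0 ?addr0// addnS SS IH big_ord_recr addrA.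
have S0 k : (k <= L)%N -> 0 <= S k.
  by move=> kL; apply: sumr_ge0 => l _; apply/ltW/v0; exact: leq_trans (ltn_ord l) kL.
have SL k : (k <= L)%N -> S k <= S L.
  move=> kL; rewrite -(subnKC kL) SD lerDl; apply: sumr_ge0 => j _.
  by apply/ltW/v0; rewrite -{2}(subnKC kL) ltn_add2l.
(* The clock [S] may run past T, so it is compressed into [0, T], and the factor 1 / k with k^2 = k2
   restores the variances. Adding 1 keeps the denominator positive when there is no block. *)
pose k2 := T / (1 + S L).
have k20 : 0 < k2 by rewrite divr_gt0// ltr_pwDl// S0.
pose k := Num.sqrt k2; have k0 : 0 < k by rewrite sqrtr_gt0.
have kk : k ^+ 2 = k2 by rewrite sqr_sqrtr ?ltW.
pose tau l := k2 * S l.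
have tauT l : (l <= L)%N -> `[0, T]%classic (tau l).
  move=> lL; rewrite /= in_itv/= mulr_ge0 ?S0 ?(ltW k20)//=.
  rewrite /tau /k2 -mulrA ler_piMr ?(ltW T0)// mulrC ler_pdivrMr ?mul1r ?ltr_pwDl ?S0//.
  by rewrite (le_trans (SL _ lL))// lerDr.
have tauS l : (l < L)%N -> tau l < tau l.+1.
  by move=> lL; rewrite /tau ltr_pM2l// SS ltrDl v0.
have [mW HW] := GW.
have mWt l : (l <= L)%N -> measurable_fun setT (W (t l)).
  by move=> lL; apply: mW; rewrite /= in_itv/= tT.
have mWtau l : (l <= L)%N -> measurable_fun setT (W (tau l)) by move=> lL; apply/mW/tauT.
(* Term by term both families have variance [v l]: by weighting in the first, by the time change in
   the second. *)
have eqI : eqlaw P P (fun l w => if (l < L)%N then a l * (W (t l.+1) w - W (t l) w) else 0)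
    (fun l w => if (l < L)%N then k^-1 * (W (tau l.+1) w - W (tau l) w) else 0).
  apply: eqlaw_finite => [l lL|l lL|m y mL].
  - by apply: measurable_funM => //; apply: measurable_funB; apply: mWt => //; exact: ltnW.
  - by apply: measurable_funM => //; apply: measurable_funB; apply: mWtau => //; exact: ltnW.
  rewrite (_ : [set w | _] = [set w | forall l, (l < m)%N -> W (t l.+1) w - W (t l) w < y l / a l]); last first.
    apply/seteqP; split => w h l lm; have := h l lm;
      by rewrite /= ltr_pdivlMr ?a0 ?(leq_trans lm)// mulrC.
  rewrite (_ : [set w | forall i, _ -> k^-1 * _ < _] =
     [set w | forall l, (l < m)%N -> W (tau l.+1) w - W (tau l) w < k * y l]); last first.
    by apply/seteqP; split => w h l lm; have := h l lm; rewrite /= ltr_pdivrMl.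
  rewrite !HW.
  - congr (_%:E); apply: eq_bigr => l _ /=.
    have lL : (l < L)%N by exact: leq_trans (ltn_ord l) mL.
    have al := a0 _ lL.
    have dt : 0 < t l.+1 - t l by rewrite subr_gt0 tS.
    rewrite /tau SS -mulrBr addrAC subrr add0r -kk /v mulrA sqrtrM ?mulr_ge0 ?sqr_ge0 ?(ltW k0) ?(ltW al)//.
    rewrite -exprMn sqrtr_sqr gtr0_norm ?mulr_gt0//.
    congr Ncdf; field.
    by rewrite !gt_eqF// sqrtr_gt0.
  - by move=> i im; apply: tauT; exact: leq_trans im mL.
  - by move=> i im; apply: tauS; exact: leq_trans im mL.
  - by move=> i im; rewrite /= in_itv/= tT//; exact: leq_trans im mL.
  - by move=> i im; apply: tS; exact: leq_trans im mL.
pose F i (f : path_space R) : R := \sum_(j < N) f (i * N + j)%N.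
have mF i : measurable_fun setT (F i).
  by apply: measurable_sum => j; exact: measurable_coord.
have := eqlaw_comp mF eqI (E := [set f | forall i, (i < n)%N -> f i < x i]).
set E0 := [set w | _]; set E1 := [set w | _]; set E2 := [set w | _]; set E3 := [set w | _].
have -> : E1 = E3.
  apply/seteqP; split => w h i iltn; have := h i iltn; rewrite /= /F.
    by move/(le_lt_trans _); apply; apply: ler_sum => j _; rewrite Ln.
  by move/(le_lt_trans _); apply; apply: ler_sum => j _; rewrite Ln.
have -> : E2 = [set w | forall i, (i < n)%N -> W (tau (i.+1 * N)%N) w - W (tau (i * N)%N) w < k * x i].
  have FE i w : (i < n)%N -> F i (fun l => if (l < L)%N then k^-1 * (W (tau l.+1) w - W (tau l) w) else 0) =
      k^-1 * (W (tau (i.+1 * N)%N) w - W (tau (i * N)%N) w).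
    move=> iltn; rewrite /F; under eq_bigr do rewrite Ln//.
    rewrite -mulr_sumr; congr (_ * _).
    rewrite -(big_mkord xpredT (fun j => W (tau (i * N + j).+1) w - W (tau (i * N + j)%N) w)).
    under eq_bigr do rewrite -addnS.
    by rewrite (@telescope_sumr _ 0 N (fun j => W (tau (i * N + j)%N) w))// addn0 -mulSnr.
  by apply/seteqP; split => w h i iltn; have := h i iltn; rewrite /= FE// ltr_pdivrMl.
move=> ->; last by apply: sub_sigma_algebra; exists n, x.
rewrite (HW n (fun i => tau (i * N)%N)).
- congr (_%:E); apply: eq_bigr => i _; congr Ncdf.
  rewrite /tau -mulrBr mulSnr SD addrAC subrr add0r -kk sqrtrM ?sqr_ge0// sqrtr_sqr gtr0_norm//.
  by rewrite invfM mulrACA divff ?gt_eqF// mul1r.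
- by move=> i im; apply: tauT; rewrite leq_mul2r im orbT.
- move=> i im; rewrite /tau ltr_pM2l// mulSnr SD ltrDl.
  rewrite (bigD1 (Ordinal N0))//= ltr_pwDl//; first by apply: v0; rewrite Ln.
  by apply: sumr_ge0 => j _; apply/ltW/v0; rewrite Ln.
Qed.

End weighted_blocks.

Lemma chebyshev_sq (R : realType) d (Omega : measurableType d)
  (P : probability Omega R) (X : Omega -> R) (e : R) : measurable_fun setT X -> 0 < e ->
  (P [set w | (e <= `|X w|)%R] <= (e ^- 2)%:E * \int[P]_w (X w ^+ 2)%:E)%E.
Proof.
move=> mX e0; rewrite -lee_pdivrMl ?invr_gt0 ?exprn_gt0// invrK.
have mA : measurable [set w | e <= `|X w|] by exact: measurable_norm_ge.
rewrite -integral_cst//.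
apply: (@le_trans _ _ (\int[P]_(w in [set w | (e <= `|X w|)%R]) (X w ^+ 2)%:E)%E).
  apply: ge0_le_integral => //=.
  - by move=> w _; rewrite lee_fin sqr_ge0.
  - by apply/measurable_EFinP/measurable_funX; exact: measurable_funTS.
  - by move=> w /= eX; rewrite lee_fin -[leRHS]real_normK ?num_real// ler_sqr ?nnegrE// ltW.
apply: ge0_subset_integral => //.
- by apply/measurable_EFinP; exact: measurable_funX.
- by move=> w _; rewrite lee_fin sqr_ge0.
Qed.

Lemma fine_probability_cup (R : realType) d (Omega : measurableType d)
  (P : probability Omega R) (n : nat) (A B : set Omega) (C : nat -> set Omega) :
  measurable A -> measurable B -> (forall i, (i < n)%N -> measurable (C i)) ->
  (forall w, A w -> (forall i, (i < n)%N -> ~ C i w) -> B w) ->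
  fine (P A) <= fine (P B) + \sum_(i < n) fine (P (C i)).
Proof.
move=> mA mB mC ABC.
rewrite -lee_fin EFinD -sumEFin !fineK ?fin_num_measure//.
rewrite (eq_bigr (fun i : 'I_n => P (C i))); last first.
  by move=> i _; rewrite fineK// fin_num_measure//; exact: mC.
pose U := \big[setU/set0]_(i < n) C i.
have mU : measurable U by apply: bigsetU_measurable => i _; exact: mC.
apply: (@le_trans _ _ (P (B `|` U))).
  apply: le_measure; rewrite ?inE//; first exact: measurableU.
  move=> w Aw; have [h|/existsNP[i /not_implyP[iltn /contrapT Ciw]]] :=
    pselect (forall i, (i < n)%N -> ~ C i w); first by left; exact: ABC.
  by right; rewrite /U -bigcup_mkord; exists i.
apply: (@le_trans _ _ (P B + P U)%E); first exact: measureU2.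
by rewrite leeD2l//; apply: Boole_inequality.
Qed.

(** L2 convergence gives convergence in probability. Shifting every threshold by e and discarding
    the events |S - Y| >= e traps the distribution function of Y between [f (- e)] and [f e], and
    continuity of [Ncdf] closes the gap. The law is prescribed from N = 1 on, since a block must
    contain a cell. *)
Lemma gauss_limit (R : realType) d (Omega : measurableType d)
  (P : probability Omega R) (n : nat) (S : nat -> nat -> Omega -> R) (Y : nat -> Omega -> R)
  (V : nat -> nat -> R) (v : nat -> R) :
  (forall N i, (i < n)%N -> measurable_fun setT (S N i)) ->
  (forall i, (i < n)%N -> measurable_fun setT (Y i)) ->
  (forall i, (i < n)%N -> 0 < v i) ->
  (forall i, (i < n)%N -> V N i @[N --> \oo] --> v i) ->
  (forall N x, P [set w | forall i, (i < n)%N -> S N.+1 i w < x i] =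
     (\prod_(i < n) Ncdf (x i / Num.sqrt (V N.+1 i)))%:E) ->
  (forall i, (i < n)%N -> (\int[P]_w ((S N i w - Y i w) ^+ 2)%:E)%E @[N --> \oo] --> 0%E) ->
  forall x : nat -> R, P [set w | forall i, (i < n)%N -> Y i w < x i] =
    (\prod_(i < n) Ncdf (x i / Num.sqrt (v i)))%:E.
Proof.
move=> mS mY v0 Vv HS SY x.
have mE (Z : nat -> Omega -> R) (y : nat -> R) : (forall i, (i < n)%N -> measurable_fun setT (Z i)) ->
    measurable [set w | forall i, (i < n)%N -> Z i w < y i].
  move=> mZ; rewrite (_ : mkset _ = \bigcap_(i in `I_n) (Z i @^-1` `]-oo, y i[)); last first.
    by apply/seteqP; split => w /= h i /h; rewrite /= in_itv.
  apply: fin_bigcap_measurable => // i iltn.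
  by rewrite -[X in measurable X]setTI; apply: mZ.
have mB N i (e : R) : (i < n)%N -> measurable [set w | e <= `|S N i w - Y i w|].
  by move=> iltn; apply: measurable_norm_ge; apply: measurable_funB; [exact: mS|exact: mY].
pose f (e : R) := \prod_(i < n) Ncdf ((x i + e) / Num.sqrt (v i)).
pose D N (e : R) := \sum_(i < n) fine (P [set w | e <= `|S N i w - Y i w|]).
have D0 e : 0 < e -> D N e @[N --> \oo] --> 0.
  move=> e0; rewrite (_ : 0 = \sum_(i < n) 0); last by rewrite big1.
  apply: (cvg_big (r := index_enum 'I_n) (Ff := fun (i : 'I_n) N => fine (P [set w | e <= `|S N i w - Y i w|]))
    (Fa := fun=> 0) add_continuous) => i _; have iltn := ltn_ord i.
  have : P [set w | (e <= `|S N i w - Y i w|)%R] @[N --> \oo] --> 0%:E.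
    apply: (@squeeze_cvge _ _ _ _ (fun=> 0%E) _ (fun N => (e ^- 2)%:E * \int[P]_w ((S N i w - Y i w) ^+ 2)%:E)%E).
    - near=> N; rewrite measure_ge0/=; apply: chebyshev_sq => //.
      by apply: measurable_funB; [exact: mS|exact: mY].
    - exact: cvg_cst.
    - rewrite -[X in _ --> X](mule0 (e ^- 2)%:E); apply: cvgeZl => //.
      exact: SY.
  by move/fine_cvgP => [].
have Df e : \prod_(i < n) Ncdf ((x i + e) / Num.sqrt (V N.+1 i)) @[N --> \oo] --> f e.
  apply: (cvg_big (r := index_enum 'I_n) (Ff := fun (i : 'I_n) N => Ncdf ((x i + e) / Num.sqrt (V N.+1 i)))
    (Fa := fun i => Ncdf ((x i + e) / Num.sqrt (v i))) mul_continuous) => i _; have iltn := ltn_ord i; apply: (@cvg_comp _ _ _ _ (@Ncdf R)); last exact: Ncdf_continuous.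
  apply: cvgMr; apply: cvgV; first by rewrite sqrtr_eq0 -ltNge v0.
  apply: (@cvg_comp _ _ _ _ Num.sqrt); last exact: sqrt_continuous.
  by rewrite (cvg_shiftS (V ^~ i)); exact: Vv.
have f0 : f e @[e --> 0] --> f 0.
  apply: (cvg_big (r := index_enum 'I_n) (Ff := fun (i : 'I_n) e => Ncdf ((x i + e) / Num.sqrt (v i)))
    (Fa := fun i => Ncdf ((x i + 0) / Num.sqrt (v i))) mul_continuous) => i _; apply: (@cvg_comp _ _ _ _ (@Ncdf R)); last exact: Ncdf_continuous.
  apply: cvgMl; apply: cvgD; first exact: cvg_cst.
  exact: cvg_id.
have fx : f 0 = \prod_(i < n) Ncdf (x i / Num.sqrt (v i)).
  by apply: eq_bigr => i _; rewrite addr0.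
pose p := fine (P [set w | forall i, (i < n)%N -> Y i w < x i]).
suff : p = f 0 by rewrite -fx => <-; rewrite fineK ?fin_num_measure//; exact: mE.
have up e : 0 < e -> p <= f e.
  move=> e0.
  have : (\prod_(i < n) Ncdf ((x i + e) / Num.sqrt (V N.+1 i))) + D N.+1 e @[N --> \oo] --> f e + 0.
    by apply: cvgD => //; rewrite (cvg_shiftS (D ^~ e)); exact: D0.
  rewrite addr0 => h; apply: (cvgr_to_ge h); near=> N.
  have -> : \prod_(i < n) Ncdf ((x i + e) / Num.sqrt (V N.+1 i)) =
      fine (P [set w | forall i, (i < n)%N -> S N.+1 i w < x i + e]) by rewrite HS.
  apply: (@fine_probability_cup _ _ _ _ n _ _ (fun i => [set w | e <= `|S N.+1 i w - Y i w|])) => //.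
  - exact: mE.
  - by apply: mE => i; exact: mS.
  - by move=> i; exact: mB.
  move=> w Yx SYe i iltn; have := SYe i iltn => /= /negP; rewrite -ltNge.
  by have := Yx i iltn; rewrite ltr_norml => ? /andP[? ?]; lra.
have dn e : 0 < e -> f (- e) <= p.
  move=> e0.
  have : (\prod_(i < n) Ncdf ((x i + - e) / Num.sqrt (V N.+1 i))) - D N.+1 e @[N --> \oo] --> f (- e) - 0.
    by apply: cvgB => //; rewrite (cvg_shiftS (D ^~ e)); exact: D0.
  rewrite subr0 => h; apply: (cvgr_to_le h); near=> N.
  have -> : \prod_(i < n) Ncdf ((x i - e) / Num.sqrt (V N.+1 i)) =
      fine (P [set w | forall i, (i < n)%N -> S N.+1 i w < x i - e]) by rewrite HS.
  rewrite lerBlDr.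
  apply: (@fine_probability_cup _ _ _ _ n _ _ (fun i => [set w | e <= `|S N.+1 i w - Y i w|])) => //.
  - by apply: mE => i; exact: mS.
  - exact: mE.
  - by move=> i; exact: mB.
  move=> w Yx SYe i iltn; have := SYe i iltn => /= /negP; rewrite -ltNge.
  by have := Yx i iltn; rewrite ltr_norml => ? /andP[? ?]; lra.
apply/le_anti/andP; split.
  apply: (cvgr_to_ge (cvg_at_right_filter f0)); near=> e; apply: up; near: e.
  exact: nbhs_right_gt.
have f0' : f (- e) @[e --> 0] --> f 0.
  have : - e @[e --> (0:R)] --> (0:R) by rewrite -[X in _ --> X]oppr0; apply: cvgN; exact: cvg_id.
  by move/cvg_comp; apply.
apply: (cvgr_to_le (cvg_at_right_filter f0')); near=> e; apply: dn; near: e.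
exact: nbhs_right_gt.
Unshelve. all: by end_near. Qed.

(** * Equal subdivisions and step functions on them *)

Definition cell (R : realType) (A B : R) (N j : nat) : R := A + j%:R * ((B - A) / N%:R).

Definition grid_steps (R : realType) (A B : R) (N : nat) (a : nat -> R) : seq (R * R * R) :=
  [seq (cell A B N j, cell A B N j.+1, a j) | j <- iota 0 N].

Section grid.
Context {R : realType}.
Variables (A B : R) (N : nat) (AB : A < B) (N0 : (0 < N)%N).

Let eta0 : 0 < (B - A) / N%:R. Proof. by rewrite divr_gt0 ?subr_gt0// ltr0n. Qed.

Lemma cellS j : cell A B N j.+1 = cell A B N j + (B - A) / N%:R.
Proof. by rewrite /cell -natr1 mulrDl mul1r addrA. Qed.

Lemma cell0 : cell A B N 0 = A. Proof. by rewrite /cell mul0r addr0. Qed.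

Lemma cellN : cell A B N N = B.
Proof. by rewrite /cell mulrC divfK ?pnatr_eq0 -?lt0n// addrC subrK. Qed.

Lemma cell_le i j : (i <= j)%N -> cell A B N i <= cell A B N j.
Proof. by move=> ij; rewrite lerD2l ler_wpM2r ?(ltW eta0)// ler_nat. Qed.

Lemma cell_lt i j : (i < j)%N -> cell A B N i < cell A B N j.
Proof. by move=> ij; rewrite ltrD2l ltr_pM2r// ltr_nat. Qed.

Lemma cell_itv j : (j <= N)%N -> A <= cell A B N j <= B.
Proof. by move=> jN; rewrite -{1}cell0 -{4}cellN !cell_le. Qed.

Lemma cell_ex t : A <= t -> t < B ->
  exists2 j, (j < N)%N & cell A B N j <= t < cell A B N j.+1.
Proof.
move=> At tB; have z0 : 0 <= (t - A) / ((B - A) / N%:R) by rewrite divr_ge0 ?subr_ge0// ltW.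
have /andP[h1 h2] := truncn_itv z0; set j := Num.truncn _ in h1 h2.
have a1 : cell A B N j <= t by rewrite /cell -lerBrDl -ler_pdivlMr.
have a2 : t < cell A B N j.+1 by rewrite /cell -ltrBlDl -ltr_pdivrMr.
exists j; last by rewrite a1.
by rewrite ltnNge; apply/negP => /cell_le; rewrite cellN => h; have := le_trans h a1; rewrite leNgt tB.
Qed.

Lemma stepf_grid_sum a t : stepf (grid_steps A B N a) t =
  \sum_(j < N) (if (cell A B N j <= t) && (t < cell A B N j.+1) then a j else 0).
Proof. by rewrite /stepf /grid_steps big_map -{1}(subn0 N) big_mkord. Qed.

Lemma stepf_grid a t j : (j < N)%N -> cell A B N j <= t < cell A B N j.+1 ->
  stepf (grid_steps A B N a) t = a j.
Proof.
move=> jN tj; rewrite stepf_grid_sum (bigD1 (Ordinal jN))//= tj big1 ?addr0// => i ij.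
case: ifPn => // /andP[h1 h2]; exfalso; move: tj => /andP[h3 h4].
have : (i < j)%N \/ (j < i)%N by apply/orP; rewrite -neq_ltn; exact: ij.
by case=> /cell_le; rewrite leNgt ?(le_lt_trans h3 h2) ?(le_lt_trans h1 h4).
Qed.

Lemma stepf_grid_out a t : t < A \/ B <= t -> stepf (grid_steps A B N a) t = 0.
Proof.
move=> h; rewrite stepf_grid_sum big1// => j _; case: ifPn => // /andP[h1 h2]; exfalso.
have /andP[c1 _] := cell_itv (ltnW (ltn_ord j)); have /andP[_ c2] := cell_itv (ltn_ord j).
by case: h => h; [have := lt_le_trans h c1; rewrite ltNge h1|have := le_trans c2 h; rewrite leNgt h2].
Qed.

Lemma stepf_grid_sq a t : stepf (grid_steps A B N a) t ^+ 2 =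
  stepf (grid_steps A B N (fun j => a j ^+ 2)) t.
Proof.
have [tA|At] := ltP t A; first by rewrite !stepf_grid_out ?expr0n//; left.
have [tB|Bt] := ltP t B; last by rewrite !stepf_grid_out ?expr0n//; right.
by have [j jN tj] := cell_ex At tB; rewrite !(stepf_grid _ jN tj).
Qed.

Lemma stepf_grid_bound a C t : 0 <= C -> (forall j, (j < N)%N -> `|a j| <= C) ->
  `|stepf (grid_steps A B N a) t| <= C.
Proof.
move=> C0 aC.
have [tA|At] := ltP t A; first by rewrite stepf_grid_out ?normr0//; left.
have [tB|Bt] := ltP t B; last by rewrite stepf_grid_out ?normr0//; right.
by have [j jN tj] := cell_ex At tB; rewrite (stepf_grid _ jN tj) aC.
Qed.

Lemma measurable_stepf (s : seq (R * R * R)) : measurable_fun [set: R] (stepf s).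
Proof.
apply: measurable_sum => x.
rewrite (_ : (fun t : R => _) = fun t => x.2 * \1_(`[x.1.1, x.1.2[%classic : set R) t); last first.
  apply/funext => t; rewrite indicE; case: ifPn => h; first by rewrite mem_set ?mulr1//= in_itv.
  by rewrite memNset ?mulr0//= in_itv/=; exact/negP.
by apply: measurable_funM => //; exact: measurable_indic.
Qed.

Lemma integral_stepf_grid a T : 0 <= A -> B <= T ->
  (\int[lebesgue_measure]_(t in `[0%R, T]) (stepf (grid_steps A B N a) t)%:E =
   (\sum_(j < N) a j * (cell A B N j.+1 - cell A B N j))%:E)%E.
Proof.
move=> A0 BT.
have hj (j : 'I_N) : has_int (@lebesgue_measure R) `[0, T]
    (fun t => if (cell A B N j <= t) && (t < cell A B N j.+1) then a j else 0)
    (a j * (cell A B N j.+1 - cell A B N j)).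
  have /andP[c1 _] := cell_itv (ltnW (ltn_ord j)); have /andP[_ c2] := cell_itv (ltn_ord j).
  have := @has_intZ _ _ _ (@lebesgue_measure R) `[0, T] (measurable_itv _) (a j)
    (\1_(`[cell A B N j, cell A B N j.+1[%classic : set R)) (cell A B N j.+1 - cell A B N j).
  case.
    split.
      apply/integrableP; split; first by apply/measurable_EFinP; exact: measurable_indic.
      apply: (@le_lt_trans _ _ (\int[lebesgue_measure]_(t in `[0%R, T]) (cst 1%E t))%E).
        apply: ge0_le_integral => //=.
        - by apply/measurable_EFinP; apply: measurableT_comp => //; exact: measurable_indic.
        - by move=> t _; rewrite lee_fin indicE; case: (_ \in _); rewrite ?normr1 ?normr0.
      rewrite integral_cst//= mul1e.
      by rewrite /= lebesgue_measure_itv/=; case: ifP; rewrite -?EFinB ltry.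
    rewrite integral_indic//= setIidl.
      by rewrite lebesgue_measure_itv/= lte_fin cell_lt// EFinB.
    move=> x /=; rewrite !in_itv/= => /andP[h1 h2].
    by rewrite (le_trans _ h1) ?(le_trans A0)//= (le_trans (ltW h2))// (le_trans c2).
  have E t : a j * \1_(`[cell A B N j, cell A B N j.+1[%classic : set R) t =
      if (cell A B N j <= t) && (t < cell A B N j.+1) then a j else 0.
    rewrite indicE; case: ifPn => h; first by rewrite mem_set ?mulr1//= in_itv.
    by rewrite memNset ?mulr0//= in_itv/=; exact/negP.
  move=> i1 i2; split; first by apply: eq_integrable i1 => // t _ /=; rewrite E.
  by rewrite -i2; apply: eq_integral => t _; rewrite E.
have [_ <-] := @has_int_sum _ _ _ (@lebesgue_measure R) `[0, T] (measurable_itv _) _ (index_enum _) _ _ hj.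
by apply: eq_integral => t _; rewrite stepf_grid_sum.
Qed.

End grid.

Section ito_bound.
Context {R : realType} {d : measure_display} {Omega : measurableType d}.
Variables (P : probability Omega R) (T : R) (W : R -> Omega -> R).
Hypotheses (T0 : 0 <= T) (HW : is_wiener P `[0, T] W).

Lemma integral_sq3 d' (X : measurableType d') (mu : {measure set X -> \bar R})
  (D : set X) (f1 f2 f3 : X -> R) : measurable D ->
  measurable_fun D f1 -> measurable_fun D f2 -> measurable_fun D f3 ->
  (\int[mu]_(x in D) ((f1 x + f2 x + f3 x) ^+ 2)%:E <=
   3%:E * (\int[mu]_(x in D) (f1 x ^+ 2)%:E + \int[mu]_(x in D) (f2 x ^+ 2)%:E + \int[mu]_(x in D) (f3 x ^+ 2)%:E))%E.
Proof.
move=> mD m1 m2 m3.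
have m (f : X -> R) : measurable_fun D f -> measurable_fun D (fun x => (f x ^+ 2)%:E).
  by move=> mf; apply/measurable_EFinP; exact: measurable_funX.
have p (f : X -> R) x : D x -> (0 <= (f x ^+ 2 : R)%:E)%E by move=> _; rewrite lee_fin sqr_ge0.
rewrite -ge0_integralD//; [|exact: p|exact: m|exact: p|exact: m].
rewrite -ge0_integralD//; [|by move=> x Dx; apply: adde_ge0; exact: p
  |by apply: emeasurable_funD; exact: m|exact: p|exact: m].
rewrite -ge0_integralZl//; last 2 first.
- by apply: emeasurable_funD; [apply: emeasurable_funD; exact: m|exact: m].
- by move=> x Dx; apply: adde_ge0; [apply: adde_ge0; exact: p|exact: p].
apply: ge0_le_integral => //.
- exact: (p (fun x => f1 x + f2 x + f3 x)).
- by apply: m; apply: measurable_funD => //; exact: measurable_funD.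
- apply: emeasurable_funM => //.
  by apply: emeasurable_funD; [apply: emeasurable_funD; exact: m|exact: m].
move=> x _; rewrite -!EFinD -EFinM lee_fin.
have := sqr_ge0 (f1 x - f2 x); have := sqr_ge0 (f1 x - f3 x); have := sqr_ge0 (f2 x - f3 x).
nra.
Qed.

Definition step_opp (s : seq (R * R * R)) := [seq (x.1, - x.2) | x <- s].

Lemma stepW_diff s1 s2 s3 w :
  stepW W (s1 ++ step_opp s2 ++ s3) w = stepW W s1 w - stepW W s2 w + stepW W s3 w.
Proof.
rewrite /stepW !big_cat big_map/= -addrA; congr (_ + (_ + _)).
by rewrite -sumrN; apply: eq_bigr => x _; rewrite mulNr.
Qed.

Lemma stepf_diff (s1 s2 s3 : seq (R * R * R)) t :
  stepf (s1 ++ step_opp s2 ++ s3) t = stepf s1 t - stepf s2 t + stepf s3 t.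
Proof.
rewrite /stepf !big_cat big_map/= -addrA; congr (_ + (_ + _)).
by rewrite -sumrN; apply: eq_bigr => x _; case: ifP => //; rewrite oppr0.
Qed.

Lemma step_ok_diff s1 s2 s3 : step_ok T s1 -> step_ok T s2 -> step_ok T s3 ->
  step_ok T (s1 ++ step_opp s2 ++ s3).
Proof. by rewrite /step_ok !all_cat all_map => -> /= h ->; rewrite andbT; exact: h. Qed.

(** Each Wiener integral comes with its own approximating steps [u] and [u'], unrelated to one
    another. Comparing s with u' - u through the isometry and passing to the limit shows that a step
    function close to f' - f in L2 has an integral close to I' - I. The factor 9 is two uses of (a +
    b + c)^2 <= 3 (a^2 + b^2 + c^2). *)
Lemma ito_bound f f' I I' s : measurable_fun `[0, T] f -> measurable_fun `[0, T] f' ->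
  is_wiener_integral P W T f I -> is_wiener_integral P W T f' I' -> step_ok T s ->
  (\int[lebesgue_measure]_(t in `[0%R, T]) ((stepf s t - (f' t - f t)) ^+ 2)%:E < +oo)%E ->
  (\int[P]_w ((stepW W s w - (I' w - I w)) ^+ 2)%:E <=
   (9 * fine (normal_m2 R))%:E *
     \int[lebesgue_measure]_(t in `[0%R, T]) ((stepf s t - (f' t - f t)) ^+ 2)%:E)%E.
Proof.
move=> mf mf' [mI [u [uok [uf uI]]]] [mI' [u' [u'ok [uf' uI']]]] sok Ky.
set c := fine (normal_m2 R).
have c0 : 0 <= c by apply: fine_ge0; apply: integral_ge0 => x _; rewrite lee_fin sqr_ge0.
have mst s' : measurable_fun `[0, T] (@stepf R s') by apply: measurable_funTS; exact: measurable_stepf.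
set K := (\int[lebesgue_measure]_(t in _) _)%E in Ky *.
have K0 : (0 <= K)%E by apply: integral_ge0 => x _; rewrite lee_fin sqr_ge0.
have main n : (\int[P]_w ((stepW W s w - (I' w - I w)) ^+ 2)%:E <=
   3%:E * (c%:E * (3%:E * (K + \int[lebesgue_measure]_(t in `[0%R, T]) ((stepf (u n) t - f t) ^+ 2)%:E
       + \int[lebesgue_measure]_(t in `[0%R, T]) ((stepf (u' n) t - f' t) ^+ 2)%:E)) +
     \int[P]_w ((stepW W (u n) w - I w) ^+ 2)%:E + \int[P]_w ((stepW W (u' n) w - I' w) ^+ 2)%:E))%E.
  (* The single step function s - u' + u, to which the isometry applies directly. *)
  pose r := s ++ step_opp (u' n) ++ u n.
  have rok : step_ok T r by exact: step_ok_diff.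
  apply: (@le_trans _ _ (\int[P]_w ((stepW W r w + (I w - stepW W (u n) w) + (stepW W (u' n) w - I' w)) ^+ 2)%:E)%E).
    apply: le_of_eq; apply: eq_integral => w _.
    by congr (_ ^+ 2)%:E; rewrite stepW_diff; ring.
  apply: le_trans (integral_sq3 _ _ _ _ _) _ => //.
  - exact: (measurable_stepW T0 HW).
  - by apply: measurable_funB => //; exact: (measurable_stepW T0 HW).
  - by apply: measurable_funB => //; exact: (measurable_stepW T0 HW).
  apply: lee_wpmul2l; first by rewrite lee_fin.
  apply: leeD; last by [].
  apply: leeD; last first.
    apply: le_of_eq; apply: eq_integral => w _.
    by congr (_%:E); rewrite -sqrrN opprB.
  rewrite (ito_isometry T0 HW rok) -/c; apply: lee_wpmul2l; first by rewrite lee_fin.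
  apply: (@le_trans _ _ (\int[lebesgue_measure]_(t in `[0%R, T])
     (((stepf s t - (f' t - f t)) + (stepf (u n) t - f t) + (f' t - stepf (u' n) t)) ^+ 2)%:E)%E).
    apply: le_of_eq; apply: eq_integral => t _.
    by congr (_ ^+ 2)%:E; rewrite stepf_diff; ring.
  apply: le_trans (integral_sq3 _ _ _ _ _) _ => //.
  - by apply: measurable_funB; [exact: mst|apply: measurable_funB; [exact: mf'|exact: mf]].
  - by apply: measurable_funB; [exact: mst|exact: mf].
  - by apply: measurable_funB; [exact: mf'|exact: mst].
  apply: lee_wpmul2l; first by rewrite lee_fin.
  apply: leeD; first by [].
  apply: le_of_eq; apply: eq_integral => t _.
  by congr (_%:E); rewrite -sqrrN opprB.
have Kf : K \is a fin_num by rewrite ge0_fin_numE.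
apply: (@cvge_to_ge _ \oo _ _ (fun n => _ : \bar R) _ _ _ (nearW _ main)).
have -> : ((9 * c)%:E * K = 3%:E * (c%:E * (3%:E * (K + 0 + 0)) + 0 + 0))%E.
  by rewrite !adde0 -(fineK Kf) -!EFinM; congr (_%:E); ring.
have f3 (x : \bar R) : x \is a fin_num -> (3%:E * x)%E \is a fin_num by move=> ?; rewrite fin_numM.
have fK : (K + 0 + 0)%E \is a fin_num by rewrite !adde0.
apply: cvgeZl => //; apply: cvgeD; [by rewrite fin_num_adde_defl| |exact: uI'].
apply: cvgeD; [by rewrite fin_num_adde_defl| |exact: uI].
apply: cvgeZl => //; apply: cvgeZl => //; apply: cvgeD; [by rewrite fin_num_adde_defl| |exact: uf'].
by apply: cvgeD; [rewrite fin_num_adde_defl|exact: cvg_cst|exact: uf].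
Qed.
End ito_bound.

(** * Primitives of functions close to an affine one *)

Section affine_bounds.
Context {R : realType}.
Let mu := @lebesgue_measure R.
Implicit Types (f : R -> R) (a b D v e : R).

Lemma affine_integrable a b D v e : mu.-integrable `]a, b[ (fun t => (D * (t - v) + e)%:E).
Proof.
have : mu.-integrable `[a, b] (fun t => (D * (t - v) + e)%:E).
  apply: continuous_compact_integrable; first exact: segment_compact.
  apply: continuous_subspaceT => t; apply: cvgD; last exact: cvg_cst.
  by apply: cvgMr; apply: cvgB; [exact: cvg_id|exact: cvg_cst].
apply: (integrableS (mu := mu)); [exact: measurable_itv|exact: measurable_itv|exact: subset_itv_oo_cc].
Qed.

Lemma Rintegral_affine a b D v e : a <= b ->
  Rintegral mu `]a, b[ (fun t => D * (t - v) + e) = D / 2 * ((b - v) ^+ 2 - (a - v) ^+ 2) + e * (b - a).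
Proof.
rewrite le_eqVlt => /predU1P[->|ab].
  by rewrite set_itvoo0// Rintegral_set0; ring.
pose f t := D * (t - v) + e; pose F t := D / 2 * (t - v) ^+ 2 + e * t.
have dF t : is_derive t (1 : R) F (f t).
  rewrite /F /f; apply: is_derive_eq; rewrite /GRing.scale/=; by field.
have cF : continuous F by move=> x; apply: differentiable_continuous; apply/derivable1_diffP; case: (dF x).
rewrite /Rintegral; have -> : (\int[mu]_(x in `]a, b[) (D * (x - v) + e)%:E = (F b - F a)%:E)%E.
  have mf : measurable_fun `]a, b[ (EFin \o f).
    by case/integrableP: (affine_integrable a b D v e).
  transitivity (\int[mu]_(x in `[a, b]) (f x)%:E)%E.
    exact: esym (integral_itv_bndoo _ _ mf).
  rewrite (@continuous_FTC2 _ _ F) ?EFinB//.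
  - apply: continuous_subspaceT => t; apply: cvgD; last exact: cvg_cst.
    by apply: cvgMr; apply: cvgB; [exact: cvg_id|exact: cvg_cst].
  - split; first by move=> t _; case: (dF t).
      by apply: cvg_at_right_filter; exact: cF.
    by apply: cvg_at_left_filter; exact: cF.
  - by move=> t _; rewrite derive1E; case: (dF t).
by rewrite /= /F; ring.
Qed.

Lemma Rintegral_affine_le f a b D v e : a <= b -> mu.-integrable `]a, b[ (EFin \o f) ->
  (forall t, a < t < b -> D * (t - v) + e <= f t) ->
  D / 2 * ((b - v) ^+ 2 - (a - v) ^+ 2) + e * (b - a) <= Rintegral mu `]a, b[ f.
Proof.
move=> ab fi H; rewrite -Rintegral_affine//; apply: le_Rintegral => //.
exact: affine_integrable.
Qed.

Lemma Rintegral_affine_ge f a b D v e : a <= b -> mu.-integrable `]a, b[ (EFin \o f) ->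
  (forall t, a < t < b -> f t <= D * (t - v) + e) ->
  Rintegral mu `]a, b[ f <= D / 2 * ((b - v) ^+ 2 - (a - v) ^+ 2) + e * (b - a).
Proof.
move=> ab fi H; rewrite -Rintegral_affine//; apply: le_Rintegral => //.
exact: affine_integrable.
Qed.

End affine_bounds.

(** Integrates an affine bound on either side of v. The case D = 0 gives slopes of primitives; E =
    0, with r proportional to |t - v|, gives second-order expansions. Open intervals occur because f
    is controlled only inside (al, be), while t may be an endpoint. *)
Lemma primitive_expansion (R : realType) (al be D E v r rho : R) (F f : R -> R) :
  (forall a b, al <= a -> a <= b -> b <= be ->
     (@lebesgue_measure R).-integrable `]a, b[ (EFin \o f) /\
     F b - F a = Rintegral (@lebesgue_measure R) `]a, b[ f) ->
  al <= v <= be ->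
  (forall t, al < t < be -> `|t - v| < rho -> `|f t - (D * (t - v) + E)| <= r) ->
  forall t, al <= t <= be -> `|t - v| <= rho ->
    `|F t - F v - (D / 2 * (t - v) ^+ 2 + E * (t - v))| <= r * `|t - v|.
Proof.
move=> HF /andP[av vb] H t /andP[at_ tb] tr.
have [vt|tv] := leP v t.
  have [fi ->] := HF v t av vt tb.
  have Hs s : v < s < t -> D * (s - v) + (E - r) <= f s /\ f s <= D * (s - v) + (E + r).
    move=> /andP[vs st].
    have : `|f s - (D * (s - v) + E)| <= r.
      apply: H; first by rewrite (le_lt_trans av vs) (lt_le_trans st tb).
      by apply: lt_le_trans tr; rewrite !ger0_norm ?subr_ge0// ?ltrD2r// ltW.
    rewrite ler_distl => /andP[]; lra.
  have := Rintegral_affine_le vt fi (fun s vst => (Hs s vst).1).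
  have := Rintegral_affine_ge vt fi (fun s vst => (Hs s vst).2).
  rewrite subrr expr0n/= subr0 !(mulrDl _ _ (t - v)) (@ger0_norm _ (t - v)) ?subr_ge0// => h1 h2; rewrite ler_distl.
  by apply/andP; split; lra.
have [fi e] := HF t v at_ (ltW tv) vb.
have Hs s : t < s < v -> D * (s - v) + (E - r) <= f s /\ f s <= D * (s - v) + (E + r).
  move=> /andP[ts sv].
  have : `|f s - (D * (s - v) + E)| <= r.
    apply: H; first by rewrite (le_lt_trans at_ ts) (lt_le_trans sv vb).
    apply: lt_le_trans tr; rewrite !ltr0_norm ?subr_lt0//; lra.
  rewrite ler_distl => /andP[]; lra.
have := Rintegral_affine_le (ltW tv) fi (fun s tsv => (Hs s tsv).1).
have := Rintegral_affine_ge (ltW tv) fi (fun s tsv => (Hs s tsv).2).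
rewrite -e subrr expr0n/= sub0r !(mulrDl _ _ (v - t)) (@ltr0_norm _ (t - v)) ?subr_lt0// => h1 h2; rewrite ler_distl.
by apply/andP; split; lra.
Qed.

(** * Gaussian increments of the Wiener integral as the change point moves *)

Section change_point_integral.
Context {R : realType} {d : measure_display} {Omega : measurableType d}.
Variables (P : probability Omega R) (T al be c C : R) (h g : R -> R).
Variables (W : R -> Omega -> R) (J : R -> Omega -> R).
Hypotheses (al0 : 0 < al) (albe : al < be) (beT : be < T) (c0 : 0 < c).
Hypotheses (mh : measurable_fun `[0, T] h) (mg : measurable_fun `[0, T] g).
Let delta t := h t - g t.
Hypotheses (dC : forall t, 0 <= t <= T -> `|delta t| <= C)
  (dc : forall t, al < t < be -> c <= delta t)
  (dcont : forall t, al < t < be -> {for t, continuous delta}).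

(** For A < B, M(B, .) - M(A, .) equals h - g on [A, B) and vanishes elsewhere, so a difference of
    this function is the squared L2 norm of that change of trend: this is the variance clock of
    [J]. *)
Definition jump_energy (th : R) : R :=
  Rintegral (@lebesgue_measure R) `[al, th] (fun t => (h t - g t) ^+ 2).

Let mdelta : measurable_fun `[0, T] delta. Proof. exact: measurable_funB. Qed.

Let mT D : D `<=` `[0, T]%classic -> measurable D -> measurable_fun D delta.
Proof. by move=> DT mD; apply: measurable_funS mdelta. Qed.

Lemma jump_energy_integrable D : measurable D -> D `<=` `[0, T]%classic ->
  (@lebesgue_measure R).-integrable D (EFin \o (fun t => (h t - g t) ^+ 2)).
Proof.
move=> mD DT; suff i0 : (@lebesgue_measure R).-integrable `[0, T] (EFin \o (fun t => (h t - g t) ^+ 2)).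
  exact: (integrableS (mu := @lebesgue_measure R) (measurable_itv `[0, T]) mD DT i0).
apply/integrableP; split; first by apply/measurable_EFinP; exact: measurable_funX.
apply: (@le_lt_trans _ _ (\int[lebesgue_measure]_(t in `[0%R, T]) (cst (C ^+ 2)%:E t))%E).
  apply: ge0_le_integral => //=.
  - by apply/measurable_EFinP; apply: measurableT_comp => //; exact: measurable_funX.
  - move=> t; rewrite in_itv/= => tT; rewrite lee_fin normrX.
    have := dC tT; have := normr_ge0 (delta t) => z0 zC.
    by rewrite ler_sqr ?nnegrE ?(le_trans z0).
rewrite integral_cst//= lebesgue_measure_itv/=; case: ifP => _; rewrite ?mule0 ?ltry//.
Qed.

Lemma jump_energyB A B : al <= A -> A <= B -> B <= be ->
  ((jump_energy B - jump_energy A)%:E =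
   \int[lebesgue_measure]_(t in `[A, B]) ((h t - g t) ^+ 2)%:E)%E.
Proof.
move=> aA AB Bb.
have sub (a b : itv_bound R) : (BLeft al <= a)%O -> (b <= BRight be)%O ->
    [set` Interval a b] `<=` `[0, T]%classic.
  move=> aa bb; apply: (@subset_trans _ [set` Interval (BLeft al) (BRight be)]).
    by apply: subset_itv.
  by apply: subset_itv; rewrite bnd_simp; [exact: ltW|exact: ltW].
rewrite /jump_energy Rintegral_itvB ?bnd_simp//; last first.
  by apply: jump_energy_integrable => //; apply: sub; rewrite ?bnd_simp.
have i1 : (@lebesgue_measure R).-integrable `]A, B] (EFin \o (fun t => (h t - g t) ^+ 2)).
  by apply: jump_energy_integrable => //; apply: sub; rewrite ?bnd_simp.
rewrite Rintegral_itv_obnd_cbnd// /Rintegral fineK//.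
apply: integrable_fin_num => //.
by apply: jump_energy_integrable => //; apply: sub; rewrite ?bnd_simp.
Qed.

Lemma jump_energy_oo A B : al <= A -> A <= B -> B <= be ->
  (@lebesgue_measure R).-integrable `]A, B[ (EFin \o (fun t => (h t - g t) ^+ 2)) /\
  jump_energy B - jump_energy A = Rintegral (@lebesgue_measure R) `]A, B[ (fun t => (h t - g t) ^+ 2).
Proof.
move=> aA AB Bb.
have i : (@lebesgue_measure R).-integrable `]A, B[ (EFin \o (fun t => (h t - g t) ^+ 2)).
  apply: jump_energy_integrable => //.
  by apply: subset_itv; rewrite bnd_simp; [rewrite (le_trans _ aA)// ltW|rewrite (le_trans Bb)// ltW].
split => //; apply: EFin_inj; rewrite jump_energyB// /Rintegral.
rewrite fineK; last exact: integrable_fin_num.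
by apply: integral_itv_bndoo; case/integrableP: i.
Qed.

Lemma jump_energy_lb A B : al <= A -> A <= B -> B <= be ->
  c ^+ 2 * (B - A) <= jump_energy B - jump_energy A.
Proof.
move=> aA AB Bb; have [fi ->] := jump_energy_oo aA AB Bb.
have := @Rintegral_affine_le _ _ A B 0 0 (c ^+ 2) AB fi.
rewrite !mul0r add0r; apply => t /andP[At tB]; rewrite mul0r add0r.
have ct : c <= delta t by apply: dc; rewrite (le_lt_trans aA At) (lt_le_trans tB Bb).
by rewrite -/(delta t) ler_sqr ?nnegrE ?(le_trans (ltW c0) ct) ?(ltW c0).
Qed.

Lemma jump_energy_ub A B : al <= A -> A <= B -> B <= be ->
  jump_energy B - jump_energy A <= C ^+ 2 * (B - A).
Proof.
move=> aA AB Bb; have [fi ->] := jump_energy_oo aA AB Bb.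
have := @Rintegral_affine_ge _ _ A B 0 0 (C ^+ 2) AB fi.
rewrite !mul0r add0r; apply => t /andP[At tB]; rewrite mul0r add0r.
have tC : `|h t - g t| <= C.
  apply: dC; rewrite (ltW (lt_le_trans al0 (le_trans aA (ltW At))))/=.
  by rewrite ltW// (lt_trans (lt_le_trans tB Bb)).
by rewrite -[leLHS]real_normK ?num_real// ler_sqr ?nnegrE// (le_trans _ tC).
Qed.

Lemma jump_energy_slope v e : al < v < be -> 0 < e -> exists2 rho, 0 < rho &
  forall t, al <= t <= be -> `|t - v| <= rho ->
    `|jump_energy t - jump_energy v - (h v - g v) ^+ 2 * (t - v)| <= e * `|t - v|.
Proof.
move=> vI e0; have cd : {for v, continuous (fun t => (h t - g t) ^+ 2)}.
  by apply: (@continuous_comp _ _ _ (fun t => h t - g t) (fun z => z ^+ 2)); [exact: dcont|exact: sqr_continuous].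
have /cvgrPdist_le/(_ _ e0)[rho /= r0 rP] := cd.
exists rho => // t tI tr; have vI' : al <= v <= be by case/andP: vI => *; rewrite !ltW.
have := @primitive_expansion _ al be 0 ((h v - g v) ^+ 2) v e rho _ _ jump_energy_oo vI' _ t tI tr.
rewrite !mul0r add0r; apply => s sI sx; rewrite !mul0r add0r distrC; apply: rP.
by rewrite /= distrC.
Qed.

(** Midpoints of cells lie strictly between [al] and [be], where h - g is continuous and at least c.
    The weights are then positive, as [weighted_blocks] requires. *)
Definition midweight (A B : R) (N j : nat) : R :=
  h ((cell A B N j + cell A B N j.+1) / 2) - g ((cell A B N j + cell A B N j.+1) / 2).

Section block.
Variables (A B : R) (aA : al <= A) (AB : A < B) (Bb : B <= be).

Let r N := stepf (grid_steps A B N (midweight A B N)).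
Let dlt t := Mtrend h g B t - Mtrend h g A t.

Lemma mid_in N j : (j < N)%N -> al < (cell A B N j + cell A B N j.+1) / 2 < be.
Proof.
move=> jN; have N0 : (0 < N)%N by exact: leq_ltn_trans jN.
have /andP[c1 _] := cell_itv AB N0 (ltnW jN); have /andP[_ c2] := cell_itv AB N0 jN.
have := cell_lt AB N0 (ltnSn j); move: c1 c2.
move: (cell A B N j) (cell A B N j.+1) => x y c1 c2 /midf_lt[m1 m2].
by rewrite (le_lt_trans (le_trans aA c1) m1) (lt_le_trans m2 (le_trans c2 Bb)).
Qed.

Let dltE t : dlt t = if (A <= t) && (t < B) then delta t else 0.
Proof.
rewrite /dlt /Mtrend leNgt; have [tA|At] := ltP t A; last by case: ifP; rewrite ?subrr.
by rewrite (lt_trans tA AB) subrr.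
Qed.

(** The point A is left out because it may be [al], where h - g is not assumed continuous; at any
    other t in [A, B) the midpoint of the cell of t tends to t. *)
Let rcvg t : t != A -> r N.+1 t @[N --> \oo] --> dlt t.
Proof.
move=> tA; rewrite dltE; case: ifPn => [/andP[At tB]|]; last first.
  rewrite negb_and -ltNge -leNgt => /orP h'.
  under eq_fun do rewrite /r stepf_grid_out//; exact: cvg_cst.
have {}At : A < t by rewrite lt_neqAle eq_sym tA.
have abt : al < t < be by rewrite (le_lt_trans aA At) (lt_le_trans tB Bb).
apply/cvgrPdist_le => e e0.
have /cvgrPdist_le/(_ e e0) := dcont abt.
move=> -[z /= z0 zP].
have : (B - A) / N.+1%:R @[N --> \oo] --> 0.
  rewrite -[X in _ --> X](mulr0 (B - A)); apply: cvgMr.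
  exact: cvg_harmonic.
move=> /cvgrPdist_lt/(_ _ z0); apply: filterS => N.
rewrite sub0r normrN ger0_norm; last by rewrite divr_ge0// subr_ge0 ltW.
move=> Nz; have [j jN tj] := cell_ex AB (ltn0Sn N) (ltW At) tB.
rewrite /r (stepf_grid AB (ltn0Sn N) _ jN tj); apply: zP => /=.
move: tj => /andP[t1 t2]; have := cellS A B N.+1 j.
move: Nz; set y := (B - A) / _ => Nz cj; rewrite ltr_norml; apply/andP; split; lra.
Qed.

Let rC N t : (0 < N)%N -> `|r N t| <= C.
Proof.
have C0 : 0 <= C.
  by apply: le_trans (dC (t := be) _) => //; rewrite (ltW beT) andbT (le_trans (ltW al0))// (le_trans aA)// (le_trans (ltW AB)).
move=> N0; apply: stepf_grid_bound => // j jN; apply: dC.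
have /andP[m1 m2] := mid_in jN.
by rewrite (ltW (lt_trans al0 m1)) (ltW (lt_trans m2 beT)).
Qed.

Let dltC t : 0 <= t <= T -> `|dlt t| <= C.
Proof.
move=> tT; rewrite dltE; case: ifP => _; first exact: dC.
by rewrite normr0 (le_trans _ (dC tT)).
Qed.

Lemma measurable_Mtrend th : measurable_fun `[0, T] (Mtrend h g th).
Proof.
apply: measurable_fun_if => //.
- apply: (@measurable_fun_ltr _ _ _ `[0, T] id (cst th)) => //.
- by apply: measurable_funS mh.
- by apply: measurable_funS mg.
Qed.

Let mdlt : measurable_fun `[0, T] dlt.
Proof. by apply: measurable_funB; exact: measurable_Mtrend. Qed.

Let ae_rcvg (F : R -> R -> R) : (forall y, continuous (F ^~ y)) ->
  \forall t \ae (@lebesgue_measure R), `[0, T]%classic t ->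
    (F (r N.+1 t) (dlt t))%:E @[N --> \oo] --> (F (dlt t) (dlt t))%:E.
Proof.
move=> Fc; exists [set A]; split => //; first exact: lebesgue_measure_set1.
move=> t /= /not_implyP[_ ht]; apply: contrapT => /eqP tA; apply: ht.
apply: cvg_EFin; first exact: nearW.
apply: (@cvg_comp _ _ _ _ (F ^~ (dlt t))); first exact: rcvg.
exact: Fc.
Qed.

Let int_cst (k : R) : (@lebesgue_measure R).-integrable `[0, T] (fun=> k%:E).
Proof.
apply/integrableP; split; first exact: measurable_cst.
rewrite integral_cst//= lebesgue_measure_itv/=; case: ifP => _; rewrite ?mule0 ?ltry//.
Qed.

(** Dominated convergence: the sampled step functions converge off the null set {A}, and they and
    their limit are bounded by C. *)
Lemma block_L2 : (\int[lebesgue_measure]_(t in `[0%R, T]) ((r N.+1 t - dlt t) ^+ 2)%:E)%E @[N --> \oo] --> 0%E.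
Proof.
have cF y : continuous (fun x : R => (x - y) ^+ 2).
  by move=> x; apply: (@cvg_comp _ _ _ (fun x => x - y) (fun z => z ^+ 2)); [apply: cvgB; [exact: cvg_id|exact: cvg_cst]|exact: sqr_continuous].
have m1 N : measurable_fun `[0, T] (fun t => ((r N.+1 t - dlt t) ^+ 2)%:E).
  apply/measurable_EFinP; apply: measurable_funX; apply: measurable_funB; last exact: mdlt.
  by apply: measurable_funTS; exact: measurable_stepf.
have m2 : measurable_fun `[0, T] (fun t => ((dlt t - dlt t) ^+ 2)%:E).
  by apply/measurable_EFinP; apply: measurable_funX; apply: measurable_funB; exact: mdlt.
have bd : \forall t \ae (@lebesgue_measure R), forall N, `[0, T]%classic t ->
    (`|((r N.+1 t - dlt t) ^+ 2)%:E| <= ((C + C) ^+ 2)%:E)%E.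
  apply: aeW => t N tT; rewrite /= lee_fin normrX ler_sqr ?nnegrE ?addr_ge0//.
  + by rewrite (le_trans (ler_normB _ _))// lerD ?rC// dltC.
  + by rewrite (le_trans _ (dltC tT)).
  + by rewrite (le_trans _ (dltC tT)).
have [_ _] := dominated_convergence (mu := @lebesgue_measure R) (measurable_itv `[0, T]) m1 m2 (ae_rcvg cF) (int_cst _) bd.
rewrite [X in _ --> X -> _](_ : _ = 0%E)//.
by under eq_integral do rewrite subrr expr0n; rewrite integral0.
Qed.

Definition block_var N := \sum_(j < N) midweight A B N j ^+ 2 * (cell A B N j.+1 - cell A B N j).

Lemma block_varE N : (0 < N)%N ->
  (\int[lebesgue_measure]_(t in `[0%R, T]) ((r N t) ^+ 2)%:E = (block_var N)%:E)%E.
Proof.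
move=> N0; under eq_integral do rewrite /r (stepf_grid_sq AB N0).
rewrite integral_stepf_grid//; first exact: le_trans (ltW al0) aA.
exact: le_trans Bb (ltW beT).
Qed.

Lemma block_var_cvg : block_var N @[N --> \oo] --> jump_energy B - jump_energy A.
Proof.
rewrite -(cvg_shiftS block_var).
have cF (y : R) : continuous (fun x : R => x ^+ 2) by move=> x; exact: sqr_continuous.
have m1 N : measurable_fun `[0, T] (fun t => ((r N.+1 t) ^+ 2)%:E).
  apply/measurable_EFinP; apply: measurable_funX.
  by apply: measurable_funTS; exact: measurable_stepf.
have m2 : measurable_fun `[0, T] (fun t => (dlt t ^+ 2)%:E).
  by apply/measurable_EFinP; apply: measurable_funX; exact: mdlt.
have bd : \forall t \ae (@lebesgue_measure R), forall N, `[0, T]%classic t ->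
    (`|((r N.+1 t) ^+ 2)%:E| <= (C ^+ 2)%:E)%E.
  apply: aeW => t N tT; rewrite /= lee_fin normrX ler_sqr ?nnegrE ?rC//.
  by rewrite (le_trans _ (dltC tT)).
have [_ _] := dominated_convergence (mu := @lebesgue_measure R) (measurable_itv `[0, T]) m1 m2 (@ae_rcvg (fun x _ => x ^+ 2) cF) (int_cst _) bd.
have -> : (\int[lebesgue_measure]_(x in `[0%R, T]) (dlt x ^+ 2)%:E = (jump_energy B - jump_energy A)%:E)%E.
  rewrite jump_energyB ?(ltW AB)// -(@integral_itv_bndo_bndc _ (BLeft A) B (fun t => ((h t - g t) ^+ 2)%:E)); last first.
    apply/measurable_EFinP; apply: measurable_funX; apply: mT => //.
    by apply: subset_itv; rewrite bnd_simp; [exact: le_trans (ltW al0) aA|exact: le_trans Bb (ltW beT)].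
  rewrite -(_ : `[0, T] `&` `[A, B[ = `[A, B[%classic); last first.
    apply/seteqP; split => t /=; rewrite !in_itv/=; first by move=> [].
    move=> /andP[h1 h2]; rewrite h1 h2; split => //.
    by rewrite (le_trans (ltW al0))/= ?(le_trans aA)// (le_trans (ltW h2))// (le_trans Bb)// ltW.
  rewrite integral_mkcondr; apply: eq_integral => t _; rewrite patchE.
  rewrite dltE; case: ifPn => h'; first by rewrite mem_set//= in_itv.
  by rewrite memNset ?expr0n//= in_itv/=; exact/negP.
under eq_fun do rewrite block_varE//.
by move/fine_cvgP => [].
Qed.

End block.
Hypotheses (HW : is_wiener P `[0, T] W)
  (HJ : forall th, al <= th <= be -> is_wiener_integral P W T (Mtrend h g th) (J th)).

Lemma step_ok_grid A B N a : al <= A -> A < B -> B <= be -> step_ok T (grid_steps A B N a).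
Proof.
move=> aA AB Bb; apply/allP => z /mapP[j]; rewrite mem_iota => /= jN -> {z}/=.
have N0 : (0 < N)%N by exact: leq_ltn_trans jN.
have /andP[c1 _] := cell_itv AB N0 (ltnW jN); have /andP[_ c2] := cell_itv AB N0 jN.
rewrite (cell_le AB N0)// (le_trans _ c1) ?(le_trans _ aA) ?(ltW al0)//=.
by rewrite (le_trans c2)// (le_trans Bb)// ltW.
Qed.

(** Each increment of [J] is an L2 limit of step integrals over finer and finer subdivisions of its
    interval. [weighted_blocks] gives the joint law of these step integrals for all intervals at
    once, and [gauss_limit] passes to the limit. *)
Lemma gauss_incr_J : gauss_incr P `[al, be] jump_energy J.
Proof.
have T0 : 0 <= T.
  have := HW; move=> [+ _]; rewrite /= in_itv/= => /andP[_ +]; exact.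
have mJ th : al <= th <= be -> measurable_fun setT (J th) by move=> /HJ[].
split=> [t|n ts tsD tsS x]; first by rewrite /= in_itv/= => /mJ.
have tD i : (i <= n)%N -> al <= ts i <= be by move=> /tsD; rewrite /= in_itv.
have tl i : (i < n)%N -> al <= ts i by move=> iltn; have /andP[] := tD i (ltnW iltn).
have tr i : (i < n)%N -> ts i.+1 <= be by move=> iltn; have /andP[] := tD i.+1 iltn.
pose s N i := grid_steps (ts i) (ts i.+1) N (midweight (ts i) (ts i.+1) N).
have sok N i : (i < n)%N -> step_ok T (s N i).
  by move=> iltn; apply: step_ok_grid; [exact: tl|exact: tsS|exact: tr].
apply: (@gauss_limit _ _ _ P n (fun N i => stepW W (s N i))
  (fun i w => J (ts i.+1) w - J (ts i) w) (fun N i => block_var (ts i) (ts i.+1) N)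
  (fun i => jump_energy (ts i.+1) - jump_energy (ts i))).
- by move=> N i iltn; apply: (measurable_stepW T0 HW); exact: sok.
- by move=> i iltn; apply: measurable_funB; apply: mJ; apply: tD => //; exact: ltnW.
- move=> i iltn; apply: lt_le_trans (jump_energy_lb _ _ _); [|exact: tl|exact/ltW/tsS|exact: tr].
  by rewrite mulr_gt0 ?exprn_gt0// subr_gt0 tsS.
- by move=> i iltn; apply: block_var_cvg; [exact: tl|exact: tsS|exact: tr].
- move=> N y; set M := N.+1.
  (* The subdivisions are laid end to end: index i * M + j stands for cell j of block i, recovered
     by quotient and remainder. *)
  pose tt l := cell (ts (l %/ M)%N) (ts (l %/ M).+1) M (l %% M)%N.
  pose a l := midweight (ts (l %/ M)%N) (ts (l %/ M).+1) M (l %% M)%N.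
  have dE i j : (j < M)%N -> ((i * M + j) %/ M)%N = i by move=> jM; rewrite divnMDl// divn_small// addn0.
  have mE i j : (j < M)%N -> ((i * M + j) %% M)%N = j by move=> jM; rewrite modnMDl modn_small.
  have tE i j : (j < M)%N -> tt (i * M + j)%N = cell (ts i) (ts i.+1) M j.
    by move=> jM; rewrite /tt dE// mE.
  have aE i j : (j < M)%N -> a (i * M + j)%N = midweight (ts i) (ts i.+1) M j.
    by move=> jM; rewrite /a dE// mE.
  (* The right end of the last cell of block i is read off as the left end of block i + 1. *)
  have tSE i j : (j < M)%N -> tt (i * M + j).+1 = cell (ts i) (ts i.+1) M j.+1.
    move=> jM; have [jM'|] := ltnP j.+1 M; first by rewrite -addnS tE.
    move=> Mj; have -> : j = N by apply/eqP; rewrite eqn_leq -ltnS jM -ltnS.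
    by have -> : (i * M + N).+1 = (i.+1 * M + 0)%N; [rewrite addn0 mulSnr -addnS|rewrite tE// cell0 cellN].
  have lE l : l = ((l %/ M) * M + l %% M)%N := divn_eq l M.
  have lM l : (l %% M < M)%N by rewrite ltn_mod.
  have ln l : (l < n * M)%N -> (l %/ M < n)%N by rewrite ltn_divLR.
  have cin i j : (i < n)%N -> (j <= M)%N -> 0 <= cell (ts i) (ts i.+1) M j <= T.
    move=> iltn jM; have /andP[c1 c2] := cell_itv (tsS i iltn) (ltn0Sn N) jM.
    rewrite (le_trans _ c1) ?(le_trans _ (tl _ iltn)) ?(ltW al0)//=.
    by rewrite (le_trans c2)// (le_trans (tr _ iltn))// ltW.
  have GW := gauss_incr_wiener HW.
  have T0' : 0 < T by rewrite (lt_trans al0)// (lt_trans albe).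
  have mn l : (l < n * M)%N -> tt l < tt l.+1.
    move=> ll; rewrite [l in tt l]lE [l in tt l.+1]lE tE// tSE//; apply: cell_lt => //.
    by apply: tsS; exact: ln.
  have tT l : (l <= n * M)%N -> 0 <= tt l <= T.
    (* At l = n * M the quotient is n and [tt] mentions [ts n.+1], but cell 0 starts at [ts n]
       whatever its right end is. *)
    rewrite leq_eqVlt => /predU1P[->|ll]; last first.
      by rewrite [l in tt l]lE tE//; apply: cin; [exact: ln|exact: ltnW].
    rewrite -(addn0 (n * M)%N) tE// cell0; have := tD n (leqnn n) => /andP[t1 t2].
    by rewrite (le_trans (ltW al0))//= (le_trans t2)// ltW.
  have a0 l : (l < n * M)%N -> 0 < a l.
    move=> ll; rewrite (lt_le_trans c0)//; apply: dc; apply: mid_in => //.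
    - by apply: tl; exact: ln.
    - by apply: tsS; exact: ln.
    - by apply: tr; exact: ln.
  have := weighted_blocks T0' GW (ltn0Sn N) tT mn a0 y.
  rewrite -/M (_ : [set w | _] = [set w | forall i, (i < n)%N -> stepW W (s M i) w < y i]).
    move=> ->; congr (_%:E); apply: eq_bigr => i _; congr (Ncdf (_ / Num.sqrt _)).
    by apply: eq_bigr => j _; rewrite aE// tE// tSE.
  have SE i w : stepW W (s M i) w =
      \sum_(j < M) a (i * M + j)%N * (W (tt (i * M + j).+1) w - W (tt (i * M + j)%N) w).
    rewrite /stepW big_map (_ : iota 0 M = index_iota 0 M); last by rewrite /index_iota subn0.
    by rewrite big_mkord; apply: eq_bigr => j _; rewrite aE// tE// tSE.
  by apply/seteqP; split => w h' i iltn; have := h' i iltn; rewrite SE.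
move=> i iltn.
suff H : (\int[P]_w ((stepW W (s N.+1 i) w - (J (ts i.+1) w - J (ts i) w)) ^+ 2)%:E)%E @[N --> \oo] --> 0%E.
  by rewrite -(cvg_shiftS (fun N => (\int[P]_w ((stepW W (s N i) w - (J (ts i.+1) w - J (ts i) w)) ^+ 2)%:E)%E)); exact: H.
have L2 := block_L2 (tl i iltn) (tsS i iltn) (tr i iltn).
have c9 : 0 <= 9 * fine (normal_m2 R).
  by rewrite mulr_ge0//; apply: fine_ge0; apply: integral_ge0 => z _; rewrite lee_fin sqr_ge0.
apply: (@squeeze_cvge _ _ _ _ (fun=> 0%E) _ (fun N => (9 * fine (normal_m2 R))%:E *
  \int[lebesgue_measure]_(t in `[0%R, T]) ((stepf (s N.+1 i) t - (Mtrend h g (ts i.+1) t - Mtrend h g (ts i) t)) ^+ 2)%:E)%E).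
- have /fine_cvgP[ffin _] := L2; near=> N.
  rewrite integral_ge0/=; last by move=> w _; rewrite lee_fin sqr_ge0.
  apply: (@ito_bound _ _ _ P T W T0 HW (Mtrend h g (ts i)) (Mtrend h g (ts i.+1))).
  + exact: measurable_Mtrend.
  + exact: measurable_Mtrend.
  + by apply: HJ; apply: tD; exact: ltnW.
  + by apply: HJ; exact: tD.
  + exact: sok.
  + by rewrite ltey_eq; apply/orP; left; near: N.
- exact: cvg_cst.
- rewrite -[X in _ --> X](mule0 (9 * fine (normal_m2 R))%:E).
  by apply: cvgeZl.
Unshelve. all: by end_near. Qed.

End change_point_integral.

(** * Chaining and peeling *)

(** Chaining: the allowances lam / 5 * (4 / 5)^n add up to lam. A dyadic point of level n + 1 is of
    level n or one step to the right of such a point, so the partial sums lam (1 - (4 / 5)^(n + 1))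
    propagate; continuity then reaches every t. *)
Lemma dyadic_sup (R : realType) (X : R -> R) (L lam : R) : 0 < L -> 0 <= lam ->
  {within `[0, L], continuous X} ->
  (forall n k, (k < 2 ^ n)%N ->
     `|X (L * (k.+1%:R / 2 ^+ n)) - X (L * (k%:R / 2 ^+ n))| <= lam / 5 * (4 / 5) ^+ n) ->
  forall t, 0 <= t <= L -> `|X t - X 0| <= lam.
Proof.
move=> L0 lam0 cX H.
have Hn n : forall k, (k <= 2 ^ n)%N -> `|X (L * (k%:R / 2 ^+ n)) - X 0| <= lam * (1 - (4 / 5) ^+ n.+1).
  elim: n => [|n IH] k.
    have H0 := H 0%N 0%N isT; rewrite !expr0 !divr1 mulr0 in H0.
    rewrite expr0 divr1 expr1 expn0; case: k => [|[|//]] _.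
      by rewrite mulr0 subrr normr0 mulr_ge0//; lra.
    by apply: (le_trans H0); lra.
  have pw : 0 <= (4 / 5 : R) ^+ n.+1 by rewrite exprn_ge0.
  have two0 : (2 : R) ^+ n != 0 by rewrite expf_neq0.
  have half m : L * ((m.*2)%:R / 2 ^+ n.+1) = L * (m%:R / 2 ^+ n).
    by rewrite exprS -mul2n natrM; field.
  have IH' m : (m <= 2 ^ n)%N -> `|X (L * ((m.*2)%:R / 2 ^+ n.+1)) - X 0| <= lam * (1 - (4 / 5) ^+ n.+1).
    by move=> mn; rewrite half; exact: IH.
  have step : lam * (1 - (4 / 5) ^+ n.+1) + lam / 5 * (4 / 5) ^+ n.+1 <= lam * (1 - (4 / 5) ^+ n.+2).
    by apply: le_of_eq; rewrite (exprS _ n.+1); field.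
  have pos : 0 <= lam / 5 * (4 / 5) ^+ n.+1 by rewrite mulr_ge0// divr_ge0.
  rewrite -{1 2}(odd_double_half k); case: (odd k) => /=; rewrite ?add0n ?add1n expnS mul2n => kn.
    have kn' : (k./2 < 2 ^ n)%N by rewrite -ltn_double.
    rewrite -[X in `|X|](subrKA (X (L * ((k./2).*2%:R / 2 ^+ n.+1)))).
    apply: (le_trans (ler_normD _ _)); apply: le_trans step; rewrite addrC; apply: lerD.
      exact: IH' (ltnW kn').
    by apply: H; rewrite expnS mul2n ltn_double.
  apply: (le_trans (IH' _ _)); first by rewrite -leq_double.
  by apply: le_trans step; rewrite lerDl.
have Hn' n k : (k <= 2 ^ n)%N -> `|X (L * (k%:R / 2 ^+ n)) - X 0| <= lam.
  move=> /Hn/le_trans; apply; rewrite ler_piMr// gerBl exprn_ge0//.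
move=> t /andP[t0 tL].
pose k n := Num.truncn (t / L * 2 ^+ n).
pose u n : R := L * ((k n)%:R / 2 ^+ n).
have two0 n : 0 < (2 : R) ^+ n by rewrite exprn_gt0.
have z0 n : 0 <= t / L * 2 ^+ n by rewrite mulr_ge0 ?divr_ge0 ?(ltW L0) ?(ltW (two0 n)).
have kn n : (k n <= 2 ^ n)%N.
  rewrite -(ler_nat R); have /andP[h _] := truncn_itv (z0 n); apply: (le_trans h).
  by rewrite natrX ler_piMl ?(ltW (two0 n))// ler_pdivrMr// mul1r.
have ut n : u n <= t <= u n + L * 2 ^- n.
  have /andP[h1 h2] := truncn_itv (z0 n); rewrite -/(k n) in h1 h2; rewrite /u.
  have lp : 0 < L / 2 ^+ n by rewrite divr_gt0.
  have te : t / L * 2 ^+ n * (L / 2 ^+ n) = t by field; rewrite !gt_eqF.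
  have ke : L * ((k n)%:R / 2 ^+ n) = (k n)%:R * (L / 2 ^+ n) by ring.
  rewrite ke -{1}[in X in _ <= X]te -[in X in _ && X]te; apply/andP; split.
    by rewrite ler_pM2r.
  by rewrite -[X in _ + X]mul1r -mulrDl ler_pM2r// natr1 ltW.
have ucvg : u n @[n --> \oo] --> t.
  apply: (@squeeze_cvgr _ _ _ _ (fun n => t - L * 2 ^- n) (fun=> t)).
  - by near=> n; have /andP[a b] := ut n; rewrite lerBlDr b a.
  - rewrite -[X in _ --> X]subr0; apply: cvgB; first exact: cvg_cst.
    rewrite -[X in _ --> X](mulr0 L); apply: cvgMr.
    rewrite (_ : (fun n => 2 ^- n) = (fun n => 2^-1 ^+ n)); last by apply/funext => n; rewrite exprVn.
    by apply: cvg_expr; rewrite ger0_norm// invf_lt1// ltr1n.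
  - exact: cvg_cst.
have Xu : X (u n) @[n --> \oo] --> X t.
  move: cX => /subspace_continuousP/(_ t); rewrite /= in_itv/= t0 tL => /(_ isT) cXt.
  apply: (cvg_trans _ cXt) => A; rewrite /fmap/= /nbhs/= => -[e /= e0 eA].
  have := ucvg; move/cvgrPdist_lt/(_ _ e0); apply: filterS => n un.
  apply: eA => //=; rewrite in_itv/=; have /andP[h _] := ut n.
  by rewrite (le_trans h tL) /u mulr_ge0// ?(ltW L0)// divr_ge0// ltW.
have Xu' : `|X (u n) - X 0| @[n --> \oo] --> `|X t - X 0|.
  by apply: cvg_norm; apply: cvgB => //; exact: cvg_cst.
by apply: (cvgr_to_le Xu'); near=> n; apply: Hn'.
Unshelve. all: by end_near. Qed.

Section union_bound.
Context {R : realType} {d : measure_display} {Omega : measurableType d}.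
Variable P : probability Omega R.

Lemma probability_cup_le (F : nat -> set Omega) (A : set Omega) (u : nat -> R) (M : R) :
  (forall n, measurable (F n)) -> measurable A -> A `<=` \bigcup_n F n ->
  (forall n, (P (F n) <= (u n)%:E)%E) -> (forall N, \sum_(i < N) u i <= M) ->
  (P A <= M%:E)%E.
Proof.
move=> mF mA AF Fu uM.
apply: (le_trans (measure_sigma_subadditive P mF mA AF)).
apply: lime_le; first by apply: is_cvg_nneseries => n _ _; exact: measure_ge0.
near=> N; rewrite big_mkord; apply: (@le_trans _ _ (\sum_(i < N) (u i)%:E)%E).
  by apply: lee_sum => i _; exact: Fu.
by rewrite sumEFin lee_fin.
Unshelve. all: by end_near. Qed.

Lemma geometric_le (x : R) (n : nat) : 0 <= x -> x < 1 -> \sum_(i < n) x ^+ i <= (1 - x)^-1.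
Proof.
move=> x0 x1; have d0 : 0 < 1 - x by rewrite subr_gt0.
rewrite -(ler_pM2l d0) divff ?gt_eqF//.
rewrite -[X in X * _]opprB mulNr -subrX1 opprB gerBl exprn_ge0//.
Qed.

(** The tail that Markov's inequality yields from a moment of order 2m growing like (t - s)^m, as
    for Brownian motion. *)
Definition poly_tail (X : R -> Omega -> R) (L K : R) (m : nat) : Prop :=
  (forall t, 0 <= t <= L -> measurable_fun setT (X t)) /\
  forall s t y, 0 <= s -> s < t -> t <= L -> 0 < y ->
    (P [set w | (y <= `|X t w - X s w|)%R] <= (K * ((t - s) / y ^+ 2) ^+ m)%:E)%E.

(** A union bound over the 2^n dyadic increments of each level, against the thresholds of
    [dyadic_sup]. The event [A] is any measurable event on which a large excursion occurs, so that
    the supremum never has to be treated as a random variable. *)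
Lemma maximal_tail (X : R -> Omega -> R) (L K lam : R) (m : nat) (A : set Omega) :
  0 < L -> 0 <= K -> 0 < lam -> (4 <= m)%N ->
  (forall w, {within `[0, L], continuous (X ^~ w)}) -> poly_tail X L K m ->
  measurable A -> (forall w, A w -> exists2 t, 0 <= t <= L & lam < `|X t w - X 0 w|) ->
  (P A <= (4 * K * (25 * L / lam ^+ 2) ^+ m)%:E)%E.
Proof.
move=> L0 K0 lam0 m4 cX [mX tX] mA HA.
pose y n : R := lam / 5 * (4 / 5) ^+ n.
have y0 n : 0 < y n by rewrite mulr_gt0 ?divr_gt0 ?exprn_gt0.
pose D n k := [set w | y n <= `|X (L * (k.+1%:R / 2 ^+ n)) w - X (L * (k%:R / 2 ^+ n)) w|].
pose F n := \big[setU/set0]_(k < 2 ^ n) D n k.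
have two0 n : 0 < (2 : R) ^+ n by rewrite exprn_gt0.
have pt n k : (k <= 2 ^ n)%N -> 0 <= L * (k%:R / 2 ^+ n) <= L.
  move=> kn; rewrite mulr_ge0 ?(ltW L0) ?divr_ge0 ?(ltW (two0 n))//=.
  by rewrite ler_piMr ?(ltW L0)// ler_pdivrMr// mul1r -natrX ler_nat.
have mD n k : (k < 2 ^ n)%N -> measurable (D n k).
  move=> kn; apply: measurable_norm_ge; apply: measurable_funB; apply: mX; apply: pt => //.
  exact: ltnW.
have PD n k : (k < 2 ^ n)%N -> (P (D n k) <= (K * (25 * L / lam ^+ 2 * (25 / 32) ^+ n) ^+ m)%:E)%E.
  move=> kn; have /andP[a1 a2] := pt n k (ltnW kn); have /andP[b1 b2] := pt n k.+1 kn.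
  have dd : L * (k.+1%:R / 2 ^+ n) - L * (k%:R / 2 ^+ n) = L / 2 ^+ n.
    by rewrite -mulrBr -mulrBl -natr1 addrAC subrr add0r mul1r.
  apply: le_trans (tX _ _ _ a1 _ b2 (y0 n)) _.
    by rewrite -subr_gt0 dd divr_gt0.
  rewrite dd; apply: le_of_eq; congr (K * _ ^+ m)%:E.
  rewrite /y.
  have -> : (25 / 32 : R) ^+ n = ((4 / 5) ^+ n) ^- 2 / 2 ^+ n.
    by rewrite -exprM mulnC exprM -!exprVn -exprMn; congr (_ ^+ n); field.
  have q0 : (4 / 5 : R) ^+ n != 0 by rewrite expf_neq0.
  have p0 := two0 n; move: ((4 / 5) ^+ n) (2 ^+ n) q0 p0 => q p q0 p0.
  by field; rewrite q0 !gt_eqF.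
apply: (@probability_cup_le F A (fun n => K * (25 * L / lam ^+ 2) ^+ m * (3 / 4) ^+ n)).
- by move=> n; apply: bigsetU_measurable => k _; exact: mD.
- exact: mA.
- move=> w Aw; apply: contrapT => nF.
  have [t tL] := HA w Aw; apply/negP; rewrite -leNgt.
  apply: (@dyadic_sup _ (X ^~ w) L lam) => //; first exact: ltW.
  move=> n k kn; rewrite leNgt; apply/negP => h; apply: nF; exists n => //.
  by rewrite /F -bigcup_mkord; exists k => //; exact: ltW.
- move=> n; apply: (@le_trans _ _ (\sum_(k < 2 ^ n) P (D n k))%E).
    by rewrite /F; apply: (Boole_inequality P (A := D n)) => k; exact: mD.
  apply: (@le_trans _ _ (\sum_(k < 2 ^ n) (K * (25 * L / lam ^+ 2 * (25 / 32) ^+ n) ^+ m)%:E)%E).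
    by apply: lee_sum => k _; exact: PD.
  (* Level n contributes at most K c1^m (2 (25/32)^m)^n, where 25/32 is the ratio 1/2 of interval
     lengths over the ratio 16/25 of squared thresholds. *)
  rewrite sumEFin sumr_const card_ord lee_fin -(mulr_natl (K * _) (2 ^ n)) natrX.
  set c1 := 25 * L / lam ^+ 2.
  have -> : 2 ^+ n * (K * (c1 * (25 / 32) ^+ n) ^+ m) = K * c1 ^+ m * (2 ^+ n * ((25 / 32) ^+ n) ^+ m).
    by rewrite exprMn; ring.
  apply: ler_wpM2l.
    by rewrite mulr_ge0// exprn_ge0// divr_ge0 ?sqr_ge0// mulr_ge0// ltW.
  rewrite -exprM mulnC exprM -exprMn lerXn2r ?nnegrE ?mulr_ge0 ?exprn_ge0//.
  (* Here m >= 4 enters: 2 (25/32)^4 <= 3/4, and the geometric series of ratio 3/4 gives the factor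
     4. *)
  apply: (@le_trans _ _ (2 * (25 / 32) ^+ 4)); last by rewrite !exprS expr0; lra.
  by rewrite ler_wpM2l// ler_wiXn2l//; lra.
- move=> N; rewrite -mulr_sumr.
  have : \sum_(i < N) (3 / 4 : R) ^+ i <= 4.
    have e4 : (1 - 3 / 4 : R)^-1 = 4 by field.
    by apply: le_trans (geometric_le _ _ _) _; rewrite ?e4; lra.
  have c0 : 0 <= K * (25 * L / lam ^+ 2) ^+ m.
    by rewrite mulr_ge0// exprn_ge0// divr_ge0 ?sqr_ge0// mulr_ge0// ltW.
  by move=> /(ler_wpM2l c0)/le_trans; apply; rewrite mulrC mulrA.
Qed.

(** If S lies in [2^j a, 2^(j+1) a), then X must rise by kap (2^j a)^2 / eps within that distance,
    an event controlled by [maximal_tail]. The constant is 25 * 2 * 4 = 200: chaining, the right end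
    of the shell, and the halved level squared. Successive shells gain a factor 8^(-m). *)
Lemma peeling (X : R -> Omega -> R) (L K kap eps : R) (m : nat) (S : Omega -> R) :
  0 < L -> 0 <= K -> 0 < kap -> 0 < eps -> (4 <= m)%N ->
  (forall w, {within `[0, L], continuous (X ^~ w)}) -> poly_tail X L K m ->
  measurable_fun setT S -> (forall w, S w <= L) ->
  (forall w, 0 < S w -> kap * S w ^+ 2 <= eps * (X (S w) w - X 0 w)) ->
  forall a, 0 < a -> (P [set w | (a <= S w)%R] <=
    (8 * K * (200 / kap ^+ 2 * (eps ^+ 2 / a ^+ 3)) ^+ m)%:E)%E.
Proof.
move=> L0 K0 kap0 eps0 m4 cX [mX tX] mS SL HS a a0.
have two0 n : 0 < (2 : R) ^+ n by rewrite exprn_gt0.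
have mI (I : interval R) : measurable [set w | S w \in I].
  by rewrite -[Y in measurable Y]setTI; exact: (mS measurableT [set` I] (measurable_itv I)).
pose F j := [set w | S w \in `[2 ^+ j * a, 2 ^+ j.+1 * a[].
have q0 : 0 <= 200 / kap ^+ 2 * (eps ^+ 2 / a ^+ 3).
  by apply: mulr_ge0; apply: divr_ge0; rewrite ?exprn_ge0 ?(ltW eps0) ?(ltW a0) ?(ltW kap0).
(* Half of the forced rise, since [maximal_tail] asks for a strict inequality. *)
pose lam j : R := kap * (2 ^+ j * a) ^+ 2 / eps / 2.
have lam0 j : 0 < lam j by rewrite !divr_gt0// mulr_gt0// exprn_gt0// mulr_gt0.
apply: (@probability_cup_le F _ (fun j => 4 * K * (200 / kap ^+ 2 * (eps ^+ 2 / a ^+ 3)) ^+ m * 8^-1 ^+ j)).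
- by move=> j; exact: mI.
- rewrite (_ : mkset _ = [set w | S w \in `[a, +oo[]); first exact: mI.
  by apply/seteqP; split => w /=; rewrite in_itv/= andbT.
- move=> w /= aS.
  have [j jS] : exists j, S w < 2 ^+ j * a.
    exists (Num.truncn (S w / a)).+1.
    rewrite -ltr_pdivrMr//; apply: (@lt_trans _ _ (Num.truncn (S w / a)).+1%:R); first exact: truncnS_gt.
    by rewrite -natrX ltr_nat ltn_expl.
  elim: j jS => [|j IH] jS; first by rewrite expr0 mul1r ltNge aS in jS.
  have [/IH//|h] := ltP (S w) (2 ^+ j * a).
  by exists j => //; rewrite /F/= in_itv/= h jS.
(* The shell is cut at L, beyond which the process is not controlled. *)
- move=> j; pose Lj := Num.min (2 ^+ j.+1 * a) L.
  have Lj0 : 0 < Lj by rewrite lt_min L0 mulr_gt0.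
  have LjL : Lj <= L by rewrite ge_min lexx orbT.
  have Lja : Lj <= 2 ^+ j.+1 * a by rewrite ge_min lexx.
  apply: le_trans (@maximal_tail X Lj K (lam j) m (F j) Lj0 K0 (lam0 j) m4 _ _ (mI _) _) _.
  + move=> w; apply: continuous_subspaceW (cX w) => t /=; rewrite !in_itv/= => /andP[-> h].
    exact: le_trans h LjL.
  + split => [t /andP[h1 h2]|s t y s0 st tL y0]; first by apply: mX; rewrite h1 (le_trans h2).
    by apply: tX => //; exact: le_trans tL LjL.
  + move=> w; rewrite /F/= in_itv/= => /andP[h1 h2].
    have S0 : 0 < S w by apply: lt_le_trans h1; rewrite mulr_gt0.
    exists (S w); first by rewrite (ltW S0)/= le_min (ltW h2) SL.
    apply: lt_le_trans (ler_norm _).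
    have : kap * S w ^+ 2 / eps <= X (S w) w - X 0 w by rewrite ler_pdivrMr// (mulrC _ eps) HS.
    apply: lt_le_trans; rewrite /lam ltr_pdivrMr//.
    have h3 : kap * (2 ^+ j * a) ^+ 2 / eps <= kap * S w ^+ 2 / eps.
      rewrite ler_pM2r ?invr_gt0// ler_pM2l// ler_sqr ?nnegrE ?(ltW S0)//.
      by rewrite mulr_ge0// ltW.
    have : 0 < kap * S w ^+ 2 / eps by rewrite divr_gt0// mulr_gt0// exprn_gt0.
    lra.
  rewrite lee_fin -[leRHS]mulrA; apply: ler_wpM2l; first by rewrite mulr_ge0.
  apply: (@le_trans _ _ ((200 / kap ^+ 2 * (eps ^+ 2 / a ^+ 3) * 8^-1 ^+ j) ^+ m)).
    rewrite lerXn2r ?nnegrE//.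
    * by rewrite divr_ge0 ?sqr_ge0// mulr_ge0// ltW.
    * by apply: mulr_ge0 => //; rewrite exprn_ge0.
    apply: (@le_trans _ _ (25 * (2 ^+ j.+1 * a) / lam j ^+ 2)).
      by rewrite ler_pM2r ?invr_gt0 ?exprn_gt0// ler_pM2l.
    apply: le_of_eq; rewrite /lam.
    have -> : (8^-1 : R) ^+ j = (2 ^+ j) ^- 3.
      by rewrite -exprM mulnC exprM -exprVn; congr (_ ^+ j); rewrite -exprVn; field.
    rewrite exprS; have p0 := two0 j; move: (2 ^+ j) p0 => p p0.
    by field; rewrite !gt_eqF.
  rewrite exprMn; apply: ler_wpM2l.
    exact: exprn_ge0.
  rewrite -exprM mulnC exprM; apply: lerXn2r; rewrite ?nnegrE ?exprn_ge0//.
  by rewrite -[leRHS]expr1 ler_wiXn2l//; [lra|exact: leq_trans m4].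
- move=> N; rewrite -mulr_sumr.
  have : \sum_(i < N) (8^-1 : R) ^+ i <= 2.
    have e8 : (1 - 8^-1 : R)^-1 = 8 / 7 by field.
    by apply: le_trans (geometric_le _ _ _) _; rewrite ?e8; lra.
  have c0 : 0 <= 4 * K * (200 / kap ^+ 2 * (eps ^+ 2 / a ^+ 3)) ^+ m.
    by apply: mulr_ge0; [apply: mulr_ge0|exact: exprn_ge0].
  move=> /(ler_wpM2l c0)/le_trans; apply; apply: le_of_eq; ring.
Qed.

End union_bound.

(** * Transfer of the argmax to the limit process *)

Section dense_times.
Context {R : realType}.

(** A dense sequence in [-K, K]; clamping keeps every term inside without reindexing the
    rationals. *)
Definition times (K : R) (i : nat) : R :=
  Num.max (- K) (Num.min (ratr (odflt 0%R (unpickle i : option rat))) K).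

Lemma times_itv K i : 0 <= K -> - K <= times K i <= K.
Proof.
move=> K0; have KK : - K <= K by rewrite (le_trans _ K0)// oppr_le0.
by rewrite /times le_max lexx/= ge_max KK ge_min lexx orbT.
Qed.

Lemma times_dense K u e : - K <= u <= K -> 0 < e -> exists i, `|times K i - u| < e.
Proof.
move=> /andP[Ku uK] e0.
have [q] : exists q : rat, ratr q \in `]u - e, u + e[.
  by apply: rat_in_itvoo; rewrite ltrD2l gtrN.
rewrite in_itv/= => /andP[h1 h2]; exists (pickle q); rewrite /times pickleK/=.
rewrite ltr_distl; apply/andP; split.
  by rewrite lt_max lt_min h1 (lt_le_trans _ uK) ?orbT// gtrBl.
rewrite gt_max gt_min h2/= andbT; apply: (le_lt_trans Ku); by rewrite ltrDl.
Qed.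

End dense_times.

(** Only x is confined to [a, b]: y may leave it, as the times [A n p] may leave [-K, K] in
    [limsup_tilted]. *)
Lemma uniform_modulus (R : realType) (f : R -> R) (a b r : R) : continuous f -> 0 < r ->
  exists2 e, 0 < e & forall x y, a <= x <= b -> `|y - x| <= e -> `|f y - f x| <= r.
Proof.
move=> cf r0.
have /compact_near_coveringP/(_ R (0^'+) (fun e x => forall y, `|y - x| <= e -> `|f y - f x| <= r)) :=
  @segment_compact R a b.
have r20 : 0 < r / 2 by rewrite divr_gt0.
case.
  move=> x0 _; have /cvgrPdist_le/(_ _ r20)[q /= q0 qP] := cf x0.
  exists ((ball x0 (q / 2)), [set e | e < q / 2]).
    split; first by apply: nbhsx_ballx; rewrite divr_gt0.
    by apply: nbhs_right_lt; rewrite divr_gt0.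
  move=> [x e] /= [xx0 eq] y yx.
  have h1 : `|f x0 - f x| <= r / 2 by apply: qP; apply: lt_trans xx0 _; lra.
  have h2 : `|f x0 - f y| <= r / 2.
    apply: qP => /=; rewrite distrC -(subrKA x).
    apply: (le_lt_trans (ler_normD _ _)); rewrite (distrC x); rewrite /ball/= in xx0; lra.
  rewrite -(subrKA (f x0)); apply: (le_trans (ler_normD _ _)); rewrite (distrC (f y)); lra.
move=> e0 /= e00 eP; exists (e0 / 2); first by rewrite divr_gt0.
move=> x y xab yx; apply: (eP (e0 / 2)) => //=.
- by rewrite sub0r normrN gtr0_norm ?divr_gt0//; lra.
- by rewrite divr_gt0.
Qed.

Section argmax.
Context {R : realType} {d d' : measure_display}
  {Omega : measurableType d} {Omega' : measurableType d'}.
Variables (P : probability Omega R) (P' : probability Omega' R).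
Variables (dl gm K s x sg : R) (W : R -> Omega' -> R) (uhat : Omega' -> R).
Hypotheses (dl0 : 0 < dl) (gm0 : 0 < gm) (K0 : 0 < K) (s0 : 0 < s) (sg2 : sg ^+ 2 = 1).
Hypotheses (HW : is_wiener P' setT W) (muhat : measurable_fun setT uhat)
  (uhatP : {ae P', forall w, forall u : R,
     dl * W u w - gm / 2 * u ^+ 2 <= dl * W (uhat w) w - gm / 2 * uhat w ^+ 2}).

Let t := times K.
Let tK i : - K <= t i <= K. Proof. by apply: times_itv; exact: ltW. Qed.

Let nsg : `|sg| = 1.
Proof. by apply/eqP; rewrite -(@eqrXn2 _ 2)// expr1n -normrX sg2 normr1. Qed.

Let mW u : measurable_fun setT (W u). Proof. by case: HW => _ [+ _]; apply. Qed.

Let ctW : {ae P', forall w, W 0 w = 0 /\ continuous (W ^~ w)}.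
Proof.
case: HW => _ [_ [+ _]]; apply: filterS => w [-> cw]; split => //.
by move=> u; move: cw; rewrite continuous_open_subspace; [apply; rewrite inE|exact: openT].
Qed.

Lemma measurable_path_le (a b c e : R) i j :
  measurable [set f : path_space R | a * f j + b + c <= e * f i].
Proof.
rewrite -[Y in measurable Y]setTI.
rewrite (_ : [set f | _] = (fun f : path_space R => a * f j + b + c <= e * f i) @^-1` [set true]).
  apply: measurable_fun_ler => //; last by apply: measurable_funM => //; exact: measurable_coord.
  by apply: measurable_funD => //; apply: measurable_funD => //; apply: measurable_funM => //; exact: measurable_coord.
by apply/seteqP; split => f /=.
Qed.

(** Encloses the event that the maximiser u satisfies x <= sg * u, using values at the times [t]
    only. A maximum over countably many times need not be attained, and u need not be one of them:
    hence the slack 1 / (k + 1) and the half-line enlarged by s. The signs sg = 1 and sg = -1 cover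
    both tails. *)
Definition almost_max (Q : R -> R) : set (path_space R) :=
  [set f | forall k : nat, exists i, x - s <= sg * t i /\
     forall j, dl * f j + (Q (t i) - Q (t j)) + - k.+1%:R^-1 <= dl * f i].

Lemma measurable_almost_max Q : measurable (almost_max Q).
Proof.
rewrite (_ : almost_max Q = \bigcap_k \bigcup_(i in [set i | x - s <= sg * t i]) \bigcap_j
   [set f : path_space R | dl * f j + (Q (t i) - Q (t j)) + - k.+1%:R^-1 <= dl * f i]).
  apply: bigcapT_measurable => k; apply: bigcup_measurable => i _.
  by apply: bigcapT_measurable => j; exact: measurable_path_le.
apply/seteqP; split => f /= h k.
  by move=> _; have [i [xi hi]] := h k; exists i => // j _; exact: hi.
by have [i xi hi] := h k I; exists i; split => // j; exact: hi.
Qed.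

(* Tilting the limit process by lam * u makes the maximum on the half-line strict,
   and the tilted process is a translate of the original one. *)
Definition tilted_max (c : R) : set (path_space R) :=
  [set f | exists i, forall j, sg * t j <= x - 2 * s ->
     dl * f j + (gm / 2 * (t i - c) ^+ 2 - gm / 2 * (t j - c) ^+ 2) + gm * s * s / 2 <= dl * f i].

Lemma measurable_tilted_max c : measurable (tilted_max c).
Proof.
rewrite (_ : tilted_max c = \bigcup_i \bigcap_(j in [set j | sg * t j <= x - 2 * s])
   [set f : path_space R | dl * f j + (gm / 2 * (t i - c) ^+ 2 - gm / 2 * (t j - c) ^+ 2) + gm * s * s / 2 <= dl * f i]).
  apply: bigcupT_measurable => i; have [h|h] := pselect ([set j | sg * t j <= x - 2 * s] !=set0).
    by apply: bigcap_measurable => // j _; exact: measurable_path_le.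
  rewrite (_ : \bigcap_(j in _) _ = setT); first exact: measurableT.
  by apply/seteqP; split => // f _ j hj; exfalso; apply: h; exists j.
by apply/seteqP; split => f /= [i h]; exists i => // j hj; apply: h.
Qed.

Variables (X : nat -> R -> Omega -> R) (u : nat -> Omega -> R) (A Q : nat -> R -> R).

(** What the rescaled model satisfies for large n, once [-K, K] fits into the rescaled parameter
    interval. *)
Definition admissible (n : nat) : Prop :=
  [/\ gauss_incr P `[- K, K] (A n) (X n),
      {in `[- K, K] &, {homo A n : p q / p < q}},
      forall w, {within `[- K, K], continuous (X n ^~ w)},
      {within `[- K, K], continuous (Q n)} &
      measurable_fun setT (u n) /\
      forall w, `|u n w| <= K -> forall p, - K <= p <= K ->
        dl * X n p w - Q n p <= dl * X n (u n w) w - Q n (u n w)].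

(** By [gauss_incr_eqlaw] the noise X n and the time-changed process W (A n .) give the same law to
    differences from time 0, and subtracting the value at 0 does not affect comparisons between
    times. *)
Lemma argmax_transfer n : admissible n ->
  (P [set w | (x <= sg * u n w)%R /\ (`|u n w| <= K)%R] <=
   P' [set w | almost_max (Q n) (fun i => W (A n (t i)) w - W (A n 0) w)%R])%E.
Proof.
move=> [GX Ai cX cQ [mu max_u]].
have D0 : `[- K, K]%classic (0 : R) by rewrite /= in_itv/= oppr_le0 (ltW K0).
have Dt i : `[- K, K]%classic (t i) by rewrite /= in_itv/= tK.
have GW : gauss_incr P' `[- K, K] (A n) (fun p => W (A n p)).
  have := @gauss_incr_timechange _ _ _ P' setT `[- K, K] id (A n) W (gauss_incr_wiener HW).
  by apply => // p q pK qK; apply: Ai; rewrite inE.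
rewrite -(gauss_incr_eqlaw GX GW D0 Dt (measurable_almost_max (Q n))).
have mS : measurable [set w | x <= sg * u n w /\ `|u n w| <= K].
  apply: measurableI; first by apply: measurable_ge; exact: measurable_funM.
  rewrite (_ : (fun w => _) = (u n) @^-1` `[- K, K]).
    by rewrite -[Y in measurable Y]setTI; exact: mu.
  by apply/funext => w; rewrite /= in_itv/= ler_norml.
apply: le_measure; rewrite ?inE//.
  have mF : measurable_fun setT (fun w => (fun i => X n (t i) w - X n 0 w) : path_space R).
    case: GX => mX _; apply: measurable_path => i; apply: measurable_funB; exact: mX.
  by have := mF measurableT _ (measurable_almost_max (Q n)); rewrite setTI.
move=> w /= [xu uK] k.
have uK' : - K <= u n w <= K by rewrite -ler_norml.
pose f p := dl * X n p w - Q n p.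
have k0 : 0 < k.+1%:R^-1 :> R by rewrite invr_gt0.
have uI : `[- K, K]%classic (u n w) by rewrite /= in_itv.
have cXu : X n p w @[p --> within `[- K, K]%classic (nbhs (u n w))] --> X n (u n w) w.
  by have /subspace_continuousP := cX w; apply.
have cQu : Q n p @[p --> within `[- K, K]%classic (nbhs (u n w))] --> Q n (u n w).
  by have /subspace_continuousP := cQ; apply.
have cf : f p @[p --> within `[- K, K]%classic (nbhs (u n w))] --> f (u n w).
  by apply: cvgB; [apply: cvgMr; exact: cXu|exact: cQu].
move: cf => /cvgrPdist_lt/(_ _ k0); rewrite /within/= => -[e /= e0 eP].
(* Within s of the maximiser the time stays in the enlarged half-line; within e the criterion
   changes by less than 1 / (k + 1). *)
have [i] := times_dense uK' (e := Num.min e s) (ltac:(by rewrite lt_min e0 s0)).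
rewrite -/(t i) lt_min => /andP[ie i_s].
exists i; split.
  have : `|sg * t i - sg * u n w| < s by rewrite -mulrBr normrM nsg mul1r.
  rewrite ltr_norml => /andP[h _]; lra.
move=> j; have := eP (t i); rewrite /= in_itv/= tK distrC ie => /(_ isT isT).
have := max_u w uK (t j) (tK j); rewrite -!/(f _) => h1.
rewrite ltr_norml => /andP[_]; rewrite !mulrBr /f in h1 *.
by move: (_^-1) h1 => q h1 h2; lra.
Qed.

Hypothesis uAQ : forall e, 0 < e -> \forall n \near \oo, forall p, - K <= p <= K ->
  `|A n p - p| <= e /\ `|Q n p - gm / 2 * p ^+ 2| <= e.

(** One large n at which the event occurs is enough. Uniform continuity of the path replaces W (A n
    p) by W p, and the tilt turns almost-maximality beyond x - s into a strict margin over all times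
    below x - 2s. *)
Lemma limsup_tilted (w : Omega') : W 0 w = 0 -> continuous (W ^~ w) ->
  lim_sup_set (fun n => [set w | almost_max (Q n) (fun i => W (A n (t i)) w - W (A n 0) w)]) w ->
  tilted_max (sg * s) (fun i => W (t i) w - W 0 w).
Proof.
move=> W0 cW H.
(* Five errors of size r (two from the clock, two from the drift, one from the slack) cost 5/16 of
   the gain gm s^2, which leaves more than the required half. *)
pose r := gm * s * s / 16; have r0 : 0 < r by rewrite divr_gt0// !mulr_gt0.
have rd0 : 0 < r / dl by rewrite divr_gt0.
have [e e0 eP] := uniform_modulus (- K) K cW rd0.
have m0 : 0 < Num.min e r by rewrite lt_min e0.
have [N _ NP] := uAQ m0.
have [n /= Nn An] := H N I.
have AQ p : - K <= p <= K -> `|dl * W (A n p) w - dl * W p w| <= r /\ `|Q n p - gm / 2 * p ^+ 2| <= r.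
  move=> pK; have [] := NP n Nn p pK; rewrite !le_min => /andP[h1 _] /andP[_ h2]; split => //.
  by rewrite -mulrBr normrM gtr0_norm// mulrC -ler_pdivlMr//; exact: eP.
have [i [xi iP]] := An (Num.truncn r^-1).
exists i => j hj; have := iP j.
have hr : (Num.truncn r^-1).+1%:R^-1 < r by rewrite -[ltRHS]invrK ltf_pV2 ?posrE ?invr_gt0// truncnS_gt.
have [/ler_normlP[a1 a2] /ler_normlP[a3 a4]] := AQ _ (tK i).
have [/ler_normlP[b1 b2] /ler_normlP[b3 b4]] := AQ _ (tK j).
rewrite -/(t i) -/(t j) => h.
have e1 : gm / 2 * (t i - sg * s) ^+ 2 = gm / 2 * t i ^+ 2 - gm * s * (sg * t i) + gm / 2 * s ^+ 2.
  by rewrite sqrrB exprMn sg2; field.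
have e2 : gm / 2 * (t j - sg * s) ^+ 2 = gm / 2 * t j ^+ 2 - gm * s * (sg * t j) + gm / 2 * s ^+ 2.
  by rewrite sqrrB exprMn sg2; field.
have gs : 0 < gm * s by rewrite mulr_gt0.
have h3 : gm * s * s <= gm * s * (sg * t i - sg * t j) by rewrite ler_pM2l//; lra.
rewrite e1 e2 W0; rewrite mulrBr in h3; set q := (Num.truncn r^-1).+1%:R^-1 in h hr.
move: q hr h => q hr h; rewrite /r in a1 a2 a3 a4 b1 b2 b3 b4 hr; rewrite !mulrBr in h *; lra.
Qed.

Lemma probability_le_ae d0 (Z : measurableType d0) (Pr : probability Z R)
  (E F : set Z) : measurable E -> measurable F ->
  {ae Pr, forall w, E w -> F w} -> (Pr E <= Pr F)%E.
Proof.
move=> mE mF [N [mN N0 HN]].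
apply: (@le_trans _ _ (Pr (F `|` N))).
  apply: le_measure; rewrite ?inE//; first exact: measurableU.
  move=> w Ew; have [Nw|Nw] := pselect (N w); first by right.
  by left; apply: contrapT => Fw; apply: Nw; apply: HN => /= h; apply: Fw; exact: h.
by apply: (@le_trans _ _ (Pr F + Pr N)%E); [exact: measureU2|rewrite N0 adde0].
Qed.

Lemma measurable_path_event (E : set (path_space R)) (q : nat -> R) (q0 : R) :
  measurable E -> measurable [set w | E (fun i => W (q i) w - W q0 w)].
Proof.
move=> mE; have mF : measurable_fun setT (fun w => (fun i => W (q i) w - W q0 w) : path_space R).
  by apply: measurable_path => i; apply: measurable_funB; exact: mW.
by have := mF measurableT _ mE; rewrite setTI.
Qed.

Let T2 := [set w | x - 3 * s <= sg * uhat w \/ K - s < `|uhat w|].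

Let mT2 : measurable T2.
Proof.
apply: measurableU; first by apply: measurable_ge; exact: measurable_funM.
by apply: measurable_gt; exact: measurableT_comp.
Qed.

(** The translated criterion is maximal at uhat + sg s. If sg * uhat were below x - 3s with |uhat|
    <= K - s, this maximiser would lie below x - 2s, and a nearby time [t j] would come within gm
    s^2 / 2 of the maximum, against the margin in [tilted_max]. *)
Lemma tilted_uhat : (P' [set w | tilted_max (sg * s) (fun i => W (t i - sg * s) w - W (0 - sg * s) w)%R] <=
  P' T2)%E.
Proof.
apply: probability_le_ae => //.
  exact: (@measurable_path_event _ (fun i => t i - sg * s)) (measurable_tilted_max _).
move: ctW uhatP; apply: filterS2 => w [_ cW] maxw [i Hi].
apply: contrapT => /not_orP[/negP]; rewrite -ltNge => h1 /negP; rewrite -leNgt => h2.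
pose p := uhat w + sg * s.
have sgp : sg * p = sg * uhat w + s by rewrite /p mulrDr mulrA -expr2 sg2 mul1r.
have pK : - K <= p <= K.
  rewrite -ler_norml; apply: (le_trans (ler_normD _ _)); rewrite normrM nsg mul1r (gtr0_norm s0); lra.
pose f v := dl * W (v - sg * s) w - gm / 2 * (v - sg * s) ^+ 2.
have cf : {for p, continuous f}.
  apply: continuousB.
    apply: continuousM; first exact: cst_continuous.
    apply: (@continuous_comp _ _ _ (fun v => v - sg * s) (W ^~ w)); last exact: cW.
    by apply: continuousB; [exact: cvg_id|exact: cst_continuous].
  apply: continuousM; first exact: cst_continuous.
  apply: (@continuous_comp _ _ _ (fun v => v - sg * s) (fun z => z ^+ 2)); last exact: sqr_continuous.
  by apply: continuousB; [exact: cvg_id|exact: cst_continuous].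
have g0 : 0 < gm * s * s / 2 by rewrite divr_gt0// !mulr_gt0.
move: cf => /cvgrPdist_lt/(_ _ g0)[e /= e0 eP].
have z0 : 0 < x - 2 * s - sg * p by rewrite sgp; lra.
(* Closer to p than the room left below x - 2s, so that [t j] is one of the times compared in
   [tilted_max]. *)
have [j] := times_dense pK (e := Num.min e (x - 2 * s - sg * p)) (ltac:(by rewrite lt_min e0 z0)).
rewrite -/(t j) lt_min => /andP[je js].
have tj : sg * t j <= x - 2 * s.
  have : `|sg * t j - sg * p| < x - 2 * s - sg * p by rewrite -mulrBr normrM nsg mul1r.
  rewrite ltr_norml => /andP[_ h]; lra.
have := Hi j tj; have := maxw (t i - sg * s); have := eP (t j).
rewrite /= distrC je => /(_ isT); rewrite ltr_norml => /andP[_].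
rewrite /f /p addrK => h3 h4 h5; lra.
Qed.

(** Reverse Fatou on the space carrying W: P'(F n) is bounded by the probability of the union of the
    later events, which decreases to that of the limsup event. That event almost surely implies
    [tilted_max], whose probability may be computed on the translated path because W has stationary
    increments. *)
Lemma argmax_limsup : (\forall n \near \oo, admissible n) ->
  forall kap, 0 < kap -> \forall n \near \oo,
  (P [set w | (x <= sg * u n w)%R /\ (`|u n w| <= K)%R] <= P' T2 + kap%:E)%E.
Proof.
move=> adm kap kap0.
pose F n := [set w | almost_max (Q n) (fun i => W (A n (t i)) w - W (A n 0) w)].
have mF n : measurable (F n).
  exact: (@measurable_path_event _ (fun i => A n (t i))) (measurable_almost_max _).
have mL : measurable (lim_sup_set F).
  by apply: bigcapT_measurable => n; apply: bigcup_measurable => k _; exact: mF.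
have LT2 : (P' (lim_sup_set F) <= P' T2)%E.
  apply: le_trans tilted_uhat.
  have G1 : gauss_incr P' setT id (fun p => W p) := gauss_incr_wiener HW.
  have G2 : gauss_incr P' setT id (fun p => W (p - sg * s)).
    apply: (@gauss_incr_eq _ _ _ P' setT (id \o (fun p => p - sg * s))).
      by move=> p q _ _ /=; ring.
    by apply: (gauss_incr_timechange G1) => // p q _ _ pq; rewrite ltrD2r.
  rewrite -(gauss_incr_eqlaw (b := 0) G1 G2 _ _ (measurable_tilted_max (sg * s)))//.
  apply: probability_le_ae => //.
    exact: (@measurable_path_event _ t) (measurable_tilted_max _).
  by move: ctW; apply: filterS => w [W0 cW]; exact: limsup_tilted.
have cvF := lim_sup_set_cvg P' F mF.
have fin0 : (P' (\bigcup_(k in [set k | (0 <= k)%N]) F k) < +oo)%E.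
  by apply: le_lt_trans (ltry 1); apply: probability_le1; apply: bigcup_measurable.
have {fin0}/fine_cvgP[_ cvF'] : P' (\bigcup_(k in [set k | (n <= k)%N]) F k) @[n --> \oo] --> (fine (P' (lim_sup_set F)))%:E.
  by rewrite fineK ?fin_num_measure//; exact: cvF.
have lt : fine (P' (lim_sup_set F)) < fine (P' T2) + kap.
  apply: (@le_lt_trans _ _ (fine (P' T2))); last by rewrite ltrDl.
  by apply: fine_le; rewrite ?fin_num_measure.
near=> n.
have an : admissible n by near: n.
apply: (le_trans (argmax_transfer an)).
have mU : measurable (\bigcup_(k in [set k | (n <= k)%N]) F k) by apply: bigcup_measurable.
apply: (@le_trans _ _ (P' (\bigcup_(k in [set k | (n <= k)%N]) F k))).
  apply: le_measure; rewrite ?inE//; first exact: mF.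
  by move=> w Fw; exists n => //=.
rewrite -(fineK (fin_num_measure _ _ mU)) -(fineK (fin_num_measure _ _ mT2)) -EFinD lee_fin.
apply: ltW; near: n.
by move/cvgr_lt: cvF' => /(_ _ lt).
Unshelve. all: by end_near. Qed.

End argmax.

(** * The contrast function *)

Lemma C1_continuous (R : realType) (a b x : R) (f : R -> R) :
  C1_on a b f -> a < x < b -> {for x, continuous f}.
Proof.
move=> C1f /C1f[df _]; apply: differentiable_continuous.
by apply/derivable1_diffP; exact: df.
Qed.

Section contrast.
Context {R : realType}.
Variables (T al be Ch Cg : R) (h g S0 : R -> R).
Let mu := @lebesgue_measure R.
Hypotheses (al0 : 0 < al) (beT : be < T).
Hypotheses (mh : measurable_fun `[0, T] h) (mg : measurable_fun `[0, T] g)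
  (mS : measurable_fun `[0, T] S0)
  (iS : mu.-integrable `[0, T] (fun t => (S0 t ^+ 2)%:E))
  (bh : forall t, 0 <= t <= T -> `|h t| <= Ch) (bg : forall t, 0 <= t <= T -> `|g t| <= Cg).

(** The derivative of [Phi] inside (al, be): moving the change point to the right replaces the
    squared error of g by that of h. Its own derivative is [Phidd]. *)
Definition drift_gap (t : R) : R := (h t - S0 t) ^+ 2 - (g t - S0 t) ^+ 2.

Lemma square_integrable_bound (f : R -> R) (D1 D2 : R) : measurable_fun `[0, T] f ->
  (forall t, 0 <= t <= T -> `|f t| <= D1 + D2 * S0 t ^+ 2) ->
  mu.-integrable `[0, T] (EFin \o f).
Proof.
move=> mf H.
have i : mu.-integrable `[0, T] (fun t => (D1 + D2 * S0 t ^+ 2)%:E).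
  have i1 : mu.-integrable `[0, T] (cst D1%:E).
    apply: (@continuous_compact_integrable _ (cst D1)); first exact: segment_compact.
    exact: cst_continuous.
  have i2 := integrableZl (mu := mu) (measurable_itv `[0, T]) D2 iS.
  by have := integrableD (mu := mu) (measurable_itv `[0, T]) i1 i2; apply: eq_integrable.
apply: (le_integrable (mu := mu) (measurable_itv `[0, T]) _ _ i).
  exact/measurable_EFinP.
move=> t; rewrite /= in_itv/= => tT; rewrite lee_fin (le_trans (H t tT))//; exact: ler_norm.
Qed.

Lemma bounded_Mtrend th t : 0 <= t <= T -> `|Mtrend h g th t| <= Num.max Ch Cg.
Proof. by move=> tT; rewrite /Mtrend le_max; case: ifP => _; rewrite ?bh ?bg ?orbT. Qed.

Lemma integrable_Mtrend2 th : mu.-integrable `[0, T] (EFin \o (fun t => Mtrend h g th t ^+ 2)).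
Proof.
apply: (@square_integrable_bound _ (Num.max Ch Cg ^+ 2) 0).
  by apply: measurable_funX; exact: measurable_Mtrend.
move=> t tT; rewrite mul0r addr0 normrX; have := bounded_Mtrend th tT.
by have := normr_ge0 (Mtrend h g th t) => z0 zC; rewrite ler_sqr ?nnegrE ?(le_trans z0).
Qed.

Lemma integrable_MtrendS th : mu.-integrable `[0, T] (EFin \o (fun t => Mtrend h g th t * S0 t)).
Proof.
apply: (@square_integrable_bound _ (Num.max Ch Cg ^+ 2) 1).
  by apply: measurable_funM => //; exact: measurable_Mtrend.
move=> t tT; have := bounded_Mtrend th tT; set M := Num.max _ _; move: (Mtrend _ _ _ _) => m mM.
rewrite mul1r normrM -(real_normK (num_real (S0 t))).
have := sqr_ge0 (`|m| - `|S0 t|); have := normr_ge0 m; have := normr_ge0 (S0 t).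
by move: (`|m|) (`|S0 t|) mM => y z mM *; nra.
Qed.

Lemma Phi_expand th : Phi T h g S0 th =
  Rintegral mu `[0, T] (fun t => Mtrend h g th t ^+ 2)
  - 2 * Rintegral mu `[0, T] (fun t => Mtrend h g th t * S0 t)
  + Rintegral mu `[0, T] (fun t => S0 t ^+ 2).
Proof.
have i1 := integrable_Mtrend2 th; have i2 := integrable_MtrendS th.
have i3 := integrableZl (mu := mu) (measurable_itv `[0, T]) 2 i2.
rewrite -RintegralZl// -RintegralB// -RintegralD//; last exact: (integrableB (mu := mu) (measurable_itv `[0, T]) i1 i3).
by apply: eq_Rintegral => t _; ring.
Qed.

Lemma pseudo_likE (Omega : Type) (J : R -> Omega -> R) eps th w : 0 < eps ->
  pseudo_lik T h g S0 J eps th w = expR (eps ^- 2 *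
    (eps * J th w - Phi T h g S0 th / 2 + Rintegral mu `[0, T] (fun t => S0 t ^+ 2) / 2)).
Proof.
move=> e0; rewrite /pseudo_lik Phi_expand; congr expR; field.
by rewrite gt_eqF.
Qed.

Lemma integrable_Phi th : mu.-integrable `[0, T] (EFin \o (fun t => (Mtrend h g th t - S0 t) ^+ 2)).
Proof.
have i1 := integrable_Mtrend2 th; have i2 := integrable_MtrendS th.
have i3 := integrableZl (mu := mu) (measurable_itv `[0, T]) 2 i2.
have := integrableD (mu := mu) (measurable_itv `[0, T]) (integrableB (mu := mu) (measurable_itv `[0, T]) i1 i3) iS.
apply: eq_integrable; first exact: measurable_itv.
by move=> t _; rewrite /= -!(EFinM, EFinN, EFinD); congr (_%:E); ring.
Qed.

Lemma drift_gap_integrable A B : al <= A -> B <= be ->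
  mu.-integrable `]A, B[ (EFin \o drift_gap).
Proof.
move=> aA Bb.
have sub : `]A, B[ `<=` `[0, T]%classic.
  by apply: subset_itv; rewrite bnd_simp; [rewrite (le_trans _ aA)// ltW|rewrite (le_trans Bb)// ltW].
apply: (integrableS (mu := mu) (measurable_itv `[0, T]) (measurable_itv _) sub).
(* On [0, T] the trend is h for change point T + 1 and g for change point 0, so the difference of
   the two integrands is [drift_gap]. *)
have := integrableB (mu := mu) (measurable_itv `[0, T]) (integrable_Phi (T + 1)) (integrable_Phi 0).
apply: eq_integrable; first exact: measurable_itv.
move=> t; rewrite inE/= in_itv/= => /andP[t0 tT].
by rewrite /Mtrend [t < 0]ltNge t0 (le_lt_trans tT) ?ltrDl//.
Qed.

Lemma PhiB A B : al <= A -> A <= B -> B <= be ->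
  Phi T h g S0 B - Phi T h g S0 A = Rintegral mu `]A, B[ drift_gap.
Proof.
move=> aA AB Bb; rewrite /Phi -RintegralB//; [|exact: integrable_Phi|exact: integrable_Phi].
transitivity (Rintegral mu `[A, B[ drift_gap).
  have sub : `[A, B[ `<=` `[0, T]%classic.
    by apply: subset_itv; rewrite bnd_simp; [rewrite (le_trans _ aA)// ltW|rewrite (le_trans Bb)// ltW].
  rewrite -[in RHS](setIidr sub) Rintegral_mkcondr; apply: eq_Rintegral => t _.
  rewrite /Mtrend patchE mem_setE in_itv/= /drift_gap.
  have [tA|tA] := ltP t A; first by rewrite (lt_le_trans tA AB) subrr.
  by case: ifP => _; rewrite ?subrr.
by rewrite /Rintegral integral_itv_obnd_cbnd//; case/integrableP: (drift_gap_integrable aA Bb).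
Qed.

Variables (c v : R).
Hypotheses (v_in : al < v < be)
  (vmin : forall th, al < th < be -> Phi T h g S0 v <= Phi T h g S0 th)
  (h1 : C1_on al be h) (g1 : C1_on al be g) (S1 : C1_on al be S0)
  (cP : forall th, al < th < be -> c <= Phidd h g S0 th).

Let HF a b : al <= a -> a <= b -> b <= be ->
  mu.-integrable `]a, b[ (EFin \o drift_gap) /\
  Phi T h g S0 b - Phi T h g S0 a = Rintegral mu `]a, b[ (drift_gap).
Proof.
move=> aa ab bb; split.
  exact: drift_gap_integrable.
exact: PhiB.
Qed.

Lemma drift_gap_derive x : al < x < be -> is_derive x (1 : R) (drift_gap) (Phidd h g S0 x).
Proof.
move=> xI; have [dh _] := h1 xI; have [dg _] := g1 xI; have [dS _] := S1 xI.
have ih := derivableP dh.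
have ig := derivableP dg.
have iS0 := derivableP dS.
rewrite /drift_gap; apply: is_derive_eq; rewrite /Phidd !derive1E /GRing.scale/=; ring.
Qed.

Lemma drift_gap_continuous x : al < x < be -> {for x, continuous (drift_gap)}.
Proof.
by move=> xI; apply: differentiable_continuous; apply/derivable1_diffP; case: (drift_gap_derive xI).
Qed.

Lemma drift_gap_mono x y : al < x -> x <= y -> y < be ->
  c * (y - x) <= drift_gap y - drift_gap x.
Proof.
move=> ax xy yb.
have sub z : x <= z <= y -> al < z < be.
  by move=> /andP[xz zy]; rewrite (lt_le_trans ax xz) (le_lt_trans zy yb).
have [z||z zI ->] := @MVT_segment _ (drift_gap) (Phidd h g S0) x y xy.
- by rewrite in_itv/= => /andP[xz zy]; apply: drift_gap_derive; apply: sub; rewrite !ltW.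
- apply: continuous_in_subspaceT => z; rewrite inE/= in_itv/= => zI.
  by apply: drift_gap_continuous; exact: sub.
- by rewrite ler_wpM2r ?subr_ge0//; apply: cP; apply: sub; move: zI; rewrite in_itv.
Qed.

Let vI : al <= v <= be. Proof. by case/andP: v_in => *; rewrite !ltW. Qed.

Lemma Phi_slope x : al < x < be -> forall e, 0 < e -> exists2 rho, 0 < rho &
  forall t, al <= t <= be -> `|t - x| <= rho ->
    `|Phi T h g S0 t - Phi T h g S0 x - drift_gap x * (t - x)| <= e * `|t - x|.
Proof.
move=> xI e e0; have /cvgrPdist_le/(_ _ e0)[rho /= r0 rP] := drift_gap_continuous xI.
exists rho => // t tI tr; have xI' : al <= x <= be by case/andP: xI => *; rewrite !ltW.
have := @primitive_expansion _ al be 0 (drift_gap x) x e rho _ _ HF xI' _ t tI tr.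
rewrite !mul0r add0r; apply => s sI sx; rewrite !mul0r add0r distrC; apply: rP.
by rewrite /= distrC.
Qed.

Lemma Phi_continuous x : al < x < be -> {for x, continuous (Phi T h g S0)}.
Proof.
move=> xI; have [rho r0 H] := Phi_slope xI ltr01.
set k := `|drift_gap x| + 1; have k0 : 0 < k by rewrite ltr_wpDl.
apply/cvgrPdist_le => e e0; near=> t.
have tI : al <= t <= be.
  have : t \in `]al, be[ by near: t; apply: near_in_itvoo; rewrite in_itv.
  by rewrite in_itv/= => /andP[? ?]; rewrite !ltW.
have tr : `|t - x| <= rho.
  by rewrite distrC; near: t; apply: cvgr_dist_le => //; exact: cvg_id.
have te : `|t - x| <= e / k.
  by rewrite distrC; near: t; apply: cvgr_dist_le; [exact: cvg_id|rewrite divr_gt0].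
have := H t tI tr; rewrite distrC; move: te; rewrite ler_pdivlMr// /k mulrDr mulr1 mul1r.
set y := Phi _ _ _ _ t - _; rewrite -normrM (mulrC (t - x)) => te h2.
have := ler_normD (y - drift_gap x * (t - x)) (drift_gap x * (t - x)).
rewrite subrK (distrC y) => h3; rewrite distrC.
by apply: (le_trans h3); apply: le_trans te; rewrite addrC lerD2l.
Unshelve. all: by end_near. Qed.

(** First-order condition at an interior minimum, read off [Phi_slope]: if the slope k were nonzero,
    a step of length m against its sign would lower [Phi] by at least |k| m / 2. *)
Lemma drift_gap_argmin : drift_gap v = 0.
Proof.
set k := drift_gap v; apply: contrapT => /eqP k0.
have nk : 0 < `|k| / 2 by rewrite divr_gt0// normr_gt0.
have [rho r0 H] := Phi_slope v_in nk; case/andP: (v_in) => av vb.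
pose m := Num.min rho (Num.min (v - al) (be - v)) / 2.
have m0 : 0 < m by rewrite divr_gt0// !lt_min r0 !subr_gt0 av.
have [mr ma mb] : [/\ m <= rho, m < v - al & m < be - v].
  have h2 : m * 2 = Num.min rho (Num.min (v - al) (be - v)) by rewrite /m divfK.
  have : m * 2 <= rho /\ m * 2 <= v - al /\ m * 2 <= be - v.
    by rewrite h2 !ge_min !lexx !orbT.
  by move=> [? [? ?]]; split; lra.
pose t := v - sgr k * m.
have nsk : `|sgr k| = 1 by rewrite normr_sg k0.
have tv : `|t - v| = m by rewrite /t addrAC subrr sub0r normrN normrM nsk mul1r gtr0_norm.
have tI : al < t < be.
  have : `|t - v| <= m by rewrite tv.
  by rewrite ler_distl => /andP[? ?]; apply/andP; split; lra.
case/andP: (tI) => h2 h3.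
have := H t; rewrite tv (ltW h2) (ltW h3) => /(_ isT mr).
have -> : k * (t - v) = - (`|k| * m) by rewrite /t addrAC subrr sub0r mulrN mulrA (mulrC k) -normrEsg.
have := vmin tI; have km : 0 < `|k| * m by rewrite mulr_gt0// normr_gt0.
by rewrite ler_distl => h4 /andP[_]; rewrite mulrAC; lra.
Qed.

(** [drift_gap] vanishes at v and grows at rate at least c; integrating c (s - v) from v gives the
    quadratic. Integration over open intervals admits [al] and [be] as values of [th]. *)
Lemma Phi_quadratic_lb th : al <= th <= be ->
  c / 2 * (th - v) ^+ 2 <= Phi T h g S0 th - Phi T h g S0 v.
Proof.
move=> /andP[ath thb]; case/andP: (v_in) => av vb.
have [vt|tv] := leP v th.
  have [fi ->] := HF (ltW av) vt thb.
  have := @Rintegral_affine_le _ _ v th c v 0 vt fi.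
  rewrite subrr expr0n/= subr0 mul0r addr0; apply => s /andP[vs st]; rewrite addr0.
  have := drift_gap_mono av (ltW vs) (lt_le_trans st thb).
  by rewrite drift_gap_argmin subr0.
have [fi e] := HF ath (ltW tv) (ltW vb).
have := @Rintegral_affine_ge _ _ th v c v 0 (ltW tv) fi.
rewrite -e subrr expr0n/= sub0r mul0r addr0 mulrN => H.
rewrite lerNr opprB in H *; apply: H => s /andP[ts sv]; rewrite addr0.
have := drift_gap_mono (le_lt_trans ath ts) (ltW sv) vb.
by rewrite drift_gap_argmin sub0r lerNr -mulrN opprB.
Qed.

Lemma Phi_taylor e : 0 < e -> exists2 rho, 0 < rho &
  forall t, al <= t <= be -> `|t - v| <= rho ->
    `|Phi T h g S0 t - Phi T h g S0 v - Phidd h g S0 v / 2 * (t - v) ^+ 2| <= e * (t - v) ^+ 2.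
Proof.
move=> e0; have [dv dE] := drift_gap_derive v_in.
have : h0^-1 *: ((drift_gap \o shift v) (h0 *: 1) - drift_gap v) @[h0 --> 0^'] -->
  Phidd h g S0 v by rewrite -dE; exact: dv.
move=> /cvgrPdist_le/(_ _ e0)[rho /= r0 rP]; exists rho => // t tI tr.
(* Tolerance e |t - v| on the ball of radius |t - v|: the linear error of the derivative becomes
   quadratic after integration. *)
have := @primitive_expansion _ al be (Phidd h g S0 v) 0 v (e * `|t - v|) `|t - v| _ _ HF vI _ t tI (lexx _).
rewrite mul0r addr0 -(mulrA e) -(expr2 `|t - v|) real_normK ?num_real//; apply => s sI sv; rewrite addr0.
have [->|nsv] := eqVneq s v.
  by rewrite drift_gap_argmin subrr mulr0 subr0 normr0 mulr_ge0// ltW.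
have sv0 : 0 < `|s - v| by rewrite normr_gt0 subr_eq0.
apply: (@le_trans _ _ (e * `|s - v|)); last by rewrite ler_pM2l// ltW.
have := rP (s - v); rewrite /= sub0r normrN (lt_le_trans sv tr) subr_eq0 nsv => /(_ isT isT).
rewrite /GRing.scale/= mulr1 subrK drift_gap_argmin subr0 distrC -ler_pdivrMr// => h2.
rewrite -[X in _ / X]gtr0_norm// normr_id -normrV ?unitfE ?subr_eq0// -normrM; apply: le_trans h2.
by apply: le_of_eq; congr (`|_|); field; rewrite subr_eq0.
Qed.

End contrast.

(** * Rate of convergence and rescaling *)

Lemma within_continuous_affine (R : realType) (f : R -> R) (B A : set R) (v k : R) :
  {within B, continuous f} -> (forall t, A t -> B (v + k * t)) ->
  {within A, continuous (fun t => f (v + k * t))}.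
Proof.
move=> /subspace_continuousP cf AB; apply/subspace_continuousP => t At N /(cf _ (AB t At)).
rewrite !nbhs_simpl /within /= => H.
have ck : (v + k * x) @[x --> t] --> v + k * t.
  by apply: cvgD; [exact: cvg_cst|apply: cvgMr; exact: cvg_id].
exact: filterS (fun x Hx Ax => Hx (AB x Ax)) (ck _ H).
Qed.

Section argmax_rate.
Context {R : realType} {d : measure_display} {Omega : measurableType d}.
Variables (P : probability Omega R) (al be v c1 C1 kap : R) (G F : R -> R).
Variables (J : R -> Omega -> R) (th : R -> Omega -> R).
Hypotheses (v_in : al < v < be) (c10 : 0 < c1) (C10 : 0 <= C1) (kap0 : 0 < kap).
Hypotheses (GJ : gauss_incr P `[al, be] G J)
  (cJ : forall w, {within `[al, be], continuous (J ^~ w)})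
  (Glb : forall a b, al <= a -> a <= b -> b <= be -> c1 * (b - a) <= G b - G a)
  (Gub : forall a b, al <= a -> a <= b -> b <= be -> G b - G a <= C1 * (b - a))
  (Flb : forall t, al <= t <= be -> kap * (t - v) ^+ 2 <= F t - F v).
Hypothesis thP : forall eps, 0 < eps <= 1 -> measurable_fun setT (th eps) /\
  forall w, al <= th eps w <= be /\
    forall t, al <= t <= be -> eps * J t w - F t <= eps * J (th eps w) w - F (th eps w).

Let av : al < v. Proof. by case/andP: v_in. Qed.
Let vb : v < be. Proof. by case/andP: v_in. Qed.

Lemma J_tail m p q y : al <= p -> p < q -> q <= be -> 0 < y -> (0 < m)%N ->
  (P [set w | (y <= `|J q w - J p w|)%R] <= (tailC R m * C1 ^+ m * ((q - p) / y ^+ 2) ^+ m)%:E)%E.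
Proof.
move=> ap pq qb y0 m0.
have := @gauss_incr_tail _ _ _ P `[al, be] G J p q m y GJ.
rewrite /= !in_itv/= ap qb (le_trans ap (ltW pq)) (le_trans (ltW pq) qb).
have Gpq : 0 < G q - G p.
  by apply: lt_le_trans (Glb ap (ltW pq) qb); rewrite mulr_gt0// subr_gt0.
move=> /(_ isT isT pq); rewrite -subr_gt0 => /(_ Gpq y0 m0) /le_trans; apply.
have y20 : 0 < y ^+ 2 by rewrite exprn_gt0.
have tC : 0 <= tailC R m by rewrite mulr_ge0// exprn_ge0// mulr_ge0.
rewrite lee_fin -mulrA -exprMn ler_wpM2l// lerXn2r ?nnegrE//.
- by rewrite divr_ge0// ltW.
- by rewrite mulr_ge0// divr_ge0// ?subr_ge0 ltW.
- by rewrite mulrA ler_pM2r ?invr_gt0//; exact: Gub (ltW pq) qb.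
Qed.

(** Comparing the criterion at its maximiser and at v bounds kap times the squared distance by eps
    times the increment of J between them. This is the hypothesis of [peeling] for the process t ->
    J (v + sg t), which looks at one side of v. *)
Lemma one_sided_tail (m : nat) sg L : (4 <= m)%N -> sg ^+ 2 = 1 -> 0 < L ->
  (forall t, 0 <= t <= L -> al <= v + sg * t <= be) ->
  (forall t, al <= t <= be -> sg * (t - v) <= L) ->
  forall eps, 0 < eps <= 1 -> forall a, 0 < a ->
  (P [set w | (a <= sg * (th eps w - v))%R] <=
   (8 * (tailC R m * C1 ^+ m) * (200 / kap ^+ 2 * (eps ^+ 2 / a ^+ 3)) ^+ m)%:E)%E.
Proof.
move=> m4 sg2 L0 sub subL eps eps01 a a0; case/andP: (eps01) => eps0 _.
have m0 : (0 < m)%N by apply: leq_trans m4.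
have nsg : `|sg| = 1 by apply/eqP; rewrite -(@eqrXn2 _ 2)// expr1n -normrX sg2 normr1.
have [mth thmax] := thP eps01.
have K0 : 0 <= tailC R m * C1 ^+ m.
  by rewrite mulr_ge0 ?exprn_ge0// mulr_ge0// exprn_ge0// mulr_ge0.
apply: (@peeling _ _ _ P (fun t => J (v + sg * t)) L) => //.
- move=> w; exact: (@within_continuous_affine _ (J ^~ w) `[al, be] `[0, L] v sg).
- split=> [t tL|s t y s0 st tL y0].
    by case: GJ => mJ _; apply: mJ; rewrite /= in_itv/=; exact: sub.
  have st0 : 0 <= t by rewrite (le_trans s0)// ltW.
  have sL : s <= L by rewrite (le_trans _ tL)// ltW.
  have /andP[s1 s2] : al <= v + sg * s <= be by apply: sub; rewrite s0.
  have /andP[t1 t2] : al <= v + sg * t <= be by apply: sub; rewrite st0.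
  have e : t - s = `|(v + sg * t) - (v + sg * s)|.
    by rewrite opprD addrACA subrr add0r -mulrBr normrM nsg mul1r gtr0_norm ?subr_gt0.
  have [lt|lt|eq] := ltgtP (v + sg * s) (v + sg * t).
  + by rewrite e gtr0_norm ?subr_gt0//; exact: J_tail.
  + rewrite e ltr0_norm ?subr_lt0// opprB.
    rewrite (_ : [set w | _] = [set w | y <= `|J (v + sg * s) w - J (v + sg * t) w|]).
      exact: J_tail.
    by apply/seteqP; split => w /=; rewrite distrC.
  + by move: e; rewrite eq subrr normr0 => /eqP; rewrite subr_eq0 gt_eqF.
- by apply: measurable_funM => //; apply: measurable_funB.
- by move=> w; apply: subL; exact: (thmax w).1.
- move=> w; have [thI /(_ v) Hmax] := thmax w.
  rewrite mulr0 addr0 mulrA -expr2 sg2 mul1r (addrC v) subrK exprMn sg2 mul1r => _.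
  have := Flb thI; have := Hmax _; rewrite (ltW av) (ltW vb) => /(_ isT); rewrite mulrBr; lra.
Qed.

Lemma rate_tail (m : nat) : (4 <= m)%N -> exists2 K, 0 <= K & forall eps, 0 < eps <= 1 ->
  forall a, 0 < a -> (P [set w | (a <= `|th eps w - v|)%R] <= (K * (eps ^+ 2 / a ^+ 3) ^+ m)%:E)%E.
Proof.
move=> m4; pose K0 := 8 * (tailC R m * C1 ^+ m) * (200 / kap ^+ 2) ^+ m.
have K00 : 0 <= K0.
  have q0 : 0 <= 200 / kap ^+ 2 by rewrite divr_ge0// sqr_ge0.
  have t0 : 0 <= tailC R m by rewrite mulr_ge0// exprn_ge0// mulr_ge0.
  exact: mulr_ge0 (mulr_ge0 (ler0n _ _) (mulr_ge0 t0 (exprn_ge0 _ C10))) (exprn_ge0 _ q0).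
exists (K0 + K0); first exact: addr_ge0.
move=> eps eps01 a a0; have [mth _] := thP eps01.
have mset sg : measurable [set w | a <= sg * (th eps w - v)].
  by apply: measurable_ge; apply: measurable_funM => //; exact: measurable_funB.
apply: (@le_trans _ _ (P ([set w | a <= 1 * (th eps w - v)] `|` [set w | a <= -1 * (th eps w - v)]))).
  apply: le_measure; rewrite ?inE//.
  - by apply: measurable_norm_ge; exact: measurable_funB.
  - by apply: measurableU.
  - by move=> w /=; rewrite ler_normr mul1r mulN1r; case/orP; [left|right].
apply: le_trans (measureU2 _ _ _) _ => //.
rewrite mulrDl EFinD; apply: leeD.
  rewrite /K0 -(mulrA _ ((200 / kap ^+ 2) ^+ m)) -exprMn.
  apply: (@one_sided_tail m 1 (be - v)); rewrite ?expr1n ?subr_gt0//.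
    by move=> t /andP[t0 tb]; have := av; rewrite mul1r => ?; apply/andP; split; lra.
  by move=> t /andP[t0 tb]; rewrite mul1r; lra.
rewrite /K0 -(mulrA _ ((200 / kap ^+ 2) ^+ m)) -exprMn.
apply: (@one_sided_tail m (-1) (v - al)); rewrite ?sqrrN ?expr1n ?subr_gt0//.
  by move=> t /andP[t0 tb]; have := vb; rewrite mulN1r => ?; apply/andP; split; lra.
by move=> t /andP[t0 tb]; rewrite mulN1r; lra.
Qed.

Variables (dl gm : R) (rho : nat -> R).
Hypotheses (dl0 : 0 < dl) (cF : forall x, al < x < be -> {for x, continuous F}).
Hypothesis G_slope : forall e, 0 < e -> exists2 r, 0 < r & forall t, al <= t <= be ->
  `|t - v| <= r -> `|G t - G v - dl ^+ 2 * (t - v)| <= e * `|t - v|.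
Hypothesis F_taylor : forall e, 0 < e -> exists2 r, 0 < r & forall t, al <= t <= be ->
  `|t - v| <= r -> `|F t - F v - gm / 2 * (t - v) ^+ 2| <= e * (t - v) ^+ 2.
Hypotheses (rho01 : forall n, 0 < rho n <= 1) (rho_cvg : rho n @[n --> \oo] --> 0).

Let rho0 n : 0 < rho n. Proof. by case/andP: (rho01 n). Qed.
Let rho20 n : 0 < rho n ^+ 2. Proof. by rewrite exprn_gt0. Qed.

(** Here rho n is the cube root of eps. Over a distance rho^2 p the variance of [J] is about dl^2
    rho^2 p, which fixes the factor 1 / (dl rho). Dividing eps J - F by rho^4 then gives dl times
    this noise minus [rescaled_drift], up to a constant. *)
Definition rescaled_noise n p w := (dl * rho n)^-1 * J (v + rho n ^+ 2 * p) w.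
Definition rescaled_clock n p := (G (v + rho n ^+ 2 * p) - G v) / (dl * rho n) ^+ 2.
Definition rescaled_drift n p := (F (v + rho n ^+ 2 * p) - F v) / rho n ^+ 4.
Definition rescaled_argmax n w := (th (rho n ^+ 3) w - v) / rho n ^+ 2.

Lemma rescaled_small K r : 0 < K -> 0 < r -> \forall n \near \oo, forall p, - K <= p <= K ->
  `|rho n ^+ 2 * p| <= r.
Proof.
move=> K0 r0; have rK : 0 < r / K by rewrite divr_gt0.
have /cvgrPdist_le/(_ _ rK)[N _ NP] := rho_cvg.
exists N => // n /= Nn p; rewrite -ler_norml => pK.
have h1 : rho n <= r / K by have := NP n Nn; rewrite sub0r normrN gtr0_norm.
have h2 : rho n ^+ 2 <= r / K.
  by apply: le_trans h1; rewrite expr2 ger_pMr//; case/andP: (rho01 n).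
rewrite normrM gtr0_norm//; have := ler_pM (ltW (rho20 n)) (normr_ge0 p) h2 pK.
by rewrite divfK// gt_eqF.
Qed.

Lemma rescaled_in K : 0 < K -> \forall n \near \oo, forall p, - K <= p <= K ->
  al < v + rho n ^+ 2 * p < be.
Proof.
move=> K0; pose m := Num.min (v - al) (be - v) / 2.
have m0 : 0 < m by rewrite divr_gt0// lt_min !subr_gt0 av.
have [ma mb] : m < v - al /\ m < be - v.
  have h2 : m * 2 = Num.min (v - al) (be - v) by rewrite /m divfK.
  have : m * 2 <= v - al /\ m * 2 <= be - v by rewrite h2 !ge_min !lexx !orbT.
  by move=> [? ?]; split; lra.
have := rescaled_small K0 m0; apply: filterS => n H p pK.
have := H p pK; rewrite ler_norml => /andP[h1 h2]; apply/andP; split; lra.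
Qed.

Lemma rescaled_admissible K : 0 < K -> \forall n \near \oo,
  admissible P dl K rescaled_noise rescaled_argmax rescaled_clock rescaled_drift n.
Proof.
move=> K0; have := rescaled_in K0; apply: filterS => n Hin.
have dr0 : 0 < dl * rho n by rewrite mulr_gt0.
have inI p : - K <= p <= K -> al <= v + rho n ^+ 2 * p <= be.
  by move=> /Hin/andP[h1 h2]; rewrite !ltW.
have mono (p q : R) : - K <= p <= K -> - K <= q <= K -> p < q ->
   v + rho n ^+ 2 * p < v + rho n ^+ 2 * q by move=> _ _ pq; rewrite ltrD2l ltr_pM2l.
split.
- have G1 : gauss_incr P `[- K, K] (G \o (fun p => v + rho n ^+ 2 * p))
     (fun p => J (v + rho n ^+ 2 * p)).
    apply: (gauss_incr_timechange GJ) => [t|s t].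
      by rewrite /= !in_itv/=; exact: inI.
    by rewrite /= !in_itv/=; exact: mono.
  have k0 : 0 < (dl * rho n)^-1 by rewrite invr_gt0.
  apply: gauss_incr_eq (gauss_incr_scale k0 G1) => s t _ _.
  by rewrite /rescaled_clock /= exprVn; ring.
- move=> p q; rewrite !in_itv/= => pK qK pq.
  have := mono p q pK qK pq => h.
  have /andP[p1 p2] := inI p pK; have /andP[q1 q2] := inI q qK.
  rewrite /rescaled_clock ltr_pM2r ?invr_gt0 ?exprn_gt0// ltrD2r -subr_gt0.
  by apply: lt_le_trans (Glb p1 (ltW h) q2); rewrite mulr_gt0// subr_gt0.
- move=> w; have cJ' : {within `[al, be], continuous (fun t => (dl * rho n)^-1 * J t w)}.
    apply/subspace_continuousP => t tI; apply: cvgMr.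
    by have /subspace_continuousP := @cJ w; apply.
  by apply: (within_continuous_affine cJ') => t; rewrite /= !in_itv/=; exact: inI.
- have cF' : {within `]al, be[, continuous (fun t => (F t - F v) / rho n ^+ 4)}.
    apply: continuous_in_subspaceT => t; rewrite inE/= in_itv/= => tI.
    by apply: cvgMl; apply: cvgB; [exact: cF|exact: cvg_cst].
  by apply: (within_continuous_affine cF') => t; rewrite /= !in_itv/=; exact: Hin.
- split.
    have r3 : 0 < rho n ^+ 3 <= 1.
      by case/andP: (rho01 n) => h1 h2; rewrite exprn_gt0// exprn_ile1// ltW.
    by have [mth _] := thP r3; apply: measurable_funM => //; exact: measurable_funB.
  move=> w uK p pK.
  have r3 : 0 < rho n ^+ 3 <= 1.
    by case/andP: (rho01 n) => h1 h2; rewrite exprn_gt0// exprn_ile1// ltW.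
  have [_ /(_ w)[thI]] := thP r3; move=> /(_ _ (inI p pK)).
  have e : v + rho n ^+ 2 * rescaled_argmax n w = th (rho n ^+ 3) w.
    by rewrite /rescaled_argmax mulrCA divff ?gt_eqF// mulr1 addrC subrK.
  have r4 : 0 < rho n ^- 4 by rewrite invr_gt0 exprn_gt0.
  rewrite -(ler_pM2r r4) /rescaled_noise /rescaled_drift e => H.
  have h j f : dl * ((dl * rho n)^-1 * j) - (f - F v) / rho n ^+ 4 =
    (rho n ^+ 3 * j - f) * rho n ^- 4 + F v / rho n ^+ 4.
    by field; rewrite !gt_eqF.
  by rewrite !h lerD2r.
Qed.

Lemma rescaled_cvg K e : 0 < K -> 0 < e -> \forall n \near \oo, forall p, - K <= p <= K ->
  `|rescaled_clock n p - p| <= e /\ `|rescaled_drift n p - gm / 2 * p ^+ 2| <= e.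
Proof.
move=> K0 e0.
(* For |p| <= K the rescaling multiplies the slope error by at most K / dl^2 and the Taylor error by
   at most K^2. *)
have e1 : 0 < e * dl ^+ 2 / K by rewrite divr_gt0// mulr_gt0// exprn_gt0.
have e2 : 0 < e / K ^+ 2 by rewrite divr_gt0// exprn_gt0.
have [r1 r10 H1] := G_slope e1; have [r2 r20 H2] := F_taylor e2.
have h1 := rescaled_small K0 r10; have h2 := rescaled_small K0 r20; have h3 := rescaled_in K0.
apply: filterS3 h1 h2 h3 => n n1 n2 n3 p pK.
have pK' : `|p| <= K by rewrite ler_norml.
have pI : al <= v + rho n ^+ 2 * p <= be by have /andP[? ?] := n3 p pK; rewrite !ltW.
have ev : v + rho n ^+ 2 * p - v = rho n ^+ 2 * p by rewrite addrAC subrr add0r.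
have := H1 _ pI; have := H2 _ pI; rewrite ev => /(_ (n2 p pK)) b2 /(_ (n1 p pK)) b1.
split.
  have q0 : 0 < (dl * rho n) ^+ 2 by rewrite exprn_gt0// mulr_gt0.
  have -> : rescaled_clock n p - p =
     (G (v + rho n ^+ 2 * p) - G v - dl ^+ 2 * (rho n ^+ 2 * p)) / (dl * rho n) ^+ 2.
    by rewrite /rescaled_clock; field; rewrite !gt_eqF.
  rewrite normrM normfV (gtr0_norm q0) ler_pdivrMr//; apply: (le_trans b1).
  rewrite normrM (gtr0_norm (rho20 n)).
  have -> : e * (dl * rho n) ^+ 2 = e * dl ^+ 2 / K * (rho n ^+ 2 * K) by field; rewrite gt_eqF.
  by rewrite ler_pM2l// ler_pM2l.
have q0 : 0 < rho n ^+ 4 by rewrite exprn_gt0.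
have -> : rescaled_drift n p - gm / 2 * p ^+ 2 =
   (F (v + rho n ^+ 2 * p) - F v - gm / 2 * (rho n ^+ 2 * p) ^+ 2) / rho n ^+ 4.
  by rewrite /rescaled_drift; field; rewrite !gt_eqF.
rewrite normrM normfV (gtr0_norm q0) ler_pdivrMr//; apply: (le_trans b2).
have -> : e * rho n ^+ 4 = e / K ^+ 2 * (rho n ^+ 4 * K ^+ 2) by field; rewrite gt_eqF.
rewrite ler_pM2l// exprMn -exprM ler_pM2l// -(real_normK (num_real p)).
by rewrite lerXn2r ?nnegrE// ltW.
Qed.

End argmax_rate.

(** * Weak convergence and moments *)

Section probability_tools.
Context {R : realType} {d : measure_display} {Omega : measurableType d}.
Variable P : probability Omega R.

Lemma decreasing_events (E : nat -> set Omega) : (forall n, measurable (E n)) ->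
  (forall m n, (m <= n)%N -> E n `<=` E m) ->
  forall kap, 0 < kap -> exists n, (P (E n) <= P (\bigcap_n E n) + kap%:E)%E.
Proof.
move=> mE dE kap kap0; have mI : measurable (\bigcap_n E n) by exact: bigcapT_measurable.
have : P (E n) @[n --> \oo] --> P (\bigcap_n E n).
  apply: nonincreasing_cvg_mu => //.
    by rewrite (le_lt_trans (probability_le1 P (mE 0%N))) ?ltry.
  by move=> m n mn; apply/subsetPset; exact: dE.
rewrite -(fineK (fin_num_measure _ _ mI)) => /fine_cvgP[_ /cvgr_lt/(_ (fine (P (\bigcap_n E n)) + kap))].
rewrite ltrDl => /(_ kap0)[N _ NP]; exists N; have := NP N (leqnn _).
rewrite /= -lte_fin fineK ?fin_num_measure// => /ltW.
by rewrite EFinD.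
Qed.

Lemma tight (g : Omega -> R) : measurable_fun setT g -> forall kap, 0 < kap ->
  exists2 K, 0 < K & (P [set w | (K <= `|g w|)%R] <= kap%:E)%E.
Proof.
move=> mg kap kap0; pose E n := [set w | n.+1%:R <= `|g w|].
have mE n : measurable (E n) by exact: measurable_norm_ge.
have [m n mn w /=|n] := @decreasing_events E mE _ kap kap0.
  by apply: le_trans; rewrite ler_nat.
have -> : \bigcap_n E n = set0.
  apply/seteqP; split => // w H; have := H (Num.truncn `|g w|) I.
  by rewrite /E /= leNgt truncnS_gt.
by rewrite measure0 add0e; exists n.+1%:R.
Qed.

Lemma bounded_integrable (g : Omega -> R) C : measurable_fun setT g ->
  (forall w, `|g w| <= C) -> P.-integrable setT (EFin \o g).
Proof.
move=> mg gC; apply: measurable_bounded_integrable => //.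
  by rewrite (le_lt_trans (probability_le1 P measurableT)) ?ltry.
by exists C; split => [|y Cy w _]; [exact: num_real|exact: le_trans (gC w) (ltW Cy)].
Qed.

Lemma Rintegral_simple (N : nat) (a : R) (c : nat -> R) (E : nat -> set Omega) :
  (forall i, measurable (E i)) ->
  P.-integrable setT (EFin \o (fun w => a + \sum_(i < N) c i * \1_(E i) w)) /\
  Rintegral P setT (fun w => a + \sum_(i < N) c i * \1_(E i) w) =
  a + \sum_(i < N) c i * fine (P (E i)).
Proof.
move=> mE; elim: N => [|N [iN IH]].
  have e0 : (fun w => a + \sum_(i < 0) c i * \1_(E i) w) = cst a :> (Omega -> R).
    by apply/funext => w; rewrite big_ord0 addr0.
  rewrite e0 big_ord0 addr0; split; first exact: (@bounded_integrable _ `|a|).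
  by rewrite /Rintegral /cst integral_cst//= (@probability_setT _ _ _ P) mule1.
have i1 : P.-integrable setT (EFin \o \1_(E N)).
  apply: (@bounded_integrable _ 1) => [|w]; first exact: measurable_indic.
  by rewrite indicE ger0_norm// lern1 leq_b1.
have i2 : P.-integrable setT (EFin \o (fun w => c N * \1_(E N) w)).
  by have := integrableZl measurableT (c N) i1; apply: eq_integrable.
have e w : a + \sum_(i < N.+1) c i * \1_(E i) w = (a + \sum_(i < N) c i * \1_(E i) w) + c N * \1_(E N) w.
  by rewrite big_ord_recr/= addrA.
split.
  by have := integrableD measurableT iN i2; apply: eq_integrable => // w _; rewrite /= e.
transitivity (Rintegral P setT (fun w => (a + \sum_(i < N) c i * \1_(E i) w) + c N * \1_(E N) w)).
  by apply: eq_Rintegral => w _; rewrite e.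
rewrite RintegralD// IH RintegralZl// big_ord_recr/= addrA; congr (_ + _ * _).
by rewrite /Rintegral integral_indic// setIT.
Qed.

End probability_tools.

Section half_lines.
Context {R : realType} {d d' : measure_display}
  {Omega : measurableType d} {Omega' : measurableType d'}.
Variables (P : probability Omega R) (P' : probability Omega' R).
Variables (u : nat -> Omega -> R) (uhat : Omega' -> R).
Hypotheses (mu : forall n, measurable_fun setT (u n)) (muhat : measurable_fun setT uhat).

(** Removes the cutoff K and the slack s. The closed half-lines x - 3s <= sg * uhat decrease to x <=
    sg * uhat as s tends to 0, also when the law of uhat charges the boundary. Of the four shares
    kap / 4, two pay for the tails of u and uhat, one for shrinking s and one for the assumed
    bound. *)
Lemma half_line_limsup :
  (forall kap, 0 < kap -> exists2 K, 0 < K & forall n, (P [set w | (K <= `|u n w|)%R] <= kap%:E)%E) ->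
  (forall sg x K s kap, sg ^+ 2 = 1 -> 0 < K -> 0 < s -> 0 < kap -> \forall n \near \oo,
    (P [set w | (x <= sg * u n w)%R /\ (`|u n w| <= K)%R] <=
     P' [set w | (x - 3 * s <= sg * uhat w)%R \/ (K - s < `|uhat w|)%R] + kap%:E)%E) ->
  forall sg x kap, sg ^+ 2 = 1 -> 0 < kap -> \forall n \near \oo,
    (P [set w | (x <= sg * u n w)%R] <= P' [set w | (x <= sg * uhat w)%R] + kap%:E)%E.
Proof.
move=> tail H sg x kap sg2 kap0; have k4 : 0 < kap / 4 by rewrite divr_gt0.
have msu n : measurable_fun setT (fun w => sg * u n w) by exact: measurable_funM.
have msuh : measurable_fun setT (fun w => sg * uhat w) by exact: measurable_funM.
have mnu n : measurable_fun setT (fun w => `|u n w|) by exact: measurableT_comp.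
have mnuh : measurable_fun setT (fun w => `|uhat w|) by exact: measurableT_comp.
have [K1 K10 K1P] := tail _ k4; have [K2 K20 K2P] := tight P' muhat k4.
(* As s <= 1, having K >= K2 + 1 puts the event K - s < |uhat| inside K2 <= |uhat|. *)
pose K := Num.max K1 (K2 + 1).
have K0 : 0 < K by rewrite lt_max K10.
pose E n := [set w | x - 3 * n.+1%:R^-1 <= sg * uhat w].
have mE n : measurable (E n) by exact: measurable_ge.
have [m n mn w /=|n nP] := @decreasing_events _ _ _ P' E mE _ _ k4.
  apply: le_trans; rewrite lerB// ler_pM2l// lef_pV2 ?posrE// ler_nat//.
have IE : \bigcap_n E n = [set w | x <= sg * uhat w].
  apply/seteqP; split => w /= xw; last first.
    move=> k _; apply: le_trans xw; rewrite gerBl mulr_ge0//.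
  rewrite leNgt; apply/negP => lt.
  pose y := (x - sg * uhat w) / 3; have y0 : 0 < y by rewrite divr_gt0// subr_gt0.
  have := xw (Num.truncn y^-1) I; rewrite /E/=.
  have : (Num.truncn y^-1).+1%:R^-1 < y by rewrite -[ltRHS]invrK ltf_pV2 ?posrE ?invr_gt0// truncnS_gt.
  rewrite /y; move: (_.+1%:R^-1) => q h1 h2; lra.
have s0 : 0 < n.+1%:R^-1 :> R by rewrite invr_gt0.
have s1 : n.+1%:R^-1 <= 1 :> R by rewrite invf_le1// ler1n.
have := H sg x K n.+1%:R^-1 (kap / 4) sg2 K0 s0 k4; apply: filterS => k Hk.
have mA : measurable [set w | x <= sg * u k w /\ `|u k w| <= K].
  apply: measurableI; first exact: measurable_ge.
  rewrite (_ : (fun w => _) = ~` [set w | K < `|u k w|]); first by apply: measurableC; exact: measurable_gt.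
  by apply/seteqP; split => w /=; [rewrite leNgt => /negP|move/negP; rewrite -leNgt].
apply: (@le_trans _ _ (P [set w | (x <= sg * u k w)%R /\ (`|u k w| <= K)%R] + P [set w | (K1 <= `|u k w|)%R])%E).
  apply: le_trans (measureU2 _ _ _) => //; last exact: measurable_ge.
  apply: le_measure; rewrite ?inE//; first exact: measurable_ge.
    by apply: measurableU => //; exact: measurable_ge.
  move=> w /= xw; have [uK|uK] := leP `|u k w| K; first by left.
  by right; apply: le_trans (ltW uK); rewrite le_max lexx.
apply: (le_trans (leeD Hk (K1P k))).
apply: (@le_trans _ _ (((P' [set w | (x <= sg * uhat w)%R] + (kap / 4)%:E) + (kap / 4)%:E) + (kap / 4)%:E + (kap / 4)%:E)%E).
  apply: leeD2r; apply: leeD2r.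
  apply: (@le_trans _ _ (P' (E n) + P' [set w | (K2 <= `|uhat w|)%R])%E).
    apply: le_trans (measureU2 _ _ _) => //; last exact: measurable_ge.
    apply: le_measure; rewrite ?inE//.
    - by apply: (measurableU (E n)) => //; exact: measurable_gt.
    - by apply: measurableU => //; exact: measurable_ge.
    - move=> w /= [?|Kw]; [by left|right].
      have : K2 + 1 <= K by rewrite le_max lexx orbT.
      rewrite /=; move: Kw s1; move: (_.+1%:R^-1) => q *; lra.
  by apply: leeD => //; rewrite -IE.
rewrite -!addeA -!EFinD leeD2l// lee_fin; lra.
Qed.

End half_lines.

(** * Step approximations adapted to one-sided bounds *)

Section step_approximation.
Context {R : realType}.
Variables (f : R -> R) (p : nat -> R).
Hypothesis pi : forall i, p i < p i.+1.

Let c i := f (p i.+1) - f (p i).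

(* Whether the jump at [p i.+1] includes its endpoint depends on the sign of the
   increment of f, so that each term is upper semicontinuous. *)
Definition jump_set i : set R :=
  if 0 <= c i then [set x | p i.+1 <= x] else [set x | p i.+1 < x].

Lemma grid_mono i j : (i < j)%N -> p i < p j.
Proof.
elim: j => // j IH; rewrite ltnS leq_eqVlt => /predU1P[->//|/IH h].
exact: lt_trans h (pi j).
Qed.

Lemma jump_setP i x : (x \in jump_set i -> p i.+1 <= x) /\ (x \notin jump_set i -> x <= p i.+1).
Proof.
rewrite notin_setE inE /jump_set; case: ifP => _ /=; split => //.
- by move=> /negP; rewrite -ltNge => /ltW.
- exact: ltW.
- by move=> /negP; rewrite -leNgt.
Qed.

(** If x passes jump N it passes all earlier ones and the sum telescopes to f (p N.+1); otherwise
    the last term vanishes. At a grid point the jump may be counted or not, hence weak inequalities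
    on both sides; the outer cells k = 0 and k = N are unbounded on one side. *)
Lemma step_value N x : exists2 k, (k <= N)%N &
  [/\ f (p 0%N) + \sum_(i < N) c i * \1_(jump_set i) x = f (p k),
      (0 < k)%N -> p k <= x & (k < N)%N -> x <= p k.+1].
Proof.
elim: N => [|N [k kN [e k1 k2]]].
  by exists 0%N => //; split => //; rewrite big_ord0 addr0.
have [jN jN'] := jump_setP N x.
have [xN|xN] := boolP (x \in jump_set N).
  exists N.+1 => //; split; [|by move=> _; exact: jN|by rewrite ltnn].
  transitivity (f (p 0%N) + \sum_(i < N.+1) (f (p i.+1) - f (p i))).
    congr (_ + _); apply: eq_bigr => i _; rewrite indicE.
    suff -> : x \in jump_set i by rewrite mulr1.
    have [->//|ni] := eqVneq (i : nat) N.
    have iN : (i.+1 < N.+1)%N.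
      by rewrite ltnS ltn_neqAle ni -ltnS ltn_ord.
    have h := lt_le_trans (grid_mono iN) (jN xN).
    by rewrite inE /jump_set; case: ifP => _ //=; exact: ltW.
  by rewrite -(big_mkord xpredT (fun i => f (p i.+1) - f (p i))) telescope_sumr// subrKC.
exists k; first exact: leqW.
split=> //; first by rewrite big_ord_recr/= indicE (negbTE xN) mulr0 addr0.
rewrite ltnS leq_eqVlt => /predU1P[->|]; [exact: jN'|exact: k2].
Qed.

End step_approximation.

Section weak_limit.
Context {R : realType} {d d' : measure_display}
  {Omega : measurableType d} {Omega' : measurableType d'}.
Variables (P : probability Omega R) (P' : probability Omega' R).
Variables (u : nat -> Omega -> R) (uhat : Omega' -> R).
Hypotheses (mu : forall n, measurable_fun setT (u n)) (muhat : measurable_fun setT uhat).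
Hypothesis tail : forall kap, 0 < kap ->
  exists2 K, 0 < K & forall n, (P [set w | (K <= `|u n w|)%R] <= kap%:E)%E.
Hypothesis half_line : forall sg x kap, sg ^+ 2 = 1 -> 0 < kap -> \forall n \near \oo,
    (P [set w | (x <= sg * u n w)%R] <= P' [set w | (x <= sg * uhat w)%R] + kap%:E)%E.

Let prob n (A : set R) := fine (P (u n @^-1` A)).
Let prob' (A : set R) := fine (P' (uhat @^-1` A)).

Let mpre d0 (Z : measurableType d0) (g : Z -> R) A :
  measurable_fun setT g -> measurable A -> measurable (g @^-1` A).
Proof. by move=> mg mA; rewrite -[Y in measurable Y]setTI; exact: mg. Qed.

Lemma half_line_real sg x kap : sg ^+ 2 = 1 -> 0 < kap -> \forall n \near \oo,
  prob n [set y | x <= sg * y] <= prob' [set y | x <= sg * y] + kap.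
Proof.
move=> sg2 kap0; have := half_line x sg2 kap0; apply: filterS => n.
have mA : measurable [set y | x <= sg * y].
  by apply: (@measurable_ge _ _ _ (fun y => sg * y)); exact: measurable_funM.
rewrite /prob /prob' -lee_fin EFinD !fineK ?fin_num_measure//; exact: mpre.
Qed.

Lemma measurable_jump_set (f : R -> R) p i : measurable (jump_set f p i).
Proof.
by rewrite /jump_set; case: ifP => _; [exact: (@measurable_ge _ _ _ idfun _ (@measurable_id _ _ _))|exact: (@measurable_gt _ _ _ idfun _ (@measurable_id _ _ _))].
Qed.

(** A nonnegative coefficient meets a closed half-line, bounded through u. A negative one meets an
    open half-line, whose complement is closed and bounded through -u; the sign of the coefficient
    turns the inequality back. *)
Lemma jump_limsup (f : R -> R) p i kap : 0 < kap -> \forall n \near \oo,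
  (f (p i.+1) - f (p i)) * prob n (jump_set f p i) <=
  (f (p i.+1) - f (p i)) * prob' (jump_set f p i) + kap.
Proof.
move=> kap0; rewrite /jump_set; set c := _ - _; case: ifPn => c0.
  have [->|cn0] := eqVneq c 0; first by apply: nearW => n; rewrite !mul0r add0r ltW.
  have c1 : 0 < c by rewrite lt_neqAle eq_sym cn0.
  have k0 : 0 < kap / c by rewrite divr_gt0.
  have := @half_line_real 1 (p i.+1) _ (expr1n _ _) k0; apply: filterS => n.
  have -> : [set y | p i.+1 <= 1 * y] = [set y | p i.+1 <= y] by apply/seteqP; split => y /=; rewrite mul1r.
  by rewrite -(ler_pM2l c1) mulrDr (mulrC c (kap / c)) divfK.
rewrite -ltNge in c0; have c1 : 0 < - c by rewrite oppr_gt0.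
have k0 : 0 < kap / (- c) by rewrite divr_gt0.
have sg1 : (-1 : R) ^+ 2 = 1 by rewrite sqrrN expr1n.
have := @half_line_real (-1) (- p i.+1) _ sg1 k0; apply: filterS => n.
have -> : [set y | - p i.+1 <= -1 * y] = ~` [set y | p i.+1 < y].
  by apply/seteqP; split => y /=; rewrite mulN1r lerN2; [move=> h; apply/negP; rewrite -leNgt|move/negP; rewrite -leNgt].
have mA : measurable [set y : R | p i.+1 < y] by exact: (@measurable_gt _ _ _ idfun _ (@measurable_id _ _ _)).
have mn := mpre (@mu n) mA; have mh := mpre muhat mA.
rewrite /prob /prob' !preimage_setC !probability_setC// !fineB ?fin_num_measure//=.
set q := fine (P _); set q' := fine (P' _) => h.
have : - c * (1 - q) <= - c * (1 - q' + kap / - c) by rewrite ler_pM2l.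
have -> : - c * (1 - q' + kap / - c) = - c * (1 - q') + kap.
  by field; rewrite lt_eqF.
by rewrite !mulrBr; lra.
Qed.

Lemma sum_jump_limsup (f : R -> R) p N kap : 0 < kap -> \forall n \near \oo,
  \sum_(i < N) (f (p i.+1) - f (p i)) * prob n (jump_set f p i) <=
  \sum_(i < N) (f (p i.+1) - f (p i)) * prob' (jump_set f p i) + kap.
Proof.
elim: N kap => [|N IH] kap kap0; first by apply: nearW => n; rewrite !big_ord0 add0r ltW.
have k0 : 0 < kap / 2 by rewrite divr_gt0.
apply: filterS2 (IH _ k0) (jump_limsup f p N k0) => n h1 h2.
rewrite !big_ord_recr/=; lra.
Qed.

(** For |x| < M, a grid whose mesh is at most a modulus of continuity gives error r; elsewhere f and
    its step value are both bounded by C. *)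
Lemma step_uniform (f : R -> R) C r M : continuous f -> (forall x, `|f x| <= C) -> 0 < r -> 0 < M ->
  exists p : nat -> R, exists N, (forall i, p i < p i.+1) /\ forall x,
  `|f x - (f (p 0%N) + \sum_(i < N) (f (p i.+1) - f (p i)) * \1_(jump_set f p i) x)| <=
  r + 2 * C * \1_[set x | M <= `|x|] x.
Proof.
move=> cf fC r0 M0; have [e e0 eP] := uniform_modulus (- M) M cf r0.
pose N := (Num.truncn (2 * M / e)).+1.
have N0 : 0 < N%:R :> R by rewrite ltr0n.
pose s := 2 * M / N%:R; have s0 : 0 < s by rewrite divr_gt0// mulr_gt0.
have se : s <= e.
  rewrite /s ler_pdivrMr// (mulrC e) -ler_pdivrMr//; apply: ltW; exact: truncnS_gt.
pose p i := - M + i%:R * s.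
have pi i : p i < p i.+1 by rewrite /p ltrD2l ltr_pM2r// ltr_nat.
have pN : p N = M by rewrite /p /s mulrCA divff ?gt_eqF// mulr1; lra.
have p0 : p 0%N = - M by rewrite /p mul0r addr0.
exists p, N; split => // x; have [k kN [-> k1 k2]] := @step_value _ f p pi N x.
have C0 : 0 <= C := le_trans (normr_ge0 _) (fC 0).
have [xM|Mx] := ltP `|x| M; last first.
  rewrite indicE mem_set//= mulr1; apply: (le_trans (ler_normB _ _)).
  have := fC x; have := fC (p k); lra.
apply: (@le_trans _ _ r); last by rewrite lerDl mulr_ge0// mulr_ge0.
have pkM : - M <= p k <= M.
  have s00 := ltW s0; rewrite -[X in _ <= _ <= X]pN; apply/andP; split.
    by rewrite /p lerDl mulr_ge0.
  by rewrite /p lerD2l ler_wpM2r ?ler_nat.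
apply: eP => //; apply: le_trans se.
have [xl xr] : - M < x /\ x < M by move: xM; rewrite ltr_norml => /andP.
have psk : p k.+1 = p k + s by rewrite /p -addn1 natrD mulrDl mul1r addrA.
have kx : p k <= x by case: k k1 {k2 kN pkM psk} => [_|k]; [rewrite p0 ltW|exact].
have xk : x <= p k + s.
  move: kN; rewrite leq_eqVlt => /predU1P[->|/k2]; last by rewrite psk.
  by rewrite pN; apply: ltW; apply: lt_le_trans xr _; rewrite lerDl ltW.
by rewrite ger0_norm ?subr_ge0//; lra.
Qed.

Lemma expectation_step d0 (Z : measurableType d0) (Pr : probability Z R)
  (g : Z -> R) (f s : R -> R) C r M : measurable_fun setT g ->
  measurable_fun setT (f \o g) -> Pr.-integrable setT (EFin \o (s \o g)) ->
  (forall x, `|f x| <= C) ->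
  (forall x, `|f x - s x| <= r + 2 * C * \1_[set x | M <= `|x|] x) ->
  `|Rintegral Pr setT (f \o g) - Rintegral Pr setT (s \o g)| <=
  r + 2 * C * fine (Pr [set w | M <= `|g w|]).
Proof.
move=> mg mf is_ fC H.
have mM : measurable [set w | M <= `|g w|] by exact: measurable_norm_ge.
have if_ : Pr.-integrable setT (EFin \o (f \o g)) by apply: (@bounded_integrable _ _ _ Pr _ C) => // w; exact: fC.
have [ib eb] := @Rintegral_simple _ _ _ Pr 1 r (fun=> 2 * C) (fun=> [set w | M <= `|g w|]) (fun=> mM).
move: eb; rewrite big_ord1 => <-; rewrite -RintegralB//.
have id_ : Pr.-integrable setT (EFin \o (fun w => (f \o g) w - (s \o g) w)).
  by have := integrableB measurableT if_ is_; apply: eq_integrable.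
apply: (le_trans (le_normr_Rintegral _ id_)) => //; apply: le_Rintegral => //.
  by have := integrable_norm id_; apply: eq_integrable.
by move=> w _; rewrite big_ord1; apply: le_trans (H (g w)) _.
Qed.

Lemma weak_limsup (f : R -> R) C : continuous f -> (forall x, `|f x| <= C) ->
  forall kap, 0 < kap -> \forall n \near \oo,
  Rintegral P setT (f \o u n) <= Rintegral P' setT (f \o uhat) + kap.
Proof.
move=> cf fC kap kap0; have C0 : 0 <= C := le_trans (normr_ge0 _) (fC 0).
have mf : measurable_fun setT f by exact: continuous_measurable_fun.
(* Five such shares are spent: the uniform error and the tail error for each of u n and uhat, and
   the sum of the jumps. *)
have r0 : 0 < kap / 8 by rewrite divr_gt0.
have q0 : 0 < kap / 8 / (2 * C + 1) by rewrite divr_gt0// ltr_wpDl// mulr_ge0.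
have [M1 M10 M1P] := tail q0; have [M2 M20 M2P] := tight P' muhat q0.
pose M := Num.max M1 M2; have M0 : 0 < M by rewrite lt_max M10.
have [p [N [pi H]]] := step_uniform cf fC r0 M0.
pose s x := f (p 0%N) + \sum_(i < N) (f (p i.+1) - f (p i)) * \1_(jump_set f p i) x.
have {}H x : `|f x - s x| <= kap / 8 + 2 * C * \1_[set x0 | M <= `|x0|] x by exact: H.
have tailM d0 (Z : measurableType d0) (Pr : probability Z R) (g : Z -> R) K :
    measurable_fun setT g -> K <= M -> (Pr [set w | (K <= `|g w|)%R] <= (kap / 8 / (2 * C + 1))%:E)%E ->
    2 * C * fine (Pr [set w | M <= `|g w|]) <= kap / 8.
  move=> mg KM h; have mM x : measurable [set w | x <= `|g w|] by exact: measurable_norm_ge.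
  have : fine (Pr [set w | M <= `|g w|]) <= kap / 8 / (2 * C + 1).
    rewrite -lee_fin fineK ?fin_num_measure//; apply: le_trans h.
    by apply: le_measure; rewrite ?inE// => w /=; exact: le_trans.
  rewrite ler_pdivlMr ?ltr_wpDl ?mulr_ge0//.
  have : 0 <= fine (Pr [set w | M <= `|g w|]) by apply: fine_ge0; exact: measure_ge0.
  by move: (fine _) => q *; lra.
have sE d0 (Z : measurableType d0) (Pr : probability Z R) (g : Z -> R) :
    measurable_fun setT g -> Pr.-integrable setT (EFin \o (s \o g)) /\
    Rintegral Pr setT (s \o g) = f (p 0%N) + \sum_(i < N) (f (p i.+1) - f (p i)) * fine (Pr (g @^-1` jump_set f p i)).
  move=> mg; have mE i : measurable (g @^-1` jump_set f p i) by apply: mpre => //; exact: measurable_jump_set.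
  exact: (Rintegral_simple Pr N (f (p 0%N)) (fun i => f (p i.+1) - f (p i)) mE).
have := sum_jump_limsup f p N r0; apply: filterS => n Hn.
have [is1 e1] := sE _ _ P _ (@mu n); have [is2 e2] := sE _ _ P' _ muhat.
have := @expectation_step _ _ P (u n) f s C (kap / 8) M (@mu n) (measurableT_comp mf (@mu n)) is1 fC H.
have := @expectation_step _ _ P' uhat f s C (kap / 8) M muhat (measurableT_comp mf muhat) is2 fC H.
have t1 : 2 * C * fine (P [set w | M <= `|u n w|]) <= kap / 8.
  by apply: (tailM _ _ P (u n) M1) => //; rewrite le_max lexx.
have t2 : 2 * C * fine (P' [set w | M <= `|uhat w|]) <= kap / 8.
  by apply: (tailM _ _ P' uhat M2) => //; rewrite le_max lexx orbT.
rewrite /prob /prob' in Hn; rewrite e1 e2 !ler_distl => /andP[a1 a2] /andP[b1 b2]; lra.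
Qed.

Lemma weak_cvg (f : R -> R) C : continuous f -> (forall x, `|f x| <= C) ->
  Rintegral P setT (f \o u n) @[n --> \oo] --> Rintegral P' setT (f \o uhat).
Proof.
move=> cf fC; have mf : measurable_fun setT f by exact: continuous_measurable_fun.
have cNf : continuous (fun x => -1 * f x) by move=> x; apply: cvgMr; exact: cf.
have NfC x : `|-1 * f x| <= C by rewrite mulN1r normrN.
have ib d0 (Z : measurableType d0) (Pr : probability Z R) (g : Z -> R) :
    measurable_fun setT g -> Rintegral Pr setT ((fun x => -1 * f x) \o g) = - Rintegral Pr setT (f \o g).
  move=> mg; transitivity (-1 * Rintegral Pr setT (f \o g)); last by rewrite mulN1r.
  rewrite -RintegralZl//; apply: (@bounded_integrable _ _ _ Pr _ C) => [|w]; last exact: fC.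
  exact: measurableT_comp.
apply/cvgrPdist_le => e e0.
apply: filterS2 (weak_limsup cf fC e0) (weak_limsup cNf NfC e0) => n h1.
by rewrite !ib// => h2; rewrite distrC ler_distl; apply/andP; split; lra.
Qed.

End weak_limit.

(** * Convergence of moments by truncation *)

Section moments.
Context {R : realType}.
Variables (p : R) (q : nat).
Hypotheses (p0 : 0 < p) (pq : 2 * p <= q%:R).

(** Away from 0 the function is exp(p ln |x|); at 0 the estimate |y| <= e^(1/p) is used instead. *)
Lemma continuous_norm_powR : continuous (fun x : R => `|x| `^ p).
Proof.
move=> x; have [->|x0] := eqVneq x 0.
  rewrite /continuous_at normr0 powR0 ?gt_eqF//; apply/cvgrPdist_le => e e0.
  have y0 : 0 < e `^ p^-1 by rewrite powR_gt0.
  near=> y; rewrite sub0r normrN ger0_norm ?powR_ge0//.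
  have : `|y| <= e `^ p^-1.
    by rewrite -[y]subr0 distrC; near: y; apply: cvgr_dist_le => //; exact: cvg_id.
  move=> h; have := ge0_ler_powR (ltW p0) (x := `|y|) (y := e `^ p^-1).
  rewrite !nnegrE normr_ge0 powR_ge0 => /(_ isT isT h).
  by rewrite -powRrM mulVf ?gt_eqF// powRr1 // ltW.
have nx : 0 < `|x| by rewrite normr_gt0.
apply: (@cvg_trans _ (expR (p * ln `|y|) @[y --> x])).
  apply: near_eq_cvg; near=> y.
  rewrite /powR normr_eq0 ifF//; apply/negbTE; near: y.
  by apply: cvgr_neq0 x0; exact: cvg_id.
rewrite /powR normr_eq0 (negbTE x0).
apply: (@continuous_comp _ _ _ (fun y => p * ln `|y|) expR); last exact: continuous_expR.
apply: cvgMr; apply: (@continuous_comp _ _ _ (fun y : R => `|y|) (@ln R)); last exact: continuous_ln.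
exact: norm_continuous.
Unshelve. all: by end_near. Qed.

(** Bounded and continuous, so its powers are test functions for weak convergence. *)
Definition trunc_norm (L : R) (x : R) : R := Num.min `|x| L.

Lemma trunc_norm_itv L x : 0 <= L -> 0 <= trunc_norm L x <= L.
Proof. by move=> L0; rewrite /trunc_norm le_min normr_ge0 L0 ge_min lexx orbT. Qed.

Lemma continuous_trunc_norm L : continuous (trunc_norm L).
Proof.
by move=> x; apply: (@continuous_min _ _ (fun x : R => `|x|) (fun=> L)); [exact: norm_continuous|exact: cst_continuous].
Qed.

Lemma trunc_norm_dyadic J x :
  trunc_norm (2 ^+ J) x ^+ q <= 1 + \sum_(j < J) (2 ^+ j.+1) ^+ q * \1_[set y | 2 ^+ j <= `|y|] x.
Proof.
elim: J => [|J IH].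
  rewrite expr0 big_ord0 addr0; have /andP[h1 h2] := trunc_norm_itv x (@ler01 R).
  exact: exprn_ile1.
rewrite big_ord_recr/= addrA indicE; have [Jx|Jx] := leP (2 ^+ J) `|x|.
  rewrite mem_set// mulr1; have J0 : 0 <= 2 ^+ J.+1 :> R by rewrite exprn_ge0.
  have /andP[h1 h2] := trunc_norm_itv x J0.
  rewrite -[leLHS]add0r lerD//; last by rewrite lerXn2r.
  by rewrite addr_ge0// sumr_ge0// => i _; rewrite mulr_ge0// !exprn_ge0.
rewrite memNset/=; last by apply/negP; rewrite -ltNge.
rewrite mulr0 addr0; apply: le_trans IH; rewrite /trunc_norm min_l.
  by rewrite min_l// ltW.
apply: le_trans (ltW Jx) _; apply: ler_weXn2l => //; exact: ler1n.
Qed.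

(** When y^p > B, y^p <= (y^p)^2 / B = y^(2p) / B. Since 2p <= q, the numerator is at most y^q for y
    > 1 and at most 1 otherwise. *)
Lemma powR_trunc_le (y B : R) : 0 <= y -> 0 < B ->
  y `^ p <= Num.min (y `^ p) B + (1 + y ^+ q) / B.
Proof.
move=> y0 B0; have q0 : 0 <= y ^+ q by rewrite exprn_ge0.
have [yB|yB] := leP (y `^ p) B.
  by rewrite lerDl divr_ge0 ?ltW// ltr_wpDr.
apply: (@le_trans _ _ ((1 + y ^+ q) / B)); last by rewrite lerDr ltW.
rewrite ler_pdivlMr//; apply: (@le_trans _ _ ((y `^ p) ^+ 2)).
  by rewrite expr2 ler_wpM2l ?powR_ge0// ltW.
rewrite -powR_mulrn ?powR_ge0// -powRrM (mulrC p).
have [y1|y1] := leP y 1.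
  apply: (@le_trans _ _ 1); last by rewrite lerDl.
  have p2 : 0 <= 2 * p by rewrite mulr_ge0// ltW.
  have := ge0_ler_powR p2 (x := y) (y := 1); rewrite !nnegrE y0 ler01 powR1.
  by move=> /(_ isT isT y1).
apply: (@le_trans _ _ (y ^+ q)); last by rewrite lerDr.
by rewrite -powR_mulrn//; apply: ler_powR => //; exact: ltW.
Qed.

Let bC (B x : R) : 0 <= B -> `|Num.min (`|x| `^ p) B| <= B.
Proof. by move=> B0; rewrite ger0_norm ?le_min ?powR_ge0// ge_min lexx orbT. Qed.

Let cC (B : R) : continuous (fun x : R => Num.min (`|x| `^ p) B).
Proof.
by move=> x; apply: (@continuous_min _ _ (fun x : R => `|x| `^ p) (fun=> B)); [exact: continuous_norm_powR|exact: cst_continuous].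
Qed.

Lemma measurable_norm_powR d (Z : measurableType d) (g : Z -> R) :
  measurable_fun setT g -> measurable_fun setT (fun w => `|g w| `^ p).
Proof.
move=> mg; apply: (@measurableT_comp _ _ _ _ _ _ (fun x : R => `|x| `^ p)) => //.
by apply: continuous_measurable_fun; exact: continuous_norm_powR.
Qed.

(** The moment of order q is bounded only through truncations, uniformly in their level; monotone
    convergence along the levels 2^J then yields both the finiteness of the p-th moment and the
    truncation error (1 + D) / B. *)
Lemma moment_truncation d (Z : measurableType d) (Pr : probability Z R)
  (g : Z -> R) (D B : R) : measurable_fun setT g -> 0 < B ->
  (forall J, Rintegral Pr setT (fun w => trunc_norm (2 ^+ J) (g w) ^+ q) <= D) ->
  [/\ (\int[Pr]_w (`|g w| `^ p)%:E)%E \is a fin_num,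
   Rintegral Pr setT (fun w => Num.min (`|g w| `^ p) B) <= Rintegral Pr setT (fun w => `|g w| `^ p) &
   Rintegral Pr setT (fun w => `|g w| `^ p) <=
     Rintegral Pr setT (fun w => Num.min (`|g w| `^ p) B) + (1 + D) / B].
Proof.
move=> mg B0 HD; have mgp := measurable_norm_powR mg.
have L0 J : 0 <= 2 ^+ J :> R by rewrite exprn_ge0.
have mt J : measurable_fun setT (fun w => trunc_norm (2 ^+ J) (g w)).
  apply: measurableT_comp => //; apply: continuous_measurable_fun; exact: continuous_trunc_norm.
have mm : measurable_fun setT (fun w => Num.min (`|g w| `^ p) B).
  apply: (@measurableT_comp _ _ _ _ _ _ (fun x : R => Num.min (`|x| `^ p) B)) => //.
  by apply: continuous_measurable_fun; exact: cC.
have im : Pr.-integrable setT (EFin \o (fun w => Num.min (`|g w| `^ p) B)).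
  by apply: (bounded_integrable Pr mm (C := B)) => w; apply: bC; exact: ltW.
set E := Rintegral Pr setT (fun w => Num.min (`|g w| `^ p) B).
have itq J : Pr.-integrable setT (EFin \o (fun w => trunc_norm (2 ^+ J) (g w) ^+ q)).
  apply: (@bounded_integrable _ _ _ _ _ ((2 ^+ J) ^+ q)); first exact: measurable_funX.
  move=> w; have /andP[h1 h2] := trunc_norm_itv (g w) (L0 J).
  by rewrite ger0_norm ?exprn_ge0// lerXn2r ?nnegrE.
have mtp J : measurable_fun setT (fun w => trunc_norm (2 ^+ J) (g w) `^ p).
  have := measurable_norm_powR (mt J); apply: eq_measurable_fun => w _.
  by rewrite ger0_norm//; case/andP: (trunc_norm_itv (g w) (L0 J)).
have ub J : (\int[Pr]_w (trunc_norm (2 ^+ J) (g w) `^ p)%:E <= (E + (1 + D) / B)%:E)%E.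
  have i1 : Pr.-integrable setT (EFin \o (fun w => (1 + trunc_norm (2 ^+ J) (g w) ^+ q))).
    have := integrableD measurableT (bounded_integrable Pr (@measurable_cst _ _ _ _ setT (1 : R)) (C := 1) (fun=> ltac:(by rewrite normr1))) (itq J).
    by apply: eq_integrable.
  have i2 : Pr.-integrable setT (EFin \o (fun w => (1 + trunc_norm (2 ^+ J) (g w) ^+ q) / B)).
    have := integrableZl measurableT B^-1 i1; apply: eq_integrable => // w _.
    by rewrite /= -EFinM mulrC.
  apply: (@le_trans _ _ (\int[Pr]_w (Num.min (`|g w| `^ p) B + (1 + trunc_norm (2 ^+ J) (g w) ^+ q) / B)%:E)%E).
    apply: ge0_le_integral => //.
    - by move=> w _; rewrite lee_fin powR_ge0.
    - exact/measurable_EFinP.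
    - by apply/measurable_EFinP; case/integrableP: (integrableD measurableT im i2) => + _; move/measurable_EFinP.
    - move=> w _; rewrite lee_fin; have /andP[h1 h2] := trunc_norm_itv (g w) (L0 J).
      apply: (le_trans (powR_trunc_le h1 B0)); rewrite lerD2r.
      apply: le_min2 => //; apply: (ge0_ler_powR (ltW p0)); rewrite ?nnegrE ?normr_ge0//.
      by rewrite /trunc_norm ge_min lexx.
  rewrite (_ : \int[Pr]_w _ = (Rintegral Pr setT (fun w => Num.min (`|g w| `^ p) B + (1 + trunc_norm (2 ^+ J) (g w) ^+ q) / B))%:E)%E; last first.
    rewrite /Rintegral fineK//; apply: integrable_fin_num => //.
    by have := integrableD measurableT im i2; apply: eq_integrable.
  rewrite lee_fin RintegralD// lerD2l.
  have -> : Rintegral Pr setT (fun w => (1 + trunc_norm (2 ^+ J) (g w) ^+ q) / B) =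
    B^-1 * Rintegral Pr setT (fun w => 1 + trunc_norm (2 ^+ J) (g w) ^+ q).
    by rewrite -RintegralZl//; apply: eq_Rintegral => w _; rewrite mulrC.
  rewrite mulrC ler_pM2r ?invr_gt0// RintegralD//; last first.
    by apply: (bounded_integrable Pr (@measurable_cst _ _ _ _ setT (1 : R)) (C := 1)) => w; rewrite normr1.
  apply: lerD (HD J).
  by rewrite /Rintegral integral_cst//= (@probability_setT _ _ _ Pr) mule1.
have ubI : (\int[Pr]_w (`|g w| `^ p)%:E <= (E + (1 + D) / B)%:E)%E.
  pose G J w := (trunc_norm (2 ^+ J) (g w) `^ p)%:E.
  have Gle J1 J2 w : (J1 <= J2)%N -> (G J1 w <= G J2 w)%E.
    move=> J12; rewrite lee_fin; apply: (ge0_ler_powR (ltW p0)); rewrite ?nnegrE//.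
    - by case/andP: (trunc_norm_itv (g w) (L0 J1)).
    - by case/andP: (trunc_norm_itv (g w) (L0 J2)).
    - by rewrite /trunc_norm; apply: le_min2 => //; apply: ler_weXn2l => //; exact: ler1n.
  have lG w : limn (G ^~ w) = (`|g w| `^ p)%:E.
    apply: lim_near_cst => //.
    have [N NP] : exists N, `|g w| <= 2 ^+ N.
      exists (Num.truncn `|g w|).+1; apply: (@le_trans _ _ (Num.truncn `|g w|).+1%:R); first exact/ltW/truncnS_gt.
      by rewrite -natrX ler_nat ltnW// ltn_expl.
    exists N => // J /= NJ; rewrite /G /trunc_norm min_l//.
    by apply: le_trans NP _; apply: ler_weXn2l => //; exact: ler1n.
  have := @cvg_monotone_convergence _ _ _ Pr setT measurableT G.
  under eq_integral do rewrite lG.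
  move=> /(_ _ _ _)/cvge_to_le; apply.
  - by move=> J; exact/measurable_EFinP.
  - by move=> J w _; rewrite lee_fin powR_ge0.
  - by move=> w _ J1 J2; exact: Gle.
  - by apply: nearW => J; exact: ub.
have fin : (\int[Pr]_w (`|g w| `^ p)%:E)%E \is a fin_num.
  rewrite ge0_fin_numE; first exact: le_lt_trans ubI (ltry _).
  by apply: integral_ge0 => w _; rewrite lee_fin powR_ge0.
have ig : Pr.-integrable setT (EFin \o (fun w => `|g w| `^ p)).
  apply/integrableP; split; first exact/measurable_EFinP.
  under eq_integral do rewrite /= ger0_norm ?powR_ge0//.
  exact: le_lt_trans ubI (ltry _).
split=> //.
  by apply: le_Rintegral => // w _; rewrite ge_min lexx.
by rewrite -lee_fin /Rintegral fineK.
Qed.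

(** Level j contributes at most 2^((j+1) q) K 2^(-3 m j), and q + 1 <= 3 m makes this at most 2^q K
    2^(-j). *)
Lemma dyadic_moment d (Z : measurableType d) (Pr : probability Z R)
  (g : Z -> R) (K : R) (m : nat) : measurable_fun setT g -> 0 <= K -> (q < 3 * m)%N ->
  (forall a, 0 < a -> (Pr [set w | (a <= `|g w|)%R] <= (K * (a ^- 3) ^+ m)%:E)%E) ->
  forall J, Rintegral Pr setT (fun w => trunc_norm (2 ^+ J) (g w) ^+ q) <= 1 + 2 ^+ q * K * 2.
Proof.
move=> mg K0 qm tl J.
have L0 j : 0 <= 2 ^+ j :> R by rewrite exprn_ge0.
have mE (j : nat) : measurable [set w | 2 ^+ j <= `|g w|].
  exact: measurable_norm_ge.
have [ii ei] := Rintegral_simple Pr J 1 (fun j => (2 ^+ j.+1) ^+ q) mE.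
have mt : measurable_fun setT (fun w => trunc_norm (2 ^+ J) (g w) ^+ q).
  apply: measurable_funX; apply: measurableT_comp => //.
  by apply: continuous_measurable_fun; exact: continuous_trunc_norm.
apply: (@le_trans _ _ (1 + \sum_(j < J) (2 ^+ j.+1) ^+ q * fine (Pr [set w | 2 ^+ j <= `|g w|]))).
  rewrite -ei; apply: le_Rintegral => //.
    apply: (@bounded_integrable _ _ _ _ _ ((2 ^+ J) ^+ q)) => // w.
    have /andP[h1 h2] := trunc_norm_itv (g w) (L0 J).
    by rewrite ger0_norm ?exprn_ge0// lerXn2r ?nnegrE.
  by move=> w _; exact: trunc_norm_dyadic.
rewrite lerD2l -mulrA.
apply: (@le_trans _ _ (\sum_(j < J) 2 ^+ q * K * (1 / 2) ^+ j)); last first.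
  rewrite -mulr_sumr mulrA ler_wpM2l ?mulr_ge0 ?exprn_ge0//.
  apply: (le_trans (@geometric_le R (1 / 2) J ltac:(lra) ltac:(lra))).
  by rewrite (_ : 1 - 1 / 2 = 2^-1) ?invrK//; lra.
apply: ler_sum => j _.
have h : fine (Pr [set w | 2 ^+ j <= `|g w|]) <= K * ((2 ^+ j) ^- 3) ^+ m.
  by rewrite -lee_fin fineK ?fin_num_measure//; apply: tl; rewrite exprn_gt0.
have q0 : 0 <= (2 ^+ j.+1) ^+ q :> R by rewrite !exprn_ge0.
apply: (le_trans (ler_wpM2l q0 h)).
have -> : (2 ^+ j.+1) ^+ q * (K * ((2 ^+ j) ^- 3) ^+ m) = 2 ^+ q * K * ((2 ^+ j) ^+ q * ((2 ^+ j) ^- 3) ^+ m) :> R.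
  by rewrite exprS exprMn; ring.
apply: ler_wpM2l; first by rewrite mulr_ge0// exprn_ge0.
rewrite div1r exprVn -exprVn exprVn -exprVn -!exprM exprVn ler_pdivrMr ?exprn_gt0//.
rewrite exprVn mulrC ler_pdivlMr ?exprn_gt0// -exprM -exprD ler_weXn2l ?ler1n//.
by rewrite -mulnA -[X in (_ + X <= _)%N]muln1 -mulnDr leq_mul2l addn1 qm orbT.
Qed.

End moments.

Lemma moment_cvg (R : realType) d d' (Omega : measurableType d)
  (Omega' : measurableType d') (P : probability Omega R) (P' : probability Omega' R)
  (u : nat -> Omega -> R) (uhat : Omega' -> R) (p : R) :
  (forall n, measurable_fun setT (u n)) -> measurable_fun setT uhat -> 0 < p ->
  (forall m, (4 <= m)%N -> exists2 K, 0 <= K & forall n a, 0 < a ->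
     (P [set w | (a <= `|u n w|)%R] <= (K * (a ^- 3) ^+ m)%:E)%E) ->
  (forall (f : R -> R) C, continuous f -> (forall x, `|f x| <= C) ->
     Rintegral P setT (f \o u n) @[n --> \oo] --> Rintegral P' setT (f \o uhat)) ->
  [/\ forall n, (\int[P]_w (`|u n w| `^ p)%:E)%E \is a fin_num,
    (\int[P']_w (`|uhat w| `^ p)%:E)%E \is a fin_num &
    Rintegral P setT (fun w => `|u n w| `^ p) @[n --> \oo] -->
      Rintegral P' setT (fun w => `|uhat w| `^ p)].
Proof.
move=> mu muhat p0 tails wk.
pose q := (Num.truncn (2 * p)).+1.
have pq : 2 * p <= q%:R by apply/ltW/truncnS_gt.
(* The order q + 4 is at least 4 and satisfies q < 3 (q + 4), as [dyadic_moment] requires. *)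
have [//|K K0 KP] := tails (q + 4)%N _; first by rewrite leq_addl.
have qm : (q < 3 * (q + 4))%N by lia.
pose D := 1 + 2 ^+ q * K * 2.
have D0 : 0 < 1 + D by rewrite addr_gt0// /D ltr_pwDl// mulr_ge0// mulr_ge0// exprn_ge0.
have HDn n J : Rintegral P setT (fun w => trunc_norm (2 ^+ J) (u n w) ^+ q) <= D.
  exact: dyadic_moment (mu n) K0 qm (KP n) J.
(* The tail bounds concern u n; the truncated moments of [uhat] inherit D as limits of expectations
   of bounded continuous functions. *)
have HD' J : Rintegral P' setT (fun w => trunc_norm (2 ^+ J) (uhat w) ^+ q) <= D.
  have L0 : 0 <= 2 ^+ J :> R by rewrite exprn_ge0.
  have := wk (fun x => trunc_norm (2 ^+ J) x ^+ q) ((2 ^+ J) ^+ q).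
  move=> /(_ _ _)/cvgr_to_le; apply.
  - move=> x; apply: (@continuous_comp _ _ _ (trunc_norm (2 ^+ J)) (fun y => y ^+ q)).
      exact: continuous_trunc_norm.
    exact: exprn_continuous.
  - move=> x; have /andP[h1 h2] := trunc_norm_itv x L0.
    by rewrite ger0_norm ?exprn_ge0// lerXn2r ?nnegrE.
  - by apply: nearW => n; exact: HDn.
have mt d0 (Z : measurableType d0) (Pr : probability Z R) (g : Z -> R) :=
  @moment_truncation R p q p0 pq _ Z Pr g D.
split.
- by move=> n; have [] := mt _ _ P _ 1 (mu n) ltr01 (HDn n).
- by have [] := mt _ _ P' _ 1 muhat ltr01 HD'.
apply/cvgrPdist_le => e e0; have e4 : 0 < e / 4 by rewrite divr_gt0.
(* Truncation at B costs at most e / 4 for each of the two laws, and the convergence of the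
   truncated powers another e / 4. *)
pose B := (1 + D) / (e / 4); have B0 : 0 < B by rewrite divr_gt0.
have DB : (1 + D) / B = e / 4 by rewrite /B invf_div mulrCA divff ?mulr1// gt_eqF.
have [_ a1 a2] := mt _ _ P' _ B muhat B0 HD'.
have := wk (fun x => Num.min (`|x| `^ p) B) B.
move=> /(_ _ _)/cvgrPdist_le/(_ _ e4).
have h1 : continuous (fun x : R => Num.min (`|x| `^ p) B).
  by move=> x; apply: (@continuous_min _ _ (fun x : R => `|x| `^ p) (fun=> B)); [exact: continuous_norm_powR|exact: cst_continuous].
have h2 (x : R) : `|Num.min (`|x| `^ p) B| <= B.
  by rewrite ger0_norm ?le_min ?powR_ge0 ?(ltW B0)// ge_min lexx orbT.
move=> /(_ h1 h2); apply: filterS => n.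
have [_ b1 b2] := mt _ _ P _ B (mu n) B0 (HDn n).
rewrite DB in a2 b2; rewrite /comp !ler_distl => /andP[c1 c2].
by apply/andP; split; lra.
Qed.

(** Limits at 0+ are tested on sequences, and each sequence in (0, 1] consists of cubes; this
    matches the rescaling by rho with eps = rho^3. *)
Lemma cvg_at_right_cube (R : realType) (L : R -> \bar R) (l : \bar R) : l \is a fin_num ->
  (forall rho : nat -> R, (forall n, 0 < rho n <= 1) -> rho n @[n --> \oo] --> 0 ->
     (forall n, L (rho n ^+ 3) \is a fin_num) /\ fine (L (rho n ^+ 3)) @[n --> \oo] --> fine l) ->
  L @ 0^'+ --> l.
Proof.
move=> lf H; rewrite -(fineK lf).
have root01 (e : R) : 0 < e <= 1 -> 0 < e `^ 3^-1 <= 1 /\ (e `^ 3^-1) ^+ 3 = e.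
  move=> /andP[e0 e1].
  have E : (e `^ 3^-1) ^+ 3 = e by rewrite -powR_mulrn ?powR_ge0// -powRrM mulVf// powRr1// ltW.
  split=> //; rewrite powR_gt0//=; rewrite -(@ler_pXn2r _ 3)// ?nnegrE ?powR_ge0//.
  by rewrite E expr1n.
apply/fine_cvgP; split.
  near=> eps; have eps01 : 0 < eps <= 1.
    by apply/andP; split; near: eps; [exact: nbhs_right_gt|exact: nbhs_right_le].
  have [/andP[r0 r1] rE] := root01 _ eps01.
  (* Makes eps the term n = 0 of a valid sequence, from which finiteness at eps is read off. *)
  pose rho n := eps `^ 3^-1 * n.+1%:R^-1.
  have rho01 n : 0 < rho n <= 1.
    rewrite mulr_gt0// ?invr_gt0//=; apply: mulr_ile1 => //; rewrite ?invr_ge0//; first exact: ltW.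
    by rewrite invf_le1// ler1n.
  have rho_cvg : rho n @[n --> \oo] --> 0.
    by rewrite -[X in _ --> X](mulr0 (eps `^ 3^-1)); apply: cvgMr; exact: cvg_harmonic.
  by have [/(_ 0%N) + _] := H rho rho01 rho_cvg; rewrite /rho invr1 mulr1 rE.
apply/cvg_at_rightP => e [e0 e_cvg].
(* A sequence tending to 0 may exceed 1 at first; the cap changes finitely many terms. *)
pose e1 n := Num.min (e n) 1.
have e1_01 n : 0 < e1 n <= 1 by rewrite lt_min e0 ltr01 ge_min lexx orbT.
have e1E : \forall n \near \oo, e1 n = e n.
  by near=> n; apply: min_l; near: n; apply: (cvgr_le (0 : R)).
have e1_cvg : e1 n @[n --> \oo] --> 0.
  by apply: cvg_trans e_cvg; apply: near_eq_cvg; apply: filterS e1E => n ->.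
pose rho n := e1 n `^ 3^-1.
have rho01 n : 0 < rho n <= 1 by have [] := root01 _ (e1_01 n).
have rho_cvg : rho n @[n --> \oo] --> 0.
  have := @powR_cvg0 R 3^-1; rewrite invr_gt0 => /(_ (ltr0n _ 3)) /cvg_at_rightP; apply.
  by split => // n; case/andP: (e1_01 n).
have [_] := H rho rho01 rho_cvg; apply: cvg_trans; apply: near_eq_cvg.
apply: filterS e1E => n; have [_] := root01 _ (e1_01 n).
by rewrite /= /rho => -> ->.
Unshelve. all: by end_near. Qed.

Unset Implicit Arguments.

Theorem theorem1 (R : realType) (d : measure_display) (Omega : measurableType d)
  (P : probability Omega R)
  (T alpha beta th0 : R) (S : R -> R -> R) (h g : R -> R)
  (W : R -> Omega -> R) (J : R -> Omega -> R)
  (thhat : R -> Omega -> R) (vhat : R) :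
  0 < alpha -> alpha < beta -> beta < T -> alpha < th0 < beta ->
  (* S(theta0, .) in L^2(0,T) *)
  measurable_fun `[0, T] (S th0) ->
  (@lebesgue_measure R).-integrable `[0, T] (fun t => (S th0 t ^+ 2)%:E) ->
  (* h, g bounded measurable on [0,T] *)
  measurable_fun `[0, T] h -> measurable_fun `[0, T] g ->
  (exists C : R, forall t, 0 <= t <= T -> `|h t| <= C) ->
  (exists C : R, forall t, 0 <= t <= T -> `|g t| <= C) ->
  (* W standard Wiener process on [0,T] *)
  is_wiener P `[0, T] W ->
  (* J th = \int_0^T M(th,t) dW_t, in a version continuous in th *)
  (forall th, alpha <= th <= beta -> is_wiener_integral P W T (Mtrend h g th) (J th)) ->
  (forall w, {within `[alpha, beta], continuous (fun th => J th w)}) ->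
  (* thhat eps is a measurable point of maximum of V(., X^T) over [alpha,beta] *)
  (forall eps, 0 < eps <= 1 ->
     measurable_fun setT (thhat eps) /\
     forall w, alpha <= thhat eps w <= beta /\
       forall th, alpha <= th <= beta ->
         pseudo_lik T h g (S th0) J eps th w <= pseudo_lik T h g (S th0) J eps (thhat eps w) w) ->
  (* Conditions M *)
  (* (1) *) (exists c : R, 0 < c /\ forall t, alpha < t < beta -> c <= h t - g t) ->
  (* (2) *) alpha < vhat < beta ->
            (forall th, alpha < th < beta -> Phi T h g (S th0) vhat <= Phi T h g (S th0) th) ->
            (forall th, alpha < th < beta -> Phi T h g (S th0) th = Phi T h g (S th0) vhat -> th = vhat) ->
  (* (3) *) C1_on alpha beta h -> C1_on alpha beta g -> C1_on alpha beta (S th0) ->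
  (* (4) *) (exists c : R, 0 < c /\ forall th, alpha < th < beta -> c <= Phidd h g (S th0) th) ->
  (* consistency *)
  (forall eta : R, 0 < eta ->
     (fun eps => P [set w | eta < `|thhat eps w - vhat|]) @ 0^'+ --> 0%E) /\
  (* limit law and moments: for any uhat = argsup_u [delta(vhat) W2(u) - gamma/2 u^2]
     with W2 a two-sided standard Wiener process *)
  (forall (d' : measure_display) (Omega' : measurableType d') (P' : probability Omega' R)
          (W2 : R -> Omega' -> R) (uhat : Omega' -> R),
     is_wiener P' setT W2 ->
     measurable_fun setT uhat ->
     {ae P', forall w, forall u : R,
        (h vhat - g vhat) * W2 u w - (Phidd h g (S th0) vhat / 2) / 2 * u ^+ 2
        <= (h vhat - g vhat) * W2 (uhat w) w - (Phidd h g (S th0) vhat / 2) / 2 * uhat w ^+ 2} ->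
     (forall f : R -> R, continuous f -> (exists C : R, forall x, `|f x| <= C) ->
        (fun eps => (\int[P]_w (f ((thhat eps w - vhat) / eps `^ (2 / 3)))%:E)%E)
          @ 0^'+ --> (\int[P']_w (f (uhat w))%:E)%E) /\
     (forall p : R, 0 < p ->
        (fun eps => (\int[P]_w ((`|(thhat eps w - vhat) / eps `^ (2 / 3)|) `^ p)%:E)%E)
          @ 0^'+ --> (\int[P']_w ((`|uhat w|) `^ p)%:E)%E)).
Proof.
move=> al0 albe beT th0_in mS iS mh mg [Ch bh] [Cg bg] HW HJ cJ thP [c1 [c10 c1P]] v_in vmin vuniq
  h1 g1 S1 [c [c0 cP]].
set dl := h vhat - g vhat; set D := Phidd h g (S th0) vhat.
have dl0 : 0 < dl by apply: lt_le_trans c10 _; exact: c1P.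
have D0 : 0 < D / 2 by rewrite divr_gt0//; apply: lt_le_trans c0 _; exact: cP.
pose C := Ch + Cg.
have dC t : 0 <= t <= T -> `|h t - g t| <= C.
  by move=> tT; apply: (le_trans (ler_normB _ _)); apply: lerD; [exact: bh|exact: bg].
have cC1 f t : C1_on alpha beta f -> alpha < t < beta -> {for t, continuous f}.
  by move=> Hf tI; exact: (C1_continuous Hf).
have dcont t : alpha < t < beta -> {for t, continuous (fun t => h t - g t)}.
  by move=> tI; apply: continuousB; [exact: cC1 h1 tI|exact: cC1 g1 tI].
(* With F half of [Phi], the constant c / 2 of [Phi_quadratic_lb] becomes c / 4, and the curvature
   of F is D / 2, that is gamma. *)
pose G := jump_energy alpha h g; pose F t := Phi T h g (S th0) t / 2.
have GJ : gauss_incr P `[alpha, beta] G J.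
  exact: (gauss_incr_J al0 albe beT c10 mh mg dC c1P dcont HW HJ).
have Glb a b : alpha <= a -> a <= b -> b <= beta -> c1 ^+ 2 * (b - a) <= G b - G a.
  exact: (jump_energy_lb al0 beT c10 mh mg dC c1P).
have Gub a b : alpha <= a -> a <= b -> b <= beta -> G b - G a <= C ^+ 2 * (b - a).
  exact: (jump_energy_ub al0 beT mh mg dC).
have Flb t : alpha <= t <= beta -> c / 4 * (t - vhat) ^+ 2 <= F t - F vhat.
  move=> /(Phi_quadratic_lb al0 beT mh mg mS iS bh bg v_in vmin h1 g1 S1 cP); rewrite /F; lra.
have cF x : alpha < x < beta -> {for x, continuous F}.
  by move=> xI; apply: cvgMl; exact: (Phi_continuous al0 beT mh mg mS iS bh bg h1 g1 S1 xI).
have G_slope e : 0 < e -> exists2 r, 0 < r & forall t, alpha <= t <= beta ->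
    `|t - vhat| <= r -> `|G t - G vhat - dl ^+ 2 * (t - vhat)| <= e * `|t - vhat|.
  exact: (jump_energy_slope al0 beT mh mg dC dcont v_in).
have F_taylor e : 0 < e -> exists2 r, 0 < r & forall t, alpha <= t <= beta ->
    `|t - vhat| <= r -> `|F t - F vhat - D / 2 / 2 * (t - vhat) ^+ 2| <= e * (t - vhat) ^+ 2.
  move=> e0; have [r r0 H] := Phi_taylor al0 beT mh mg mS iS bh bg v_in vmin h1 g1 S1 e0.
  exists r => // t tI tr; have := H t tI tr; rewrite -/D /F !ler_distl => /andP[a1 a2].
  have := sqr_ge0 (t - vhat); move: (_ ^+ 2) a1 a2 => y a1 a2 y0.
  have := mulr_ge0 (ltW e0) y0; move=> ey; apply/andP; split; lra.
have thmax eps : 0 < eps <= 1 -> measurable_fun setT (thhat eps) /\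
    forall w, alpha <= thhat eps w <= beta /\ forall t, alpha <= t <= beta ->
      eps * J t w - F t <= eps * J (thhat eps w) w - F (thhat eps w).
  move=> eps01; have [mth H] := thP eps eps01; split => // w.
  have [thI Hw] := H w; split => // t /Hw; case/andP: eps01 => eps0 _.
  rewrite !(pseudo_likE mh mg mS iS bh bg)// ler_expR ler_pM2l ?invr_gt0 ?exprn_gt0//.
  by rewrite lerD2r.
have c20 : 0 < c1 ^+ 2 by rewrite exprn_gt0.
have k0 : 0 < c / 4 by rewrite divr_gt0.
have tail := rate_tail v_in c20 (sqr_ge0 C) k0 GJ cJ Glb Gub Flb thmax.
have cube01 (r : R) : 0 < r <= 1 -> 0 < r ^+ 3 <= 1.
  by case/andP => r0 r1; rewrite exprn_gt0// exprn_ile1// ltW.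
split.
  (* With m = 4 the tail bound at eta is K rho^24 / eta^12, hence at most K rho / eta^12. *)
  move=> eta eta0; have [K K0 KP] := tail 4%N (leqnn _).
  have meta eps : 0 < eps <= 1 -> measurable [set w | eta < `|thhat eps w - vhat|].
    move=> /thmax[mth _]; apply: measurable_gt; apply: measurableT_comp => //.
    exact: measurable_funB.
  apply: cvg_at_right_cube => // rho rho01 rho_cvg.
  split; first by move=> n; apply: fin_num_measure; exact: meta (cube01 _ (rho01 n)).
  have bound_cvg : K / eta ^+ 12 * rho n @[n --> \oo] --> 0.
    by rewrite -[X in _ --> X](mulr0 (K / eta ^+ 12)); apply: cvgMr.
  apply: (squeeze_cvgr _ (cvg_cst 0) bound_cvg); apply: nearW => n.
  have [r0 r1] : 0 < rho n /\ rho n <= 1 by apply/andP.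
  have r3 := cube01 _ (rho01 n).
  rewrite fine_ge0//=; rewrite -lee_fin fineK; last by apply: fin_num_measure; exact: meta.
  apply: (@le_trans _ _ (P [set w | (eta <= `|thhat (rho n ^+ 3) w - vhat|)%R])).
    apply: le_measure; rewrite ?inE//; first exact: meta.
      have [mth _] := thmax _ r3.
      by apply: measurable_norm_ge; exact: measurable_funB.
    by move=> w /=; exact: ltW.
  apply: (le_trans (KP _ r3 _ eta0)); rewrite lee_fin.
  have -> : K * ((rho n ^+ 3) ^+ 2 / eta ^+ 3) ^+ 4 = K / eta ^+ 12 * rho n ^+ 24.
    by field; rewrite gt_eqF.
  apply: ler_wpM2l; first by rewrite divr_ge0// exprn_ge0// ltW.
  by rewrite -[leRHS]expr1 ler_wiXn2l// ltW.
move=> d' Omega' P' W2 uhat HW2 muhat uhatP.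
pose u (rho : nat -> R) := rescaled_argmax vhat thhat rho.
have mu (rho : nat -> R) : (forall n, 0 < rho n <= 1) -> forall n, measurable_fun setT (u rho n).
  move=> rho01 n; have r3 := cube01 _ (rho01 n).
  by have [mth _] := thmax _ r3; apply: measurable_funM => //; exact: measurable_funB.
have utail (rho : nat -> R) : (forall n, 0 < rho n <= 1) -> forall m, (4 <= m)%N -> exists2 K, 0 <= K &
    forall n a, 0 < a -> (P [set w | (a <= `|u rho n w|)%R] <= (K * (a ^- 3) ^+ m)%:E)%E.
  move=> rho01 m m4; have [K K0 KP] := tail m m4; exists K => // n a a0.
  have [r0 r1] : 0 < rho n /\ rho n <= 1 by apply/andP.
  have r3 := cube01 _ (rho01 n).
  have r2 : 0 < rho n ^+ 2 by rewrite exprn_gt0.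
  have ra : 0 < rho n ^+ 2 * a by rewrite mulr_gt0.
  have := KP _ r3 _ ra.
  have -> : (rho n ^+ 3) ^+ 2 / (rho n ^+ 2 * a) ^+ 3 = a ^- 3.
    by field; rewrite !gt_eqF.
  congr (P _ <= _)%E; apply/seteqP; split => w /=; rewrite /u /rescaled_argmax normrM normfV (gtr0_norm r2).
    by rewrite ler_pdivlMr// mulrC.
  by rewrite ler_pdivlMr// mulrC.
have weak (rho : nat -> R) : (forall n, 0 < rho n <= 1) -> rho n @[n --> \oo] --> 0 ->
    forall (f : R -> R) C, continuous f -> (forall x, `|f x| <= C) ->
     Rintegral P setT (f \o u rho n) @[n --> \oo] --> Rintegral P' setT (f \o uhat).
  move=> rho01 rho_cvg f Cf cf fC.
  have tl kap : 0 < kap -> exists2 K, 0 < K & forall n, (P [set w | (K <= `|u rho n w|)%R] <= kap%:E)%E.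
    move=> kap0; have [K K0 KP] := utail rho rho01 4%N (leqnn _).
    (* For a >= 1 the bound K (a^(-3))^4 is at most K / a, hence at most kap when also a >= K /
       kap. *)
    pose a := Num.max 1 (K / kap).
    have a1 : 1 <= a by rewrite le_max lexx.
    have a0 : 0 < a by apply: lt_le_trans a1.
    exists a => // n; apply: (le_trans (KP n a a0)); rewrite lee_fin.
    apply: (@le_trans _ _ (K * a^-1)).
      apply: ler_wpM2l => //; rewrite -exprVn -exprM -[leRHS]expr1.
      by apply: ler_wiXn2l => //; rewrite ?invr_ge0 ?(ltW a0)// invf_le1.
    by rewrite ler_pdivrMr// mulrC -ler_pdivrMr// le_max lexx orbT.
  apply: (weak_cvg (mu rho rho01) muhat tl _ cf fC).
  apply: (half_line_limsup (mu rho rho01) muhat tl) => sg x K s kap sg2 K0 s0 kap0.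
  have HA e (e0 : 0 < e) := rescaled_cvg v_in dl0 G_slope F_taylor rho01 rho_cvg K0 e0.
  have HB := rescaled_admissible v_in c20 GJ cJ Glb thmax dl0 cF rho01 rho_cvg K0.
  exact: (argmax_limsup x dl0 D0 K0 s0 sg2 HW2 muhat uhatP HA HB kap0).
have pw (r : R) : 0 < r <= 1 -> (r ^+ 3) `^ (2 / 3) = r ^+ 2.
  move=> /andP[r0 _]; have r00 := ltW r0.
  by rewrite -(powR_mulrn 3 r00) -powRrM mulrC divfK// powR_mulrn.
split.
  move=> f cf [Cf fC]; have mf : measurable_fun setT f by exact: continuous_measurable_fun.
  have fin d0 (Z : measurableType d0) (Pr : probability Z R) (k : Z -> R) :
    measurable_fun setT k -> (\int[Pr]_w (f (k w))%:E)%E \is a fin_num.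
    move=> mg0; apply: integrable_fin_num => //.
    by apply: (@bounded_integrable _ _ _ Pr (f \o k) Cf) => [|w]; [exact: measurableT_comp|exact: fC].
  apply: cvg_at_right_cube.
  - exact: fin.
  - move=> rho rho01 rho_cvg; split.
      move=> n; apply: fin; apply: measurable_funM => //; apply: measurable_funB => //.
      by have [] := thmax _ (cube01 _ (rho01 n)).
    have := weak rho rho01 rho_cvg f Cf cf fC.
    apply: cvg_trans; apply: near_eq_cvg; apply: nearW => n.
    by rewrite /= (pw _ (rho01 n)).
move=> p p0.
have mc (rho : nat -> R) (rho01 : forall n, 0 < rho n <= 1) (rho_cvg : rho n @[n --> \oo] --> 0) :=
  moment_cvg (mu rho rho01) muhat p0 (utail rho rho01) (weak rho rho01 rho_cvg).
apply: cvg_at_right_cube.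
(* Finiteness of the limit moment does not involve rho, so it is read off the sequence 1 / (n +
   1). *)
- by have [_ + _] := mc (fun n => n.+1%:R^-1) (fun n => ltac:(by rewrite invr_gt0 ltr0n invf_le1 ?ler1n)) (@cvg_harmonic R).
- move=> rho rho01 rho_cvg; have [fn _ cv] := mc rho rho01 rho_cvg.
  split; first by move=> n; have := fn n; rewrite /u /rescaled_argmax -(pw _ (rho01 n)).
  move: cv; apply: cvg_trans; apply: near_eq_cvg; apply: nearW => n.
  by rewrite /= (pw _ (rho01 n)).
Qed.
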